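(* Let $p\ge 1$ be an integer and let $\phi$ be a bounded radial function on $\mathbb{D}$ whose Mellin transform is a proper rational fraction $$\widehat{\phi}(z)=\frac{P(z)}{Q(z)}\quad(\Re z>2),\qquad P(z)=\prod_{j=1}^m (z+a_j),\qquad Q(z)=\prod_{k=1}^n (z+b_k),\qquad 1\le m<n.$$ Assume that the numbers $$A_j=\frac{a_j+p+1}{2p}\ (1\le j\le m)\qquad\text{and}\qquad B_k=\frac{b_k+p-1}{2p}\ (1\le k\le n)$$ are all (real and) positive. Then there exists a bounded radial function $\psi$ on $\mathbb{D}$ such that $$\left(T_{e^{i\theta}\psi}\right)^p=T_{e^{ip\theta}\phi},$$ i.e. the Toeplitz operator $T_{e^{i\theta}\psi}$ is a $p$-th root of $T_{e^{ip\theta}\phi}$.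
   Context: $\mathbb{D}$ is the unit disc in $\mathbb{C}$ and $dA=r\,dr\,\frac{d\theta}{\pi}$ is normalized area measure on $\mathbb{D}$. $L^2_a$ is the Bergman space of analytic functions on $\mathbb{D}$ that are square integrable with respect to $dA$, and $P_{L^2_a}$ is the orthogonal projection of $L^2(\mathbb{D},dA)$ onto $L^2_a$. For a bounded (measurable) function $f$ on $\mathbb{D}$, the Toeplitz operator $T_f:L^2_a\to L^2_a$ is $T_f(h)=P_{L^2_a}(fh)$. A function on $\mathbb{D}$ is radial if it depends only on $r=|z|$; it is identified with a function of $r\in[0,1)$. For radial $\phi$, $T_{e^{ip\theta}\phi}$ denotes the Toeplitz operator with symbol $re^{i\theta}\mapsto e^{ip\theta}\phi(r)$. The Mellin transform of a radial function $\phi\in L^1([0,1],r\,dr)$ is $\widehat{\phi}(z)=\int_0^1\phi(r)r^{z-1}\,dr$, which is analytic on $\{z:\Re z>2\}$. *)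

(* Defs.v *)
From HB Require Import structures.
From mathcomp Require Import all_boot all_order all_algebra.
From mathcomp Require Import complex.
From mathcomp Require Import all_classical all_reals all_analysis.

Set Implicit Arguments.
Unset Strict Implicit.
Unset Printing Implicit Defensive.

Import Order.TTheory GRing.Theory Num.Theory.
Import numFieldNormedType.Exports.

Local Open Scope classical_set_scope.
Local Open Scope ring_scope.
Local Open Scope complex_scope.

Section Defs.
Variable R : realType.

Local Notation leb := (@lebesgue_measure R).
Local Notation normc := (@Normc.normc R).

Definition disk : set R[i] := [set z | normc z < 1].

Definition cintegral d (T : measurableType d)
    (mu : {measure set T -> \bar R}) (D : set T) (f : T -> R[i]) : R[i] :=
  Rintegral mu D (fun x => complex.Re (f x)) +i*
  Rintegral mu D (fun x => complex.Im (f x)).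

(* The measure dA = r dr dtheta / pi is handled in polar coordinates: an
   integral over the disk is an integral over the box of all (r, theta) with
   0 <= r < 1 and 0 <= theta < 2 pi, with density r / pi.  Complex-valued
   functions on the disk are total functions on R[i]; their values outside
   the disk are never looked at. *)
Definition polar (x : R * R) : R[i] := (x.1 * cos x.2) +i* (x.1 * sin x.2).

Definition polar_box : set (R * R) := `[0, 1[ `*` `[0, 2 * pi[.

Definition area_integral (f : R[i] -> R[i]) : R[i] :=
  cintegral (leb \x leb)%E polar_box
    (fun x => (x.1 / pi)%:C * f (polar x)).

Definition square_integrable (f : R[i] -> R[i]) : Prop :=
  (leb \x leb)%E.-integrable polar_box
    (fun x => (normc (f (polar x)) ^+ 2 * (x.1 / pi))%:E).

Definition inner (f g : R[i] -> R[i]) : R[i] :=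
  area_integral (fun z => f z * (g z)^*).

(* R[i]^o is R[i] as a normed space over itself, so derivability in the
   direction 1 is complex differentiability. *)
Definition analytic_on_disk (f : R[i] -> R[i]) : Prop :=
  forall z : R[i], disk z -> derivable (f : R[i]^o -> R[i]^o) z 1.

Definition bergman (f : R[i] -> R[i]) : Prop :=
  analytic_on_disk f /\ square_integrable f.

(* [g] is the orthogonal projection of [u] onto the Bergman space *)
Definition is_bergman_proj (u g : R[i] -> R[i]) : Prop :=
  bergman g /\ forall k, bergman k -> inner (fun z => u z - g z) k = 0.

(* For u in L^2(D, dA) such a g exists, because the Bergman space is closed
   in L^2, and is unique on the disk; the default value 0 is then not used. *)
Definition bergman_proj (u : R[i] -> R[i]) : R[i] -> R[i] :=
  xget (fun=> 0) [set g | is_bergman_proj u g].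

Definition toeplitz (f h : R[i] -> R[i]) : R[i] -> R[i] :=
  bergman_proj (fun z => f z * h z).

(* A radial function is given by its profile phi on [0, 1). *)
Definition bounded_radial (phi : R -> R[i]) : Prop :=
  [/\ measurable_fun (`[0, 1[ : set R) (fun r => complex.Re (phi r)),
      measurable_fun (`[0, 1[ : set R) (fun r => complex.Im (phi r)) &
      exists M : R, forall r : R, 0 <= r < 1 -> normc (phi r) <= M].

(* The symbol r e^(i theta) |-> e^(i p theta) phi(r).  The value at the origin,
   where theta is not defined, is irrelevant. *)
Definition quasihomogeneous (p : nat) (phi : R -> R[i]) (z : R[i]) : R[i] :=
  (z / (normc z)%:C) ^+ p * phi (normc z).

(* r ^ w for r > 0 and w complex *)
Definition rpowc (r : R) (w : R[i]) : R[i] :=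
  (r `^ complex.Re w)%:C *
  (cos (complex.Im w * ln r) +i* sin (complex.Im w * ln r)).

Definition mellin (phi : R -> R[i]) (z : R[i]) : R[i] :=
  cintegral leb `]0, 1[ (fun r => phi r * rpowc r (z - 1)).

End Defs.

(* Main.v *)
Require Import Defs.
From HB Require Import structures.
From mathcomp Require Import all_boot all_order all_algebra.
From mathcomp Require Import complex.
From mathcomp Require Import all_classical all_reals all_analysis.
From mathcomp Require Import measurable_realfun.
From mathcomp Require Import ring lra zify.
Set Implicit Arguments.
Unset Strict Implicit.
Unset Printing Implicit Defensive.
Import Order.TTheory GRing.Theory Num.Theory.
Import numFieldNormedType.Exports.
Local Open Scope classical_set_scope.
Local Open Scope ring_scope.
Local Open Scope complex_scope.

(** A Toeplitz operator with symbol [e^(iq theta) phi(r)] acts on Taylor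
    coefficients as a weighted shift whose weights are moments of [phi]:
    [z^k] goes to [2 (k + q + 1) M_phi(2k + q + 1) z^(k + q)], where [M_phi(n)]
    is the integral of [phi(r) r^n].  The operator identity therefore amounts
    to a product formula for moments of [psi], and, after normalizing [psi] by
    a constant, to prescribing the ratios [M_psi(n + 2p) / M_psi(n)] for even
    [n >= 2].  With [z = n + 1] the required ratio is a product of factors
    [(z + alpha) / (z + delta)] with [alpha > 0] whose total excess, the sum of
    the [delta - alpha], is [2p (1 + e)] for some [e >= 0].  A profile
    [r^beta (1 - r^(2p))^e] realizes [(z + beta) / (z + beta + 2p (1 + e))],
    and an infinite product of operators [1 + kap H_a H_b], where [H_a]
    multiplies Mellin transforms by [(z + a)^-1], inserts one balanced pair of
    factors at a time; it keeps the profile bounded and so replaces the usual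
    argument with quotients of Gamma functions.

    Power series expansions on the disk come from integrating over circles
    through the cone [(t, theta) |-> z0 + t (r e^(i theta) - z0)] and bisecting
    rectangles, as in Goursat's proof. *)

(** * Complex-valued functions of a real variable *)

(** The positivity hypotheses are the condition [alpha > 0] of the recursion. At [z = n + 1] the
    ratio compares the rational fraction at [z + p + 1] and at [z + p - 1], so its numerator shifts
    are [a_j + p + 1 = 2p A_j] and [b_k + p - 1 = 2p B_k]. The weights [2 (k + q + 1)] add one more
    factor [(z + 1) / (z + 2p - 1)], of excess [2p - 2]. Each [a_j] has excess [-2] and each [b_k]
    has excess [2], so the total is [2p + 2 (n - m - 1)], and [m < n] gives
    [e = (n - m - 1) / p >= 0]. A single factor cannot be inserted by an infinite product: the
    general term would be [1 + c / j] up to smaller terms, which diverges. It is therefore inserted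
    together with an auxiliary factor of opposite excess; the terms of order [1 / j] cancel and the
    general term becomes [1 + O(1 / j^2)]. The auxiliary parameter is handed from one insertion to
    the next, and what it leaves at the end cancels the ratio of the initial profile
    [r^beta (1 - r^(2p))^e]. *)

Section ComplexNorm.
Variable R : realType.
Implicit Types (x y z : R[i]) (r : R).
Local Notation nc := (@Normc.normc R).
Local Notation cj := (@conjc R).

Lemma normc_sqrtE z : nc z = Num.sqrt (complex.Re z ^+ 2 + complex.Im z ^+ 2).
Proof. by case: z. Qed.

Lemma normr_normc z : `|z| = (nc z)%:C.
Proof. by rewrite normc_def normc_sqrtE. Qed.

Lemma normc_ge0 z : 0 <= nc z.
Proof. by rewrite normc_sqrtE sqrtr_ge0. Qed.

Lemma sqr_normcE z : nc z ^+ 2 = complex.Re z ^+ 2 + complex.Im z ^+ 2.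
Proof. by rewrite normc_sqrtE sqr_sqrtr// addr_ge0// sqr_ge0. Qed.

Lemma normc_eq0 z : (nc z == 0) = (z == 0).
Proof.
by apply/eqP/eqP => [/Normc.eq0_normc//|->]; rewrite Normc.normc0.
Qed.

Lemma normc_gt0 z : (0 < nc z) = (z != 0).
Proof. by rewrite lt_neqAle normc_ge0 andbT eq_sym normc_eq0. Qed.

Lemma normcR r : nc r%:C = `|r|.
Proof. by rewrite normc_sqrtE/= expr0n/= addr0 sqrtr_sqr. Qed.

Lemma normcX z n : nc (z ^+ n) = nc z ^+ n.
Proof.
by elim: n => [|n IH]; rewrite ?expr0 ?Normc.normc1// !exprS Normc.normcM IH.
Qed.

Lemma normc_conj z : nc (cj z) = nc z.
Proof. by case: z => a b; rewrite !normc_sqrtE/= sqrrN. Qed.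

Lemma ler_normcB x y : nc (x - y) <= nc x + nc y.
Proof. by rewrite (le_trans (le_normcD _ _))// normcN. Qed.

Lemma normc_distC x y : nc (x - y) = nc (y - x).
Proof. by rewrite -normcN opprB. Qed.

Lemma ler_normc_sum I (s : seq I) (P : pred I) (F : I -> R[i]) :
  nc (\sum_(i <- s | P i) F i) <= \sum_(i <- s | P i) nc (F i).
Proof.
elim/big_rec2: _ => [|i u v _ uv]; first by rewrite Normc.normc0.
by rewrite (le_trans (le_normcD _ _))// lerD2l.
Qed.

Lemma ger_normc_Re z : `|complex.Re z| <= nc z.
Proof.
by rewrite -sqrtr_sqr normc_sqrtE ler_sqrt ?addr_ge0 ?sqr_ge0// lerDl sqr_ge0.
Qed.

Lemma ger_normc_Im z : `|complex.Im z| <= nc z.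
Proof.
by rewrite -sqrtr_sqr normc_sqrtE ler_sqrt ?addr_ge0 ?sqr_ge0// lerDr sqr_ge0.
Qed.

Lemma ler_normc_ReIm z : nc z <= `|complex.Re z| + `|complex.Im z|.
Proof.
rewrite -(@ler_pXn2r _ 2) ?nnegrE ?normc_ge0 ?addr_ge0//.
rewrite sqr_normcE -[complex.Re z ^+ 2]real_normK ?num_real//.
rewrite -[complex.Im z ^+ 2]real_normK ?num_real//.
have := normr_ge0 (complex.Re z); have := normr_ge0 (complex.Im z).
by move: (`|_|) (`|_|) => u v u0 v0; nra.
Qed.

Lemma mulc_conj z : z * cj z = (nc z ^+ 2)%:C.
Proof.
case: z => a b; rewrite sqr_normcE /=; apply/eqP; rewrite eq_complex/=.
by apply/andP; split; apply/eqP; ring.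
Qed.

Lemma RecD x y : complex.Re (x + y) = complex.Re x + complex.Re y.
Proof. by case: x y => [? ?] [? ?]. Qed.
Lemma ImcD x y : complex.Im (x + y) = complex.Im x + complex.Im y.
Proof. by case: x y => [? ?] [? ?]. Qed.
Lemma RecM x y : complex.Re (x * y) =
  complex.Re x * complex.Re y - complex.Im x * complex.Im y.
Proof. by case: x y => [? ?] [? ?]. Qed.
Lemma ImcM x y : complex.Im (x * y) =
  complex.Re x * complex.Im y + complex.Im x * complex.Re y.
Proof. by case: x y => [? ?] [? ?]. Qed.
Lemma RecZ r y : complex.Re (r%:C * y) = r * complex.Re y.
Proof. by rewrite RecM/= mul0r subr0. Qed.
Lemma RecN x : complex.Re (- x) = - complex.Re x. Proof. by case: x. Qed.
Lemma ImcN x : complex.Im (- x) = - complex.Im x. Proof. by case: x. Qed.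
Lemma Re_sum I (s : seq I) (P : pred I) (F : I -> R[i]) :
  complex.Re (\sum_(i <- s | P i) F i) = \sum_(i <- s | P i) complex.Re (F i).
Proof. exact: (big_morph _ RecD). Qed.

Lemma conjcM x y : cj (x * y) = cj x * cj y.
Proof. exact: rmorphM. Qed.
Lemma conjcX x n : cj (x ^+ n) = cj x ^+ n.
Proof. exact: rmorphXn. Qed.

Lemma complex_eqP x y : complex.Re x = complex.Re y ->
  complex.Im x = complex.Im y -> x = y.
Proof. by case: x y => [? ?] [? ?] /= -> ->. Qed.

Lemma derivable_complexP (f : R[i] -> R[i]) z :
  derivable (f : R[i]^o -> R[i]^o) z 1 <->
  exists l, forall e, 0 < e -> exists2 d, 0 < d & forall h, nc h < d ->
    nc (f (z + h) - f z - l * h) <= e * nc h.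
Proof.
split.
- move=> /cvg_ex[/= l] /cvgrPdist_le hl; exists l => e e0.
  have eC : (0 : R[i]) < e%:C by rewrite ltcR.
  have [/= d d0 hd] := hl _ eC.
  have dE : d = (complex.Re d)%:C.
    by move: d0; rewrite ltcE/= => /andP[/eqP]; case: (d) => a b /= ->.
  exists (complex.Re d); first by move: d0; rewrite dE ltcR.
  move=> h hlt; have [->|h0] := eqVneq h 0.
    by rewrite addr0 subrr mulr0 subr0 Normc.normc0 mulr0.
  have := hd h; rewrite /ball_/= sub0r normrN normr_normc dE ltcR => /(_ hlt h0).
  rewrite normr_normc lecR => H.
  have -> : f (z + h) - f z - l * h =
     - (l - (h^-1 *: (f (h *: 1%R + z) - f z))) * h.
    have -> : h *: (1:R[i]^o) = h by rewrite -[_ *: _]/(h * 1) mulr1.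
    rewrite -[_ *: _]/(_ * _) (addrC h); field.
    by [].
  by rewrite Normc.normcM normcN ler_wpM2r// normc_ge0.
- move=> [l hl]; apply/cvg_ex; exists l; apply/cvgrPdist_le => e e0.
  have eE : e = (complex.Re e)%:C.
    by move: e0; rewrite ltcE/= => /andP[/eqP]; case: (e) => a b /= ->.
  have e0' : 0 < complex.Re e by move: e0; rewrite eE ltcR.
  have [d d0 hd] := hl _ e0'.
  exists d%:C; first by rewrite /= ltcR.
  move=> h; rewrite /ball_/= sub0r normrN normr_normc ltcR => hlt h0.
  rewrite normr_normc eE lecR.
  have := hd h hlt; rewrite -ler_pdivrMr ?normc_gt0// => H.
  apply: le_trans H.
  rewrite -Normc.normcV -Normc.normcM -normcN.
  rewrite le_eqVlt; apply/orP; left; apply/eqP; congr nc.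
  have -> : h *: (1:R[i]^o) = h by rewrite -[_ *: _]/(h * 1) mulr1.
  rewrite -[h^-1 *: _]/(_ * _) (addrC h); field.
  by [].
Qed.

End ComplexNorm.

Section ComplexIntegral.
Variable R : realType.
Local Notation nc := (@Normc.normc R).
Local Notation cj := (@conjc R).
Local Notation leb := (@lebesgue_measure R).
Implicit Types (F G : R -> R[i]) (a b : R).

Lemma Re_continuous : continuous (@complex.Re R : R[i]^o -> R).
Proof.
move=> z; have FF := @nbhs_filter _ z; apply/cvgrPdist_lt => e e0.
near=> y; suff: `|z - y| < e%:C.
  rewrite normr_normc ltcR => H; apply: le_lt_trans H.
  by rewrite -RecN -RecD; exact: ger_normc_Re.
near: y; apply: (@cvgr_dist_lt _ R[i]^o); first exact: cvg_id.
by rewrite ltcR.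
Unshelve. all: by end_near.
Qed.

Lemma Im_continuous : continuous (@complex.Im R : R[i]^o -> R).
Proof.
move=> z; have FF := @nbhs_filter _ z; apply/cvgrPdist_lt => e e0.
near=> y; suff: `|z - y| < e%:C.
  rewrite normr_normc ltcR => H; apply: le_lt_trans H.
  by rewrite -ImcN -ImcD; exact: ger_normc_Im.
near: y; apply: (@cvgr_dist_lt _ R[i]^o); first exact: cvg_id.
by rewrite ltcR.
Unshelve. all: by end_near.
Qed.

Lemma realC_continuous : continuous ((fun r => r%:C) : R -> R[i]^o).
Proof.
move=> x; apply/cvgrPdist_lt => e e0.
have eE : e = (complex.Re e)%:C.
  by move: e0; rewrite ltcE/= => /andP[/eqP]; case: (e) => u v /= ->.
have e0' : 0 < complex.Re e by move: e0; rewrite eE ltcR.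
exists (complex.Re e) => // y /= H.
by rewrite eE normr_normc ltcR -rmorphB normcR.
Qed.

Lemma normc_continuous : continuous (nc : R[i]^o -> R).
Proof.
move=> z; have FF := @nbhs_filter _ z; apply/cvgrPdist_lt => e e0.
near=> y; suff: `|z - y| < e%:C.
  rewrite normr_normc ltcR => H; apply: le_lt_trans H.
  rewrite ler_norml; apply/andP; split.
    rewrite lerNl opprB lerBlDr normc_distC.
    by rewrite -{1}(subrK z y) le_normcD.
  by rewrite lerBlDr -{1}(subrK y z) le_normcD.
near: y; apply: (@cvgr_dist_lt _ R[i]^o); first exact: cvg_id.
by rewrite ltcR.
Unshelve. all: by end_near.
Qed.

Definition ccont (A : set R) F := {within A, continuous (F : R -> R[i]^o)}.

Definition cint a b F := cintegral leb `[a, b] F.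

Lemma ccont_Re A F : ccont A F -> {within A, continuous (fun x => complex.Re (F x))}.
Proof. by move=> c x; exact: (@continuous_comp (subspace A) R[i]^o R F (@complex.Re R) x (c x) (@Re_continuous _)). Qed.

Lemma ccont_Im A F : ccont A F -> {within A, continuous (fun x => complex.Im (F x))}.
Proof. by move=> c x; exact: (@continuous_comp (subspace A) R[i]^o R F (@complex.Im R) x (c x) (@Im_continuous _)). Qed.

Lemma ccont_Ri A (u v : R -> R) : {within A, continuous u} -> {within A, continuous v} ->
  ccont A (fun x => u x +i* v x).
Proof.
move=> cu cv.
have -> : (fun x => u x +i* v x) = (fun x => (u x)%:C + 'i * (v x)%:C).
  by apply/funext => x; rewrite [LHS]complexE.
move=> x; apply: (@cvgD _ R[i]^o); first exact: (@continuous_comp (subspace A) R R[i]^o u _ x (cu x) (@realC_continuous _)).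
apply: (@cvgM R[i]); first exact: cvg_cst.
exact: (@continuous_comp (subspace A) R R[i]^o v _ x (cv x) (@realC_continuous _)).
Qed.

Lemma ccontD A F G : ccont A F -> ccont A G -> ccont A (fun x => F x + G x).
Proof. by move=> cF cG x; apply: (@cvgD _ R[i]^o); [exact: cF|exact: cG]. Qed.
Lemma ccontN A F : ccont A F -> ccont A (fun x => - F x).
Proof. by move=> cF x; apply: (@cvgN _ R[i]^o); exact: cF. Qed.
Lemma ccontB A F G : ccont A F -> ccont A G -> ccont A (fun x => F x - G x).
Proof. by move=> cF cG; exact: (ccontD cF (ccontN cG)). Qed.
Lemma ccontM A F G : ccont A F -> ccont A G -> ccont A (fun x => F x * G x).
Proof. by move=> cF cG x; apply: (@cvgM R[i]); [exact: cF|exact: cG]. Qed.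
Lemma ccont_cst A c : ccont A (fun=> c).
Proof. by move=> x; exact: cvg_cst. Qed.
Lemma ccontX A F n : ccont A F -> ccont A (fun x => F x ^+ n).
Proof.
move=> cF; elim: n => [|n IH]; first exact: ccont_cst.
under [X in ccont _ X]eq_fun do rewrite exprS.
exact: ccontM.
Qed.
Lemma ccontV A F : (forall x, A x -> F x != 0) -> ccont A F -> ccont A (fun x => (F x)^-1).
Proof.
move=> F0 cF; apply: (@within_continuous_comp R[i]^o R R[i]^o A F (@GRing.inv _)) => //.
move=> z; rewrite inE => -[x Ax <-].
exact: (@inv_continuous R[i] _ (F0 _ Ax)).
Qed.
Lemma ccont_conj A F : ccont A F -> ccont A (fun x => cj (F x)).
Proof.
move=> cF.
have -> : (fun x => cj (F x)) = (fun x => complex.Re (F x) +i* (- complex.Im (F x))).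
  by apply/funext => x; case: (F x).
apply: ccont_Ri; first exact: ccont_Re.
by move=> x; apply: (@cvgN _ R); exact: (ccont_Im cF).
Qed.
Lemma ccont_comp A F (f : R[i] -> R[i]) : ccont A F ->
  (forall x, A x -> {for F x, continuous (f : R[i]^o -> R[i]^o)}) -> ccont A (fun x => f (F x)).
Proof.
move=> cF cf; apply: (@within_continuous_comp R[i]^o R R[i]^o A F f) => //.
by move=> z; rewrite inE => -[x Ax <-]; exact: cf.
Qed.

Lemma ccont_normc A F : ccont A F -> {within A, continuous (fun x => nc (F x))}.
Proof. by move=> c x; exact: (@continuous_comp (subspace A) R[i]^o R F nc x (c x) (@normc_continuous _)). Qed.

Opaque ccont.

Lemma ccont_sum A I (s : seq I) (F : I -> R -> R[i]) :
  (forall i, ccont A (F i)) -> ccont A (fun x => \sum_(i <- s) F i x).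
Proof.
move=> cF; elim: s => [|i s IH].
  have -> : (fun x => \sum_(j <- [::]) F j x) = (fun=> 0).
    by apply/funext => x; rewrite big_nil.
  exact: ccont_cst.
have -> : (fun x => \sum_(j <- i :: s) F j x) = (fun x => F i x + \sum_(j <- s) F j x).
  by apply/funext => x; rewrite big_cons.
exact: (ccontD (cF i) IH).
Qed.
Lemma ccont_int a b F : ccont `[a, b] F ->
  leb.-integrable `[a, b] (EFin \o (fun x => complex.Re (F x))) /\
  leb.-integrable `[a, b] (EFin \o (fun x => complex.Im (F x))).
Proof.
by move=> cF; split; apply: continuous_compact_integrable; [exact: segment_compact| exact: ccont_Re|
  exact: segment_compact| exact: ccont_Im].
Qed.

Lemma Re_cint a b F : complex.Re (cint a b F) = Rintegral leb `[a, b] (fun x => complex.Re (F x)).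
Proof. by []. Qed.
Lemma Im_cint a b F : complex.Im (cint a b F) = Rintegral leb `[a, b] (fun x => complex.Im (F x)).
Proof. by []. Qed.

Lemma cintD a b F G : ccont `[a, b] F -> ccont `[a, b] G ->
  cint a b (fun x => F x + G x) = cint a b F + cint a b G.
Proof.
move=> /ccont_int[rF iF] /ccont_int[rG iG].
apply: complex_eqP; rewrite ?RecD ?ImcD !(Re_cint, Im_cint).
  by under eq_Rintegral do rewrite RecD; rewrite RintegralD.
by under eq_Rintegral do rewrite ImcD; rewrite RintegralD.
Qed.

Lemma cintZ a b F c : ccont `[a, b] F ->
  cint a b (fun x => c * F x) = c * cint a b F.
Proof.
move=> /ccont_int[rF iF].
have iZ (u : R) (f : R -> R) : leb.-integrable `[a, b] (EFin \o f) ->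
    leb.-integrable `[a, b] (EFin \o (fun x => u * f x)).
  move=> h; have := @integrableZl _ _ _ leb `[a, b] (measurable_itv `[a, b]) u _ h.
  by apply: eq_integrable.
apply: complex_eqP; rewrite ?RecM ?ImcM !(Re_cint, Im_cint).
  under eq_Rintegral do rewrite RecM.
  by rewrite RintegralB ?RintegralZl//; exact: iZ.
under eq_Rintegral do rewrite ImcM.
by rewrite RintegralD ?RintegralZl//; exact: iZ.
Qed.

Lemma cintN a b F : ccont `[a, b] F -> cint a b (fun x => - F x) = - cint a b F.
Proof.
move=> cF; rewrite -mulN1r -cintZ//; congr cint.
by apply/funext => x; rewrite mulN1r.
Qed.

Lemma cintB a b F G : ccont `[a, b] F -> ccont `[a, b] G ->
  cint a b (fun x => F x - G x) = cint a b F - cint a b G.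
Proof. by move=> cF cG; rewrite (cintD cF (ccontN cG)) (cintN cG). Qed.

Lemma eq_cint a b F G : (forall x, a <= x <= b -> F x = G x) -> cint a b F = cint a b G.
Proof.
by move=> FG; apply: complex_eqP => /=; apply: eq_Rintegral => x; rewrite inE/= in_itv/= => H;
  rewrite FG.
Qed.

Lemma cint_sum a b I (s : seq I) (F : I -> R -> R[i]) :
  (forall i, ccont `[a, b] (F i)) ->
  cint a b (fun x => \sum_(i <- s) F i x) = \sum_(i <- s) cint a b (F i).
Proof.
move=> cF; elim: s => [|i s IH].
  rewrite big_nil (@eq_cint _ _ _ (fun x => 0 * 0)); last by move=> x _; rewrite big_nil mulr0.
  by rewrite cintZ ?mul0r//; exact: ccont_cst.
rewrite big_cons -IH -cintD//; last exact: ccont_sum.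
by apply: eq_cint => x _; rewrite big_cons.
Qed.

(** Real and imaginary parts are bounded separately, which costs the factor 2; the constant never
    matters later. *)
Lemma ler_cint a b F M : a <= b -> ccont `[a, b] F ->
  (forall x, a <= x <= b -> nc (F x) <= M) -> nc (cint a b F) <= 2 * M * (b - a).
Proof.
move=> ab /ccont_int[rF iF] FM; apply: le_trans (ler_normc_ReIm _) _.
have -> : 2 * M * (b - a) = M * (b - a) + M * (b - a) by ring.
have bnd (u : R -> R) : leb.-integrable `[a, b] (EFin \o u) ->
    (forall x, a <= x <= b -> `|u x| <= M) -> `|Rintegral leb `[a, b] u| <= M * (b - a).
  move=> iu uM; apply: le_trans (le_normr_Rintegral _ _) _ => //.
  have -> : M * (b - a) = Rintegral leb `[a, b] (fun=> M).
    rewrite Rintegral_cst//; have /= -> := @lebesgue_measure_itv R `[a, b]; rewrite lte_fin; by case: ltgtP ab => // ->; rewrite subrr.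
  apply: le_Rintegral => //.
  - exact: integrable_norm iu.
  - apply: continuous_compact_integrable; [exact: segment_compact|].
    by move=> x; exact: cvg_cst.
by apply: lerD; apply: bnd => // x xab; [apply: le_trans (ger_normc_Re _) _|apply: le_trans (ger_normc_Im _) _]; exact: FM.
Qed.

Lemma ccont_bounded a b F : a <= b -> ccont `[a, b] F ->
  exists M, forall x, a <= x <= b -> nc (F x) <= M.
Proof.
move=> ab /ccont_normc cF; have [m _ hm] := EVT_max ab cF.
by exists (nc (F m)) => x xab; apply: hm; rewrite in_itv.
Qed.

Lemma cint_split a b c F : a <= b -> b <= c -> ccont `[a, c] F ->
  cint a c F = cint a b F + cint b c F.
Proof.
move=> ab bc /ccont_int[rF iF].
have H (u : R -> R) : leb.-integrable `[a, c] (EFin \o u) ->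
    Rintegral leb `[a, c] u = Rintegral leb `[a, b] u + Rintegral leb `[b, c] u.
  move=> iu; rewrite -(@Rintegral_itv_obnd_cbnd _ b (BRight c)).
    have <- := @Rintegral_itvB R u (BLeft a) (BRight c) b iu; rewrite ?bnd_simp//.
    by rewrite addrC subrK.
  by apply: integrableS iu => // x/=; rewrite !in_itv/= => /andP[/ltW bx ->]; rewrite (le_trans ab).
by apply: complex_eqP => /=; rewrite H// ?RecD ?ImcD.
Qed.

Lemma cint_FTC a b F G : a <= b -> ccont `[a, b] F ->
  (forall x : R, is_derive x (1:R) (fun y => complex.Re (G y)) (complex.Re (F x))) ->
  (forall x : R, is_derive x (1:R) (fun y => complex.Im (G y)) (complex.Im (F x))) ->
  cint a b F = G b - G a.
Proof.
rewrite le_eqVlt => /orP[/eqP <- _ _ _|ab cF dR dI].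
  rewrite subrr; apply: complex_eqP => /=; rewrite set_itv1 Rintegral_set1//.
have H (u U : R -> R) : {within `[a, b], continuous u} -> (forall x : R, is_derive x (1:R) U (u x)) ->
    Rintegral leb `[a, b] u = U b - U a.
  move=> cu dU; rewrite /Rintegral (@continuous_FTC2 _ u U)//.
    have cU x : U y @[y --> x] --> U x.
      by apply: differentiable_continuous; apply/derivable1_diffP.
    split => //.
    - exact/cvg_at_right_filter/cU.
    - exact/cvg_at_left_filter/cU.
  by move=> x _; rewrite derive1E derive_val.
by apply: complex_eqP => /=; rewrite ?RecD ?ImcD ?RecN ?ImcN; apply: (H _ (fun x => _ (G x))) => //; [exact: ccont_Re|exact: ccont_Im].
Qed.

End ComplexIntegral.

#[global] Opaque ccont.

Local Ltac ilra := match goal with |- is_true _ => lra end.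

(** Nested intervals: the left ends increase and stay below every right end, so their limit lies in
    all the intervals. Besides the bisection, this also produces limits with an explicit error
    bound. *)
Lemma squeeze_intervals (R : realType) (u L : R^nat) : (forall n, u n <= u n.+1) ->
  (forall n, u n.+1 + L n.+1 <= u n + L n) -> (forall n, 0 <= L n) ->
  exists x, forall n, u n <= x <= u n + L n.
Proof.
move=> uS uLS L0.
have un : nondecreasing_seq u by apply/nondecreasing_seqP.
have uLn : nonincreasing_seq (fun n => u n + L n) by apply/nonincreasing_seqP.
have ub m n : u n <= u m + L m.
  have [nm|mn] := leqP n m.
    by rewrite (le_trans (un _ _ nm))// lerDl.
  by rewrite (le_trans _ (uLn _ _ (ltnW mn)))// lerDl.
have cu : cvgn u.
  apply: nondecreasing_is_cvgn => //; exists (u 0%N + L 0%N) => _ [n _ <-]; exact: ub.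
exists (limn u) => n; apply/andP; split; first exact: nondecreasing_cvgn_le.
by apply: limr_le => //; apply: nearW => m; exact: ub.
Qed.

(** * Additive rectangle functions that are locally of second order vanish (Goursat's argument) *)

Section Bisection.
Variable R : realType.
Local Notation nc := (@Normc.normc R).
Variables (Phi : R -> R -> R -> R -> R[i]) (a0 b0 c0 d0 : R).
Hypothesis ab0 : a0 <= b0.
Hypothesis cd0 : c0 <= d0.
Hypothesis PhiDx : forall a m b c d, a0 <= a -> a <= m -> m <= b -> b <= b0 ->
  c0 <= c -> c <= d -> d <= d0 -> Phi a b c d = Phi a m c d + Phi m b c d.
Hypothesis PhiDy : forall a b c m d, a0 <= a -> a <= b -> b <= b0 ->
  c0 <= c -> c <= m -> m <= d -> d <= d0 -> Phi a b c d = Phi a b c m + Phi a b m d.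
Hypothesis Phi_local : forall x y, a0 <= x <= b0 -> c0 <= y <= d0 ->
  forall e, 0 < e -> exists2 del, 0 < del & forall a b c d,
    a0 <= a -> a <= x -> x <= b -> b <= b0 -> c0 <= c -> c <= y -> y <= d -> d <= d0 ->
    b - a < del -> d - c < del -> nc (Phi a b c d) <= e * ((b - a) + (d - c)) ^+ 2.

Let W n := (b0 - a0) / 2 ^+ n.
Let H n := (d0 - c0) / 2 ^+ n.
Let cell n (s : R * R) := Phi s.1 (s.1 + W n) s.2 (s.2 + H n).

(** The fourth quadrant is taken without a test: if the other three carry less than a quarter of the
    norm, the triangle inequality gives it at least a quarter. *)
Let next n (s : R * R) : R * R :=
  let t := nc (cell n s) / 4 in
  let w := W n.+1 in let h := H n.+1 in
  if t <= nc (cell n.+1 (s.1, s.2)) then (s.1, s.2) else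
  if t <= nc (cell n.+1 (s.1 + w, s.2)) then (s.1 + w, s.2) else
  if t <= nc (cell n.+1 (s.1, s.2 + h)) then (s.1, s.2 + h) else (s.1 + w, s.2 + h).

Fixpoint corner n : R * R :=
  if n is n'.+1 then next n' (corner n') else (a0, c0).

Let W2 n : W n = W n.+1 + W n.+1.
Proof. by rewrite /W exprS; field; rewrite expf_neq0. Qed.
Let H2 n : H n = H n.+1 + H n.+1.
Proof. by rewrite /H exprS; field; rewrite expf_neq0. Qed.
Let W_ge0 n : 0 <= W n. Proof. by rewrite /W divr_ge0 ?subr_ge0// exprn_ge0. Qed.
Let H_ge0 n : 0 <= H n. Proof. by rewrite /H divr_ge0 ?subr_ge0// exprn_ge0. Qed.

Let inbox n (s : R * R) := [/\ a0 <= s.1, s.1 + W n <= b0, c0 <= s.2 & s.2 + H n <= d0].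

Let next_spec n s : inbox n s ->
  [/\ inbox n.+1 (next n s), nc (cell n s) / 4 <= nc (cell n.+1 (next n s)),
    s.1 <= (next n s).1 /\ (next n s).1 + W n.+1 <= s.1 + W n &
    s.2 <= (next n s).2 /\ (next n s).2 + H n.+1 <= s.2 + H n].
Proof.
case: s => a c [/= aa ab cc cd].
have W1 := W2 n; have H1 := H2 n; have w0 := W_ge0 n.+1; have h0 := H_ge0 n.+1.
have E : cell n (a, c) = (cell n.+1 (a, c) + cell n.+1 (a, c + H n.+1)) +
    (cell n.+1 (a + W n.+1, c) + cell n.+1 (a + W n.+1, c + H n.+1)).
  rewrite /cell/= (PhiDx (m := a + W n.+1)); try ilra.
  rewrite (PhiDy (m := c + H n.+1)); try ilra.
  rewrite (PhiDy (a := a + W n.+1) (m := c + H n.+1)); try ilra.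
  by rewrite W1 H1 !addrA.
have T : nc (cell n (a, c)) <= nc (cell n.+1 (a, c)) + nc (cell n.+1 (a, c + H n.+1)) +
    (nc (cell n.+1 (a + W n.+1, c)) + nc (cell n.+1 (a + W n.+1, c + H n.+1))).
  by rewrite E (le_trans (le_normcD _ _))// lerD// le_normcD.
rewrite /next/=; case: ifP => [t1|/negbT]; [|rewrite -ltNge => t1; case: ifP => [t2|/negbT];
  [|rewrite -ltNge => t2; case: ifP => [t3|/negbT]; [|rewrite -ltNge => t3]]];
  split => //=; try (split => /=; lra); try lra.
Qed.

Let corner_inbox n : inbox n (corner n).
Proof.
elim: n => [|n IH]; last by case: (next_spec IH).
by split; rewrite /= ?/W ?/H ?expr0 ?divr1; lra.
Qed.

Let corner_big n : nc (Phi a0 b0 c0 d0) / 4 ^+ n <= nc (cell n (corner n)).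
Proof.
elim: n => [|n IH].
  rewrite expr0 divr1 /cell/= /W /H expr0 !divr1.
  by rewrite [a0 + _]addrC [c0 + _]addrC !subrK.
have [_ + _ _] := next_spec (corner_inbox n); apply: le_trans.
by rewrite exprSr invfM mulrA ler_wpM2r.
Qed.

(** The chosen cell of generation [n] keeps at least [1 / 4 ^ n] of the initial norm, while near the
    common point of all cells [Phi] is below any multiple of the squared size, which also scales as
    [1 / 4 ^ n]. *)
Lemma bisection_eq0 : Phi a0 b0 c0 d0 = 0.
Proof.
apply/eqP; rewrite -normc_eq0 eq_le normc_ge0 andbT.
have S n := next_spec (corner_inbox n).
have [x hx] : exists x, forall n, (corner n).1 <= x <= (corner n).1 + W n.
  by apply: squeeze_intervals => // n; have [_ _ [? ?] _] := S n.
have [y hy] : exists y, forall n, (corner n).2 <= y <= (corner n).2 + H n.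
  by apply: squeeze_intervals => // n; have [_ _ _ [? ?]] := S n.
have xab : a0 <= x <= b0.
  by have [/= ? ? ? ?] := corner_inbox 0%N; have := hx 0%N; rewrite /=; lra.
have ycd : c0 <= y <= d0.
  by have [/= ? ? ? ?] := corner_inbox 0%N; have := hy 0%N; rewrite /=; lra.
set P := nc _; rewrite leNgt; apply/negP => P0.
pose L := (b0 - a0) + (d0 - c0).
have L0 : 0 <= L by rewrite /L; lra.
(* Chosen so that [e * L ^+ 2 < P]; the [+ 1] covers a degenerate rectangle with [L = 0]. *)
pose e := P / (2 * (L ^+ 2 + 1)).
have den0 : 0 < 2 * (L ^+ 2 + 1) by rewrite mulr_gt0// ltr_wpDl// sqr_ge0.
have e0 : 0 < e by rewrite divr_gt0.
have [del del0 hdel] := Phi_local xab ycd e0.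
have [n hn] : exists n, L / 2 ^+ n < del.
  exists (Num.trunc (L / del)).+1.
  rewrite ltr_pdivrMr ?exprn_gt0// mulrC -ltr_pdivrMr//.
  have /andP[_ /lt_le_trans ->//] := truncn_itv (divr_ge0 L0 (ltW del0)).
  by rewrite -natrX ler_nat ltnW// ltn_expl.
have [i1 i2 i3 i4] := corner_inbox n.
have /andP[x1 x2] := hx n; have /andP[y1 y2] := hy n.
have LE : L / 2 ^+ n = W n + H n by rewrite /W /H /L -mulrDl.
have w0 := W_ge0 n; have h0 := H_ge0 n.
have := hdel _ _ _ _ i1 x1 x2 i2 i3 y1 y2 i4.
rewrite ![_ + _ - _]addrC !addKr => H1.
have {H1} : nc (cell n (corner n)) <= e * (W n + H n) ^+ 2 by apply: H1; lra.
apply/negP; rewrite -ltNge; apply: lt_le_trans (corner_big n).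
have E4 : (2 ^+ n) ^+ 2 = 4 ^+ n :> R.
  by rewrite -exprM mulnC exprM; congr (_ ^+ _); ring.
rewrite -LE expr_div_n E4 mulrA ltr_pM2r ?invr_gt0 ?exprn_gt0//.
rewrite /e mulrAC ltr_pdivrMr// -subr_gt0.
by rewrite -/P; nra.
Qed.

End Bisection.

(** * Exponentials on the unit circle and their orthogonality *)

Section UnitCircle.
Variable R : realType.
Local Notation nc := (@Normc.normc R).
Local Notation cj := (@conjc R).
Local Notation leb := (@lebesgue_measure R).

Definition cis (x : R) : R[i] := cos x +i* sin x.

Lemma normc_cis x : nc (cis x) = 1.
Proof. by rewrite normc_sqrtE/= cos2Dsin2 sqrtr1. Qed.

Lemma cis_conj x : cis x * cj (cis x) = 1.
Proof. by rewrite mulc_conj normc_cis expr1n. Qed.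

Lemma ccont_cis A : ccont A cis.
Proof.
by apply: ccont_Ri; apply: continuous_subspaceT; [exact: continuous_cos|exact: continuous_sin].
Qed.

Lemma cint_conj a b F : ccont `[a, b] F ->
  cint a b (fun x => cj (F x)) = cj (cint a b F) :> R[i].
Proof.
move=> /ccont_int[rF iF]; apply: complex_eqP => /=.
  by apply: eq_Rintegral => x _; case: (F x).
rewrite -mulN1r -RintegralZl//.
by apply: eq_Rintegral => x _; case: (F x) => u v /=; rewrite mulN1r.
Qed.

Lemma cis_primitive a b : a <= b -> 'i * cint a b cis = cis b - cis a.
Proof.
move=> ab; rewrite -cintZ; last exact: ccont_cis.
apply: cint_FTC => //.
- by apply: ccontM; [exact: ccont_cst|exact: ccont_cis].
- move=> x /=; rewrite mul0r mul1r sub0r.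
  exact: is_derive_cos.
- move=> x /=; rewrite mul0r mul1r add0r.
  exact: is_derive_sin.
Qed.

Lemma cis_lipschitz x y : nc (cis x - cis y) <= 2 * `|x - y|.
Proof.
wlog yx : x y / y <= x.
  move=> H; have [/H//|/ltW/H] := leP y x.
  by rewrite normc_distC distrC.
rewrite -cis_primitive// Normc.normcM ger0_norm ?subr_ge0//.
have -> : nc 'i = 1 by rewrite normc_sqrtE/= expr0n expr1n add0r sqrtr1.
rewrite mul1r; have := @ler_cint R y x cis 1 yx (@ccont_cis _).
by rewrite mulr1; apply => t _; rewrite normc_cis.
Qed.

Lemma cis_conjX x n : (cj (cis x) ^+ n) = cos (n%:R * x) +i* (- sin (n%:R * x)).
Proof.
elim: n => [|n IH]; first by rewrite expr0 mul0r cos0 sin0 oppr0.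
rewrite exprS IH -natr1 mulrDl mul1r cosD sinD /cis/=.
by apply: complex_eqP => /=; ring.
Qed.

Lemma cos_natpi n : cos (n%:R * (2 * pi)) = 1 :> R.
Proof.
elim: n => [|n IH]; first by rewrite mul0r cos0.
by rewrite -natr1 mulrDl mul1r mulrC mulr_natl cosD2pi// -mulr_natl mulrC.
Qed.

Lemma sin_natpi n : sin (n%:R * (2 * pi)) = 0 :> R.
Proof.
elim: n => [|n IH]; first by rewrite mul0r sin0.
by rewrite -natr1 mulrDl mul1r mulrC mulr_natl sinD2pi// -mulr_natl mulrC.
Qed.

Lemma cint_cis_conjX n : cint 0 (2 * pi) (fun x => cj (cis x) ^+ n) =
  if n == 0%N then (2 * pi)%:C else 0.
Proof.
have pi0 : (0 : R) <= 2 * pi by rewrite mulr_ge0// pi_ge0.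
have cc m : ccont `[0, 2 * pi] (fun x => cj (cis x) ^+ m).
  by apply: ccontX; apply: ccont_conj; exact: ccont_cis.
case: eqP => [->|/eqP n0].
  transitivity ((2 * pi : R)%:C - 0%:C); last by rewrite subr0.
  apply: (@cint_FTC _ _ _ _ (fun x => x%:C)) => //.
  by move=> x /=; exact: is_derive_cst.
have nR : n%:R != 0 :> R by rewrite pnatr_eq0.
pose G x : R[i] := (n%:R^-1 * sin (n%:R * x)) +i* (n%:R^-1 * cos (n%:R * x)).
transitivity (G (2 * pi) - G 0).
  apply: cint_FTC => //.
  - move=> x; rewrite cis_conjX/=.
    by apply: is_derive_eq; rewrite /GRing.scale/=; field.
  - move=> x; rewrite cis_conjX/=.
    by apply: is_derive_eq; rewrite /GRing.scale/=; field.
by rewrite /G cos_natpi sin_natpi !mulr0 cos0 sin0 mulr0 subrr.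
Qed.

Lemma cint_cis_conj n m : cint 0 (2 * pi) (fun x => cis x ^+ n * cj (cis x) ^+ m) =
  if n == m then (2 * pi)%:C else 0.
Proof.
have cc i j : ccont `[0, 2 * pi] (fun x => cis x ^+ i * cj (cis x) ^+ j).
  by apply: ccontM; apply: ccontX; [|apply: ccont_conj]; exact: ccont_cis.
wlog nm : n m / (n <= m)%N => [H|].
  have [/H//|mn] := leqP n m.
  rewrite (@eq_cint _ _ _ _ (fun x => cj (cis x ^+ m * cj (cis x) ^+ n))); last first.
    by move=> x _; rewrite conjcM !conjcX conjcK mulrC.
  rewrite cint_conj// H ?(ltnW mn)// eq_sym; case: ifP => // _; last by rewrite rmorph0.
  by rewrite conjc_real.
rewrite -(subnK nm) (@eq_cint _ _ _ _ (fun x => cj (cis x) ^+ (m - n))); last first.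
  by move=> x _; rewrite exprD mulrCA -exprMn cis_conj expr1n mulr1.
rewrite cint_cis_conjX; case: eqP => [E|NE]; [rewrite ifT//|rewrite ifF//].
  by rewrite E.
by apply/eqP => E; apply: NE; lia.
Qed.

End UnitCircle.

(** * Cauchy's formula and power series *)

Section Cauchy.
Variable R : realType.
Local Notation nc := (@Normc.normc R).
Local Notation cj := (@conjc R).

Lemma analytic_continuous (f : R[i] -> R[i]) : analytic_on_disk f ->
  forall z, disk z -> {for z, continuous (f : R[i]^o -> R[i]^o)}.
Proof.
move=> af z dz; apply: differentiable_continuous.
by apply/derivable1_diffP; exact: af.
Qed.

Variables (f : R[i] -> R[i]) (r : R) (z0 : R[i]).
Hypothesis af : analytic_on_disk f.
Hypothesis r0 : 0 < r.
Hypothesis r1 : r < 1.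
Hypothesis z0r : nc z0 < r.

Let pt (x : R) : R[i] := r%:C * cis x.
Let v (x : R) : R[i] := pt x - z0.
Let w (t x : R) : R[i] := z0 + t%:C * v x.
Let q (x : R) : R[i] := z0 * ((r^-1)%:C * cj (cis x)).
(** This is [pt x / (pt x - z0)], the Cauchy kernel relative to [dx] up to the factor ['i], written
    as the sum of a geometric series of ratio [q x]. *)
Let k (x : R) : R[i] := (1 - q x)^-1.
Let K := (1 - nc z0 / r)^-1.

Let rho1 : nc z0 / r < 1. Proof. by rewrite ltr_pdivrMr// mul1r. Qed.
Let K0 : 0 < K. Proof. by rewrite invr_gt0 subr_gt0. Qed.

Let nc_pt x : nc (pt x) = r.
Proof. by rewrite Normc.normcM normcR normc_cis mulr1 gtr0_norm. Qed.

Let nc_q x : nc (q x) = nc z0 / r.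
Proof. by rewrite !Normc.normcM normcR normc_conj normc_cis mulr1 gtr0_norm ?invr_gt0. Qed.

Let q_neq1 x : 1 - q x != 0.
Proof.
rewrite subr_eq0; apply/eqP => E; have := nc_q x; rewrite -E Normc.normc1 => H.
by move: rho1; rewrite -H ltxx.
Qed.

Let nc_k x : nc (k x) <= K.
Proof.
rewrite Normc.normcV lef_pV2 ?posrE ?subr_gt0// ?normc_gt0//.
by rewrite lerBlDr -(nc_q x) -{1}(@Normc.normc1 R) -{1}(subrK (q x) 1) le_normcD.
Qed.

(** As [v] has derivative ['i * pt], this says that ['i * k] is the logarithmic derivative of [v].
    Under the cone map [dw / (w - z0)] thus becomes [dt / t + 'i * k dx], which explains the two
    integrands of [Phi]. *)
Let v_k x : v x * k x = pt x.
Proof.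
apply: (mulIf (q_neq1 x)); rewrite -mulrA mulVf// mulr1 mulrBr mulr1 /v; congr (_ - _).
rewrite /q /pt mulrC -mulrA [X in _ * X]mulrACA -rmorphM mulVf ?gt_eqF// rmorph1.
by rewrite mul1r (mulrC (cj _)) cis_conj mulr1.
Qed.

Let nc_v x : nc (v x) <= 2.
Proof.
rewrite (le_trans (ler_normcB _ _))// nc_pt.
by have h1 := r1; have h2 := z0r; lra.
Qed.

Let nc_w t x : 0 <= t <= 1 -> nc (w t x) < 1.
Proof.
move=> /andP[t0 t1].
have -> : w t x = (1 - t)%:C * z0 + t%:C * pt x.
  by rewrite /w /v rmorphB rmorph1; ring.
apply: le_lt_trans (le_normcD _ _) _.
rewrite Normc.normcM (Normc.normcM t%:C) !normcR nc_pt !ger0_norm ?subr_ge0//.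
have : (1 - t) * nc z0 <= (1 - t) * r by rewrite ler_wpM2l ?subr_ge0// ltW.
have h1 := r1; have h0 := r0; lra.
Qed.

Let ccont_pt A : ccont A pt.
Proof. by apply: ccontM; [exact: ccont_cst|exact: ccont_cis]. Qed.
Let ccont_v A : ccont A v.
Proof. by apply: ccontB; [exact: ccont_pt|exact: ccont_cst]. Qed.
Let ccont_k A : ccont A k.
Proof.
apply: ccontV; first by move=> x _; exact: q_neq1.
apply: ccontB; first exact: ccont_cst.
apply: ccontM; first exact: ccont_cst.
by apply: ccontM; [exact: ccont_cst|apply: ccont_conj; exact: ccont_cis].
Qed.
Let ccont_id A : ccont A (fun t : R => t%:C).
Proof.
apply: ccont_Ri; apply: continuous_subspaceT => x; first exact: cvg_id.
exact: cvg_cst.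
Qed.

Let ccont_fw_x A t : 0 <= t <= 1 -> ccont A (fun x => f (w t x)).
Proof.
move=> t01; apply: ccont_comp.
  by apply: ccontD; [exact: ccont_cst|apply: ccontM; [exact: ccont_cst|exact: ccont_v]].
by move=> x _; apply: analytic_continuous => //; exact: nc_w.
Qed.

Let ccont_fw_t a b x : 0 <= a -> b <= 1 -> ccont `[a, b] (fun t => f (w t x)).
Proof.
move=> a0 b1; apply: ccont_comp.
  by apply: ccontD; [exact: ccont_cst|apply: ccontM; [exact: ccont_id|exact: ccont_cst]].
move=> t; rewrite /= in_itv/= => /andP[ta tb].
by apply: analytic_continuous => //; apply: nc_w; rewrite (le_trans a0 ta) (le_trans tb b1).
Qed.

Let ccont_Vt a b : 0 < a -> ccont `[a, b] (fun t : R => (t%:C)^-1).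
Proof.
move=> a0; apply: ccontV; last exact: ccont_id.
move=> t; rewrite /= in_itv/= => /andP[ta _].
by rewrite (_ : 0 = 0%:C)// (inj_eq (@complexI _)) gt_eqF// (lt_le_trans a0).
Qed.

(* The pull-back of the closed form [f dw / (w - z0)] under the cone map [w] is
   integrated over the boundary of a rectangle. *)
Let Phi (t1 t2 x1 x2 : R) : R[i] :=
  'i * cint x1 x2 (fun x => (f (w t2 x) - f (w t1 x)) * k x)
  - cint t1 t2 (fun t => (f (w t x2) - f (w t x1)) * (t%:C)^-1).

Let ccont_Phi1 A t1 t2 : 0 <= t1 <= 1 -> 0 <= t2 <= 1 ->
  ccont A (fun x => (f (w t2 x) - f (w t1 x)) * k x).
Proof.
by move=> ? ?; apply: ccontM; [apply: ccontB; exact: ccont_fw_x|exact: ccont_k].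
Qed.

Let ccont_Phi2 a b x1 x2 : 0 < a -> b <= 1 ->
  ccont `[a, b] (fun t => (f (w t x2) - f (w t x1)) * (t%:C)^-1).
Proof.
move=> a0 b1; apply: ccontM; last exact: ccont_Vt.
by apply: ccontB; apply: ccont_fw_t => //; exact: ltW.
Qed.

Let PhiDx e a m b c d : 0 < e -> e <= a -> a <= m -> m <= b -> b <= 1 ->
  Phi a b c d = Phi a m c d + Phi m b c d.
Proof.
move=> e0 ea am mb b1; rewrite /Phi (@cint_split _ a m b)//; last by apply: ccont_Phi2 => //; lra.
rewrite (@eq_cint _ _ _ _ (fun x => (f (w m x) - f (w a x)) * k x + (f (w b x) - f (w m x)) * k x)); last first.
  by move=> x _; ring.
rewrite cintD; [ring| |]; apply: ccont_Phi1; lra.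
Qed.

Let PhiDy e a b c m d : 0 < e -> e <= a -> a <= b -> b <= 1 ->
  c <= m -> m <= d -> Phi a b c d = Phi a b c m + Phi a b m d.
Proof.
move=> e0 ea ab b1 cm md; rewrite /Phi (@cint_split _ c m d)//; last by apply: ccont_Phi1; lra.
rewrite (@eq_cint _ a b _ (fun t => (f (w t m) - f (w t c)) * (t%:C)^-1 + (f (w t d) - f (w t m)) * (t%:C)^-1)); last first.
  by move=> x _; ring.
rewrite cintD; [ring| |]; apply: ccont_Phi2; lra.
Qed.

Let w_dist t t0 x x0 : 0 <= t0 <= 1 ->
  nc (w t x - w t0 x0) <= 2 * (`|t - t0| + `|x - x0|).
Proof.
move=> /andP[t00 t01].
have -> : w t x - w t0 x0 = (t - t0)%:C * v x + (t0 * r)%:C * (cis x - cis x0).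
  by rewrite /w /v /pt rmorphB rmorphM; ring.
apply: le_trans (le_normcD _ _) _.
rewrite !Normc.normcM !normcR mulrDr.
apply: lerD.
  by rewrite mulrC ler_wpM2r// nc_v.
rewrite -[leRHS]mul1r ler_pM ?normc_ge0//; last exact: cis_lipschitz.
have h1 := r1; have h0 := r0; rewrite ger0_norm ?mulr_ge0// ?ltW//; nra.
Qed.

(** [Phi] vanishes on affine functions of [w], so [f] may be replaced by its first-order Taylor
    remainder at [w t0 x0]. The remainder is small relative to the size of the cell, and the side
    lengths give the second factor of that size. The bound [e <= t] keeps [1 / t] bounded. *)
Let Phi_local e : 0 < e -> forall t0 x0, e <= t0 <= 1 -> 0 <= x0 <= 2 * pi ->
  forall eta, 0 < eta -> exists2 del, 0 < del & forall a b c d,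
    e <= a -> a <= t0 -> t0 <= b -> b <= 1 -> 0 <= c -> c <= x0 -> x0 <= d -> d <= 2 * pi ->
    b - a < del -> d - c < del -> nc (Phi a b c d) <= eta * ((b - a) + (d - c)) ^+ 2.
Proof.
move=> e0 t0 x0 /andP[et0 t01] _ eta eta0.
have t0_01 : 0 <= t0 <= 1 by lra.
have /derivable_complexP[l hl] := af (nc_w x0 t0_01).
have Ke : 0 < K + e^-1 by rewrite addr_gt0// invr_gt0.
(* The two sides are bounded by [8 * e' * D * K * (d - c)] and [8 * e' * D * e^-1 * (b - a)];
   together they stay below [8 * e' * (K + e^-1) * D ^+ 2]. *)
pose e' := eta / (8 * (K + e^-1)).
have e'0 : 0 < e' by rewrite divr_gt0// mulr_gt0.
have [del' del'0 hdel] := hl _ e'0.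
exists (del' / 8); first by rewrite divr_gt0.
move=> a b c d ea at0 t0b b1 c0 cx0 x0d dpi bad dcd.
have ab : a <= b by lra.
have cd : c <= d by lra.
pose D := (b - a) + (d - c).
have D0 : 0 <= D by rewrite /D; lra.
pose g z := f z - f (w t0 x0) - l * (z - w t0 x0).
have gb t x : a <= t <= b -> c <= x <= d -> nc (g (w t x)) <= 2 * e' * D.
  move=> tab xcd; have wd := @w_dist t t0 x x0 t0_01.
  have tD : `|t - t0| + `|x - x0| <= D.
    by apply: lerD; rewrite ler_norml; lra.
  have h2 : nc (w t x - w t0 x0) <= 2 * D by apply: le_trans wd _; lra.
  have := hdel (w t x - w t0 x0).
  rewrite (addrC (w t0 x0)) subrK => H; apply: le_trans (H _) _.
    by apply: le_lt_trans h2 _; rewrite /D; lra.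
  have -> : 2 * e' * D = e' * (2 * D) by ring.
  by rewrite ler_wpM2l// ltW.
have gf z : f z = g z + (f (w t0 x0) + l * (z - w t0 x0)) by rewrite /g; ring.
have cg1 t : a <= t <= b -> ccont `[c, d] (fun x => g (w t x)).
  move=> tab; apply: ccontB; first by apply: ccontB; [apply: ccont_fw_x; lra|exact: ccont_cst].
  apply: ccontM; first exact: ccont_cst.
  apply: ccontB; last exact: ccont_cst.
  by apply: ccontD; [exact: ccont_cst|apply: ccontM; [exact: ccont_cst|exact: ccont_v]].
have cg2 x : ccont `[a, b] (fun t => g (w t x)).
  apply: ccontB; first by apply: ccontB; [apply: ccont_fw_t; lra|exact: ccont_cst].
  apply: ccontM; first exact: ccont_cst.
  apply: ccontB; last exact: ccont_cst.
  by apply: ccontD; [exact: ccont_cst|apply: ccontM; [exact: ccont_id|exact: ccont_cst]].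
have aab : a <= a <= b by lra.
have bab : a <= b <= b by lra.
(* The linear term contributes [l * (b - a) * r * (cis d - cis c)] to each of the two integrals,
   through [v_k] and [cis_primitive] in the first, so it cancels. *)
have PhiE : Phi a b c d = 'i * cint c d (fun x => (g (w b x) - g (w a x)) * k x)
  - cint a b (fun t => (g (w t d) - g (w t c)) * (t%:C)^-1).
  rewrite /Phi (@eq_cint _ c d _ (fun x => (g (w b x) - g (w a x)) * k x +
     (l * (b - a)%:C * r%:C) * cis x)); last first.
    move=> x _; rewrite (gf (w b x)) (gf (w a x)).
    have -> : (l * (b - a)%:C * r%:C) * cis x = l * (b - a)%:C * (v x * k x).
      by rewrite v_k /pt mulrA.
    by rewrite /w rmorphB; ring.
  rewrite (@eq_cint _ a b _ (fun t => (g (w t d) - g (w t c)) * (t%:C)^-1 +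
     (l * r%:C * (cis d - cis c)) * 1)); last first.
    move=> t /andP[t1 t2]; rewrite (gf (w t d)) (gf (w t c)).
    have tn : t%:C != 0 :> R[i].
      by rewrite (_ : 0 = 0%:C)// (inj_eq (@complexI _)) gt_eqF//; lra.
    by rewrite /w /v /pt; field.
  rewrite cintD; last 2 first.
    by apply: ccontM; [apply: ccontB; exact: cg1|exact: ccont_k].
    by apply: ccontM; [exact: ccont_cst|exact: ccont_cis].
  rewrite cintD; last 2 first.
    apply: ccontM; [by apply: ccontB; exact: cg2|].
    by apply: ccont_Vt; lra.
    exact: ccont_cst.
  rewrite cintZ; last exact: ccont_cis.
  rewrite [in X in _ - (_ + X)]cintZ; last exact: ccont_cst.
  rewrite mulrDr [X in _ + X - _]mulrCA cis_primitive//.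
  have -> : cint a b (fun=> 1) = (b - a)%:C.
    rewrite rmorphB; apply: (@cint_FTC _ _ _ _ (fun x => x%:C)) => //.
    - exact: ccont_cst.
    - by move=> x /=; exact: is_derive_cst.
  ring.
rewrite PhiE; apply: le_trans (ler_normcB _ _) _.
rewrite Normc.normcM (_ : nc 'i = 1) ?mul1r; last first.
  by rewrite normc_sqrtE/= expr0n expr1n add0r sqrtr1.
have e'ge := ltW e'0; have Kge := ltW K0.
have e'D : 0 <= 4 * e' * D by apply: mulr_ge0 => //; apply: mulr_ge0.
have B1 : nc (cint c d (fun x => (g (w b x) - g (w a x)) * k x)) <= 2 * (4 * e' * D * K) * (d - c).
  apply: ler_cint => //.
    by apply: ccontM; [apply: ccontB; exact: cg1|exact: ccont_k].
  move=> x xcd; rewrite Normc.normcM ler_pM ?normc_ge0//.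
  apply: le_trans (ler_normcB _ _) _.
  by have := gb b x bab xcd; have := gb a x aab xcd; lra.
have B2 : nc (cint a b (fun t => (g (w t d) - g (w t c)) * (t%:C)^-1)) <= 2 * (4 * e' * D * e^-1) * (b - a).
  apply: ler_cint => //.
    apply: ccontM; [by apply: ccontB; exact: cg2|].
    by apply: ccont_Vt; lra.
  move=> t tab; rewrite Normc.normcM ler_pM ?normc_ge0//.
    apply: le_trans (ler_normcB _ _) _.
    have ccd : c <= c <= d by lra.
    have dcd' : c <= d <= d by lra.
    by have := gb t c tab ccd; have := gb t d tab dcd'; lra.
  rewrite Normc.normcV normcR gtr0_norm; last by lra.
  by rewrite lef_pV2 ?posrE; lra.
apply: le_trans (lerD B1 B2) _.
have -> : eta = e' * 8 * (K + e^-1).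
  by rewrite /e' -mulrA mulfVK// gt_eqF// mulr_gt0.
rewrite -/D.
have ei0 : 0 < e^-1 by rewrite invr_gt0.
have eige := ltW ei0.
have h1 : 0 <= K * (b - a) + e^-1 * (d - c) by apply: addr_ge0; apply: mulr_ge0; rewrite ?subr_ge0.
rewrite -subr_ge0.
have -> : e' * 8 * (K + e^-1) * D ^+ 2 -
  (2 * (4 * e' * D * K) * (d - c) + 2 * (4 * e' * D * e^-1) * (b - a)) =
  8 * (e' * D * (K * (b - a) + e^-1 * (d - c))) by rewrite /D; ring.
by apply: mulr_ge0 => //; apply: mulr_ge0 => //; apply: mulr_ge0.
Qed.

Let L t := cint 0 (2 * pi) (fun x => f (w t x) * k x).

Let pi2 : (0 : R) <= 2 * pi. Proof. by rewrite mulr_ge0// pi_ge0. Qed.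

(** The integral of the closed form over the boundary of [[e, 1] x [0, 2 pi]] vanishes, and the
    sides [x = 0] and [x = 2 pi] cancel because [w] is periodic in [x]. *)
Let L_const e : 0 < e -> e <= 1 -> L e = L 1.
Proof.
move=> e0 e1.
have P0 : Phi e 1 0 (2 * pi) = 0.
  apply: bisection_eq0 => //.
  - by move=> *; apply: (PhiDx _ _ e0).
  - by move=> *; apply: (PhiDy e0).
  - by move=> *; exact: Phi_local.
move: P0; rewrite /Phi (@eq_cint _ e 1 _ (fun=> 0 * 0)); last first.
  have wpi t : w t (2 * pi) = w t 0.
    have := cos_natpi R 1; have := sin_natpi R 1; rewrite mulr1n mul1r => sp cp.
    by rewrite /w /v /pt /cis sp cp cos0 sin0.
  by move=> t _; rewrite wpi subrr !mul0r.
rewrite cintZ; last exact: ccont_cst.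
rewrite mul0r subr0 => /eqP; rewrite mulf_eq0 => /orP[|/eqP].
  by rewrite eq_complex/= oner_eq0 andbF.
rewrite (@eq_cint _ _ _ _ (fun x => f (w 1 x) * k x - f (w e x) * k x)); last first.
  by move=> x _; rewrite mulrBl.
have e01 : 0 <= e <= 1 by lra.
rewrite cintB; last 2 first.
  by apply: ccontM; [apply: ccont_fw_x; rewrite ler01 lexx|exact: ccont_k].
  by apply: ccontM; [exact: ccont_fw_x|exact: ccont_k].
by move/eqP; rewrite subr_eq0 => /eqP.
Qed.

(** The left side is [L 1], hence [L t] for every small [t], and [f (w t x)] tends to [f z0]
    uniformly in [x]. The integral of [k] is left unevaluated here; it comes later from the series
    expansion of the kernel. *)
Lemma cone_cauchy : cint 0 (2 * pi) (fun x => f (pt x) * k x) =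
  f z0 * cint 0 (2 * pi) k.
Proof.
have -> : cint 0 (2 * pi) (fun x => f (pt x) * k x) = L 1.
  by apply: eq_cint => x _; rewrite /w mul1r /v addrC subrK.
apply/eqP; rewrite -subr_eq0 -normc_eq0 eq_le normc_ge0 andbT.
apply/ler_addgt0Pl => eps eps0; rewrite addr0.
have dz0 : disk z0 by rewrite /disk/=; have h1 := r1; have h2 := z0r; lra.
pose C := 4 * pi * K + 1 : R.
have C0 : 0 < C by rewrite /C ltr_wpDl//; apply: mulr_ge0 (ltW K0); rewrite mulr_ge0// pi_ge0.
have /derivable_complexP[l hl] := af dz0.
have [del del0 hdel] := hl 1 ltr01.
(* Since [v] is bounded by 2, [del / 4] brings [t * v] within [del]; the last bound turns the final
   estimate [2 * (nc l + 1) * t * (4 * pi * K)] into [eps]. *)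
pose t := Num.min 1 (Num.min (del / 4) (eps / (2 * (nc l + 1) * C))).
have l0 := normc_ge0 l.
have t0 : 0 < t by rewrite /t !lt_min ltr01 !divr_gt0// !mulr_gt0// ltr_wpDl.
have t1 : t <= 1 by rewrite /t ge_min lexx.
have t2 : t <= del / 4 by rewrite /t !ge_min lexx orbT.
have t3 : t <= eps / (2 * (nc l + 1) * C) by rewrite /t !ge_min lexx !orbT.
rewrite -(L_const t0 t1) /L -cintZ; last exact: ccont_k.
have t01 : 0 <= t <= 1 by rewrite ltW.
rewrite -cintB; last 2 first.
  by apply: ccontM; [exact: ccont_fw_x|exact: ccont_k].
  by apply: ccontM; [exact: ccont_cst|exact: ccont_k].
pose M := (nc l + 1) * (2 * t) * K.
apply: (@le_trans _ _ (2 * M * (2 * pi - 0))).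
  apply: ler_cint => //.
    apply: ccontB; apply: ccontM; [exact: ccont_fw_x|exact: ccont_k|exact: ccont_cst|exact: ccont_k].
  move=> x _; rewrite -mulrBl Normc.normcM ler_pM ?normc_ge0//.
  have tv : nc (t%:C * v x) <= 2 * t.
    by rewrite Normc.normcM normcR gtr0_norm// mulrC ler_wpM2r ?nc_v// ltW.
  have H := hdel (t%:C * v x) _.
  have -> : f (w t x) - f z0 = (f (z0 + t%:C * v x) - f z0 - l * (t%:C * v x)) + l * (t%:C * v x).
    by rewrite subrK.
  apply: le_trans (le_normcD _ _) _; rewrite Normc.normcM mulrDl addrC mul1r.
  apply: lerD; first by rewrite ler_wpM2l.
  apply: le_trans (H _) _; last by rewrite mul1r.
  by apply: le_lt_trans tv _; lra.
rewrite subr0.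
have -> : 2 * M * (2 * pi) = (2 * (nc l + 1) * t) * (4 * pi * K) by rewrite /M; ring.
have den : 0 < 2 * (nc l + 1) * C by rewrite !mulr_gt0// ltr_wpDl.
move: t3; rewrite ler_pdivlMr// => t3.
apply: le_trans t3.
have -> : t * (2 * (nc l + 1) * C) = (2 * (nc l + 1) * t) * C by ring.
apply: ler_wpM2l; last by rewrite /C lerDl.
by apply: mulr_ge0 (ltW t0); rewrite mulr_ge0// addr_ge0.
Qed.

(** Finite geometric expansion [k = sum_(j < N) q ^ j + q ^ N * k], integrated against [F]. Keeping
    [F] arbitrary allows both [F = 1], which evaluates the kernel, and the restriction of [f] to a
    circle. *)
Lemma cauchy_kernel_expand (F : R -> R[i]) M N : ccont `[0, 2 * pi] F ->
  (forall x, 0 <= x <= 2 * pi -> nc (F x) <= M) ->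
  nc (cint 0 (2 * pi) (fun x => F x * k x) -
    \sum_(j < N) cint 0 (2 * pi) (fun x => F x * ((r^-1)%:C * cj (cis x)) ^+ j) * z0 ^+ j)
  <= 4 * pi * M * K * (nc z0 / r) ^+ N.
Proof.
move=> cF FM.
have cq : ccont `[0, 2 * pi] (fun x => (r^-1)%:C * cj (cis x)).
  by apply: ccontM; [exact: ccont_cst|apply: ccont_conj; exact: ccont_cis].
have c1 j : ccont `[0, 2 * pi] (fun x => F x * ((r^-1)%:C * cj (cis x)) ^+ j).
  by apply: ccontM; [exact: cF|exact: (@ccontX _ _ _ j cq)].
have c2 j : ccont `[0, 2 * pi] (fun x => z0 ^+ j * (F x * ((r^-1)%:C * cj (cis x)) ^+ j)).
  by apply: ccontM; [exact: ccont_cst|exact: c1].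
have cr : ccont `[0, 2 * pi] (fun x => F x * (q x ^+ N * k x)).
  apply: ccontM; [exact: cF|apply: ccontM; last exact: ccont_k].
  by apply: ccontX; apply: ccontM; [exact: ccont_cst|exact: cq].
rewrite (@eq_cint _ _ _ _ (fun x => \sum_(j < N) z0 ^+ j * (F x * ((r^-1)%:C * cj (cis x)) ^+ j) +
   F x * (q x ^+ N * k x))); last first.
  move=> x _.
  have -> : \sum_(j < N) z0 ^+ j * (F x * ((r^-1)%:C * cj (cis x)) ^+ j) = F x * \sum_(j < N) q x ^+ j.
    by rewrite mulr_sumr; apply: eq_bigr => j _; rewrite /q [(z0 * _) ^+ _]exprMn mulrCA.
  rewrite -mulrDr; congr (_ * _).
  apply: (mulIf (q_neq1 x)); rewrite mulVf// mulrDl -mulrA mulVf// mulr1.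
  have := subrX1 (q x) N; move: (\sum_(_ < N) _) => S E.
  have -> : S * (1 - q x) = - ((q x - 1) * S) by ring.
  by rewrite -E; ring.
have cs : ccont `[0, 2 * pi] (fun x => \sum_(j < N) z0 ^+ j * (F x * ((r^-1)%:C * cj (cis x)) ^+ j)).
  by apply: ccont_sum => j; exact: c2.
rewrite (cintD cs cr) cint_sum; last by move=> j; exact: c2.
rewrite (eq_bigr (fun j : 'I_N => cint 0 (2 * pi) (fun x => F x * ((r^-1)%:C * cj (cis x)) ^+ j) * z0 ^+ j)); last first.
  by move=> j _; rewrite (cintZ _ (c1 j)) mulrC.
rewrite addrC addKr.
have -> : 4 * pi * M * K * (nc z0 / r) ^+ N = 2 * (M * ((nc z0 / r) ^+ N * K)) * (2 * pi - 0) by ring.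
apply: (ler_cint pi2 cr) => x xpi.
rewrite Normc.normcM ler_pM ?normc_ge0 ?FM//.
by rewrite Normc.normcM normcX nc_q ler_wpM2l ?exprn_ge0 ?divr_ge0 ?normc_ge0// ltW.
Qed.

End Cauchy.

(** * Power series on the unit disk *)

Section PowerSeries.
Variable R : realType.
Local Notation nc := (@Normc.normc R).
Local Notation cj := (@conjc R).
Implicit Types (c : nat -> R[i]) (f g h : R[i] -> R[i]).

Definition psum c N (z : R[i]) := \sum_(j < N) c j * z ^+ j.

(** Radius of convergence at least 1, in the form of Abel's lemma; bounds of this shape pass
    directly to products with the weights of a Toeplitz operator. *)
Definition tame c := forall r : R, 0 < r < 1 -> exists M, forall j, nc (c j) * r ^+ j <= M.

Definition has_pseries h c :=
  tame c /\ forall z, disk z -> (fun N => nc (h z - psum c N z)) @ \oo --> 0.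

(** Identities and inequalities between limits are obtained below by bounding a fixed quantity by
    geometric errors in a free truncation index [N]. *)
Lemma expr_geom_le0 (x C rho : R) (N0 : nat) : 0 <= rho < 1 ->
  (forall N, (N0 <= N)%N -> x <= C * rho ^+ N) -> x <= 0.
Proof.
move=> /andP[rho0 rho1] H.
have cv : (fun N => C * rho ^+ N) @ \oo --> (C * 0).
  by apply: cvgM; [exact: cvg_cst|apply: cvg_expr; rewrite ger0_norm].
rewrite mulr0 in cv.
rewrite -(cvg_lim _ cv)//; apply: limr_ge; first by apply/cvg_ex; exists 0.
by exists N0 => // N /= N0N; exact: H.
Qed.

Lemma geom_partial_le (rho : R) m n : 0 <= rho < 1 ->
  \sum_(m <= j < n) rho ^+ j <= rho ^+ m / (1 - rho).
Proof.
move=> /andP[rho0 rho1]; have d0 : 0 < 1 - rho by rewrite subr_gt0.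
have [mn|nm] := leqP m n; last first.
  by rewrite big_geq ?divr_ge0 ?exprn_ge0 ?(ltW d0)// ltnW.
rewrite ler_pdivlMr// -(subnK mn); elim: (n - m)%N => [|k IH].
  by rewrite add0n big_geq// mul0r exprn_ge0.
rewrite addSn big_nat_recr ?leq_addl//= mulrDl.
have E : \sum_(m <= i < k + m) rho ^+ i * (1 - rho) = rho ^+ m - rho ^+ (k + m).
  elim: (k) => [|l IHl]; first by rewrite add0n big_geq// subrr.
  by rewrite addSn big_nat_recr ?leq_addl//= IHl exprS; ring.
rewrite mulr_suml E.
have := exprn_ge0 (k + m) rho0; move: (rho ^+ (k + m)) (rho ^+ m) => A B A0; nra.
Qed.

(** Each of the [j + 1] terms [rho ^ i] with [i <= j] is at least [rho ^ j], and their sum is below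
    the whole geometric series. *)
Lemma natr_geom_bound (rho : R) j : 0 <= rho < 1 ->
  (j%:R + 1) * rho ^+ j <= (1 - rho)^-1.
Proof.
move=> rho01; have := geom_partial_le 0 j.+1 rho01; rewrite expr0 mul1r; apply: le_trans.
rewrite big_mkord natr1 mulr_natl -[in leLHS](card_ord j.+1) -sumr_const.
apply: ler_sum => i _; case/andP: rho01 => rho0 /ltW rho1.
by apply: ler_wiXn2l => //; rewrite -ltnS.
Qed.

(** The tails [C * rho ^ N / (1 - rho)] give nested intervals around the real and the imaginary
    parts, hence a limit together with its rate. *)
Lemma complex_geom_cvg (u : nat -> R[i]) C rho : 0 <= rho < 1 -> 0 <= C ->
  (forall N, nc (u N.+1 - u N) <= C * rho ^+ N) ->
  exists l, forall N, nc (l - u N) <= 2 * (C / (1 - rho)) * rho ^+ N.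
Proof.
move=> /andP[rho0 rho1] C0 H; have d0 : 0 < 1 - rho by rewrite subr_gt0.
pose t N := C / (1 - rho) * rho ^+ N.
have t0 N : 0 <= t N by rewrite mulr_ge0 ?exprn_ge0// divr_ge0// ltW.
have tS N : t N = t N.+1 + C * rho ^+ N.
  by rewrite /t exprS; field; rewrite gt_eqF.
have K (v : R^nat) : (forall N, `|v N.+1 - v N| <= C * rho ^+ N) ->
    exists l, forall N, `|l - v N| <= t N.
  move=> Hv; have [l hl] : exists l, forall N, v N - t N <= l <= (v N - t N) + 2 * t N.
    apply: squeeze_intervals => N.
    - by have := Hv N; have := tS N; rewrite ler_norml; lra.
    - by have := Hv N; have := tS N; rewrite ler_norml; lra.
    - by rewrite mulr_ge0.
  by exists l => N; have := hl N; rewrite ler_norml; lra.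
have [lr hr] : exists l, forall N, `|l - complex.Re (u N)| <= t N.
  apply: K => N; apply: le_trans (H N); rewrite -RecN -RecD; exact: ger_normc_Re.
have [li hi] : exists l, forall N, `|l - complex.Im (u N)| <= t N.
  apply: K => N; apply: le_trans (H N); rewrite -ImcN -ImcD; exact: ger_normc_Im.
exists (lr +i* li) => N; apply: le_trans (ler_normc_ReIm _) _.
rewrite RecD ImcD RecN ImcN /=.
have -> : 2 * (C / (1 - rho)) * rho ^+ N = t N + t N by rewrite /t; ring.
exact: lerD.
Qed.

Lemma tame_bound c r : tame c -> 0 < r < 1 -> exists C rho, [/\ 0 <= C, 0 <= rho < 1 &
  forall j, (j%:R + 1) ^+ 2 * (nc (c j) * r ^+ j) <= C * rho ^+ j].
Proof.
move=> tc r01; case/andP: (r01) => r0 r1.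
(* Three radii between [r] and 1. The ratios [r / r1'] and [r1' / r2] absorb one factor [j + 1] each
   by [natr_geom_bound], and [r2 / r3] remains as the geometric rate. *)
pose r1' := (3 * r + 1) / 4; pose r2 := (2 * r + 2) / 4; pose r3 := (r + 3) / 4.
have r3P : 0 < r3 < 1 by rewrite /r3; lra.
have [M hM] := tc _ r3P.
have M0 : 0 <= M by apply: le_trans (hM 0%N); rewrite mulr_ge0 ?normc_ge0 ?exprn_ge0//; lra.
have lt_div (x y : R) : 0 < x -> x < y -> 0 <= x / y < 1.
  by move=> x0 xy; rewrite divr_ge0 ?ltr_pdivrMr ?mul1r//; lra.
have A : 0 <= r / r1' < 1 by apply: lt_div; rewrite /r1'; lra.
have B : 0 <= r1' / r2 < 1 by apply: lt_div; rewrite /r1' /r2; lra.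
have D : 0 <= r2 / r3 < 1 by apply: lt_div; rewrite /r2 /r3; lra.
have Ai : 0 <= (1 - r / r1')^-1 by rewrite invr_ge0; lra.
have Bi : 0 <= (1 - r1' / r2)^-1 by rewrite invr_ge0; lra.
exists (M * (1 - r / r1')^-1 * (1 - r1' / r2)^-1), (r2 / r3); split => //.
  by rewrite !mulr_ge0.
move=> j.
have E : r ^+ j = (r / r1') ^+ j * ((r1' / r2) ^+ j * ((r2 / r3) ^+ j * r3 ^+ j)).
  rewrite -!exprMn; congr (_ ^+ _); field.
  by rewrite /r1' /r2 /r3 !gt_eqF//; lra.
rewrite E.
have -> : (j%:R + 1) ^+ 2 * (nc (c j) * ((r / r1') ^+ j * ((r1' / r2) ^+ j * ((r2 / r3) ^+ j * r3 ^+ j)))) =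
  (nc (c j) * r3 ^+ j) * ((j%:R + 1) * (r / r1') ^+ j) * ((j%:R + 1) * (r1' / r2) ^+ j) * (r2 / r3) ^+ j by ring.
have r30 : 0 <= r3 by lra.
case/andP: (A) => A0 _; case/andP: (B) => B0 _; case/andP: (D) => D0 _.
apply: ler_wpM2r; first exact: exprn_ge0.
have j0 : 0 <= j%:R + 1 :> R by rewrite addr_ge0.
apply: ler_pM; last exact: natr_geom_bound.
- by rewrite !mulr_ge0 ?normc_ge0 ?exprn_ge0.
- by rewrite mulr_ge0 ?exprn_ge0.
apply: ler_pM; last exact: natr_geom_bound.
- by rewrite mulr_ge0 ?normc_ge0 ?exprn_ge0.
- by rewrite mulr_ge0 ?exprn_ge0.
exact: hM.
Qed.

Lemma tame_bound1 c r : tame c -> 0 < r < 1 -> exists C rho, [/\ 0 <= C, 0 <= rho < 1 &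
  forall j, nc (c j) * r ^+ j <= C * rho ^+ j].
Proof.
move=> tc r01; have [C [rho [C0 rho01 H]]] := tame_bound tc r01.
exists C, rho; split => // j; apply: le_trans (H j).
have x0 : 0 <= nc (c j) * r ^+ j.
  by case/andP: r01 => /ltW r0 _; rewrite mulr_ge0 ?normc_ge0 ?exprn_ge0.
rewrite -[leLHS]mul1r ler_wpM2r// -[leLHS](expr1n _ 2) ler_pXn2r ?nnegrE ?addr_ge0//.
by rewrite lerDr.
Qed.

Lemma psumS c N z : psum c N.+1 z = psum c N z + c N * z ^+ N.
Proof. by rewrite /psum big_ord_recr. Qed.

Lemma tame_psum_cvg c r : tame c -> 0 < r < 1 -> exists C rho, [/\ 0 <= C, 0 <= rho < 1 &
  forall z, nc z <= r -> exists l, forall N, nc (l - psum c N z) <= C * rho ^+ N].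
Proof.
move=> tc r01; have [C [rho [C0 rho01 H]]] := tame_bound1 tc r01.
exists (2 * (C / (1 - rho))), rho; split => //.
  by rewrite mulr_ge0// divr_ge0//; lra.
move=> z zr; apply: complex_geom_cvg => // N.
rewrite psumS addrC addKr Normc.normcM normcX; apply: le_trans (H N).
have r0 : 0 <= r by lra.
by rewrite ler_wpM2l ?normc_ge0// lerXn2r ?nnegrE ?normc_ge0.
Qed.

Lemma normc_cvg0_unique (u : nat -> R[i]) x y : (fun N => nc (x - u N)) @ \oo --> 0 ->
  (fun N => nc (y - u N)) @ \oo --> 0 -> x = y.
Proof.
move=> hx hy; apply/eqP; rewrite -subr_eq0 -normc_eq0 eq_le normc_ge0 andbT.
have hxy : (fun N => nc (x - u N) + nc (y - u N)) @ \oo --> (0 + 0 : R) by exact: cvgD.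
rewrite addr0 in hxy.
rewrite -(cvg_lim _ hxy)//; apply: limr_ge; first by apply/cvg_ex; exists 0.
apply: nearW => N; have -> : x - y = (x - u N) - (y - u N) by ring.
exact: ler_normcB.
Qed.

Lemma geom_cvg0 (v : R^nat) C rho : 0 <= rho < 1 -> (forall N, 0 <= v N <= C * rho ^+ N) ->
  v @ \oo --> 0.
Proof.
move=> /andP[rho0 rho1] H.
have cv : (fun N => C * rho ^+ N) @ \oo --> (C * 0).
  by apply: cvgM; [exact: cvg_cst|apply: cvg_expr; rewrite ger0_norm].
rewrite mulr0 in cv.
apply: (squeeze_cvgr _ (cvg_cst 0) cv).
by apply: nearW => N; exact: H.
Qed.

Lemma pseries_tail h c r : has_pseries h c -> 0 < r < 1 -> exists C rho,
  [/\ 0 <= C, 0 <= rho < 1 & forall z, nc z <= r -> forall N, nc (h z - psum c N z) <= C * rho ^+ N].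
Proof.
move=> [tc hc] r01; have [C [rho [C0 rho01 H]]] := tame_psum_cvg tc r01.
exists C, rho; split => // z zr; have [l hl] := H z zr.
suff -> : h z = l by [].
apply: (@normc_cvg0_unique (fun N => psum c N z)); first by apply: hc; rewrite /disk/=; lra.
by apply: (@geom_cvg0 _ C rho) => // N; rewrite normc_ge0 hl.
Qed.

Lemma pseries_exists c : tame c -> exists h, has_pseries h c.
Proof.
move=> tc; have /choice[h hh] : forall z, exists l, disk z ->
    (fun N => nc (l - psum c N z)) @ \oo --> 0.
  move=> z; have [dz|nd] := pselect (disk z); last by exists 0 => /nd.
  have r01 : 0 < (nc z + 1) / 2 < 1.
    by move: dz; rewrite /disk/=; have := normc_ge0 z; lra.
  have [C [rho [C0 rho01 H]]] := tame_psum_cvg tc r01.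
  have [|l hl] := H z; first by move: dz; rewrite /disk/=; lra.
  exists l => _; apply: (@geom_cvg0 _ C rho) => // N; rewrite normc_ge0; exact: hl.
by exists h; split.
Qed.

Lemma pseries_unique h g c z : has_pseries h c -> has_pseries g c -> disk z -> h z = g z.
Proof. by move=> [_ hc] [_ gc] dz; exact: normc_cvg0_unique (hc z dz) (gc z dz). Qed.

(** The factor [r ^+ 2] on the left avoids the exponent [j - 2], which would need separate small
    cases. The induction on [j] runs with [j ^ 2] in place of [(j + 1) ^ 2]. *)
Lemma expr_taylor2 (z h : R[i]) (r : R) j : nc z <= r -> nc (z + h) <= r ->
  r ^+ 2 * nc ((z + h) ^+ j - z ^+ j - j%:R * z ^+ j.-1 * h) <= (j%:R + 1) ^+ 2 * r ^+ j * nc h ^+ 2.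
Proof.
move=> zr zhr; have r0 : 0 <= r by apply: le_trans (normc_ge0 z) zr.
suff : r ^+ 2 * nc ((z + h) ^+ j - z ^+ j - j%:R * z ^+ j.-1 * h) <= j%:R ^+ 2 * r ^+ j * nc h ^+ 2.
  move=> H; apply: le_trans H _; apply: ler_wpM2r; first by rewrite exprn_ge0 ?normc_ge0.
  apply: ler_wpM2r; first by rewrite exprn_ge0.
  by rewrite lerXn2r ?nnegrE ?addr_ge0// lerDl.
elim: j => [|j IH].
  by rewrite !expr0 !mulr0n subrr !mul0r subr0 Normc.normc0 mulr0 expr0n !mul0r.
have -> : (z + h) ^+ j.+1 - z ^+ j.+1 - j.+1%:R * z ^+ j.+1.-1 * h =
   (z + h) * ((z + h) ^+ j - z ^+ j - j%:R * z ^+ j.-1 * h) + j%:R * z ^+ j.-1 * h ^+ 2.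
  rewrite /= !exprS -natr1; case: j {IH} => [|j] /=; first by rewrite !expr0; ring.
  by rewrite !exprS; ring.
have jz : r * nc (j%:R * z ^+ j.-1) <= j%:R * r ^+ j.
  case: j {IH} => [|j]; first by rewrite !mulr0n !mul0r Normc.normc0 mulr0.
  rewrite Normc.normcM normcX (_ : nc j.+1%:R = j.+1%:R); last first.
    by rewrite -[j.+1%:R](rmorph_nat (real_complex R)) normcR ger0_norm.
  by rewrite mulrCA ler_wpM2l// exprS ler_wpM2l// lerXn2r ?nnegrE ?normc_ge0.
have h0 := normc_ge0 h.
apply: (@le_trans _ _ (r ^+ 2 * (nc (z + h) * nc ((z + h) ^+ j - z ^+ j - j%:R * z ^+ j.-1 * h) +
   nc (j%:R * z ^+ j.-1) * nc h ^+ 2))).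
  rewrite ler_wpM2l ?exprn_ge0//; apply: le_trans (le_normcD _ _) _.
  by rewrite !Normc.normcM normcX.
rewrite mulrDr mulrCA.
apply: (@le_trans _ _ (r * (j%:R ^+ 2 * r ^+ j * nc h ^+ 2) + r * (j%:R * r ^+ j) * nc h ^+ 2)).
  apply: lerD; first by rewrite ler_pM ?normc_ge0 ?mulr_ge0 ?exprn_ge0 ?normc_ge0.
  rewrite [leLHS]mulrA; apply: ler_wpM2r; first exact: exprn_ge0.
  by rewrite expr2 -[leLHS]mulrA; apply: ler_wpM2l.
have -> : r * (j%:R ^+ 2 * r ^+ j * nc h ^+ 2) + r * (j%:R * r ^+ j) * nc h ^+ 2 =
   (j%:R ^+ 2 + j%:R) * (r ^+ j.+1 * nc h ^+ 2) by rewrite [r ^+ j.+1]exprS; ring.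
rewrite -[leRHS]mulrA; apply: ler_wpM2r; first by rewrite mulr_ge0 ?exprn_ge0.
by rewrite -natr1; have := ler0n R j; move: (j%:R) => x x0; nra.
Qed.

(** Termwise second-order Taylor remainders are summable by [tame_bound], so the formal derivative
    series is the complex derivative with an error quadratic in the increment. *)
Lemma pseries_analytic h c : has_pseries h c -> analytic_on_disk h.
Proof.
move=> hc z dz; have tc := hc.1.
have z1 : nc z < 1 := dz.
have z0 := normc_ge0 z.
have [r [r01 zr]] : exists r, 0 < r < 1 /\ nc z < r by exists ((nc z + 1) / 2); lra.
have r0 : 0 < r by lra.
have [C [rho [C0 rho01 H]]] := tame_bound tc r01.
pose lN N := \sum_(j < N) c j * (j%:R * z ^+ j.-1).
have nj j : nc j%:R = j%:R :> R.
  by rewrite -[j%:R](rmorph_nat (real_complex R)) normcR ger0_norm.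
have [l hl] : exists l, forall N, nc (l - lN N) <= 2 * (C / r / (1 - rho)) * rho ^+ N.
  apply: complex_geom_cvg => //; first by rewrite divr_ge0// ltW.
  move=> N; rewrite (_ : lN N.+1 - lN N = c N * (N%:R * z ^+ N.-1)); last first.
    by rewrite /lN big_ord_recr/=; ring.
  rewrite !Normc.normcM normcX nj.
  rewrite mulrAC ler_pdivlMr//; apply: le_trans (H N).
  case: N => [|N]; first by rewrite mul0r mulr0 mul0r !mulr_ge0 ?normc_ge0 ?exprn_ge0 ?addr_ge0// ltW.
  have -> : nc (c N.+1) * (N.+1%:R * nc z ^+ N.+1.-1) * r = N.+1%:R * (nc (c N.+1) * (nc z ^+ N * r)) by rewrite /=; ring.
  apply: ler_pM; rewrite ?mulr_ge0 ?normc_ge0 ?exprn_ge0 ?(ltW r0)//.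
    have x0 : 1 <= N.+1%:R + 1 :> R by rewrite lerDr.
    apply: (@le_trans _ _ (N.+1%:R + 1)); first by rewrite lerDl.
    by rewrite expr2 -[leLHS]mulr1 ler_wpM2l// addr_ge0.
  by rewrite ler_wpM2l ?normc_ge0// exprSr ler_wpM2r ?(ltW r0)// lerXn2r ?nnegrE ?normc_ge0// ltW.
pose B := C / (1 - rho) / r ^+ 2.
have B0 : 0 <= B by rewrite !divr_ge0// ?exprn_ge0//; lra.
(* The three functions are replaced by their partial sums at the cost of a geometric error, which
   disappears as [N] grows; the remaining finite sum is bounded by [B] independently of [N]. *)
have key w : nc (z + w) <= r -> nc (h (z + w) - h z - l * w) <= B * nc w ^+ 2.
  move=> zwr; rewrite -subr_le0.
  have [C1 [s [C10 s01 T]]] := pseries_tail hc r01.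
  pose D := 2 * C1 + 2 * (C / r / (1 - rho)) * nc w.
  pose q := Num.max s rho.
  have q01 : 0 <= q < 1 by rewrite /q le_max gt_max; case/andP: s01 => -> ->; case/andP: rho01 => _ ->.
  apply: (@expr_geom_le0 _ D q 0 q01) => N _.
  rewrite lerBlDr.
  have -> : h (z + w) - h z - l * w = ((h (z + w) - psum c N (z + w)) - (h z - psum c N z) - (l - lN N) * w)
     + (psum c N (z + w) - psum c N z - lN N * w) by ring.
  apply: le_trans (le_normcD _ _) _; apply: lerD.
    apply: le_trans (ler_normcB _ _) _; rewrite /D [leRHS]mulrDl; apply: lerD.
      apply: le_trans (ler_normcB _ _) _.
      have sq : s ^+ N <= q ^+ N.
        by case/andP: s01 => s0 _; rewrite lerXn2r ?nnegrE ?/q ?le_max ?lexx ?s0.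
      have : C1 * s ^+ N <= C1 * q ^+ N by rewrite ler_wpM2l.
      by have := T _ zwr N; have := T _ (ltW zr) N; lra.
    rewrite Normc.normcM [leRHS]mulrAC; apply: ler_wpM2r; first exact: normc_ge0.
    apply: le_trans (hl N) _; apply: ler_wpM2l.
      by rewrite mulr_ge0// !divr_ge0//; lra.
    by case/andP: rho01 => rho0 _; rewrite lerXn2r ?nnegrE ?/q ?le_max ?lexx ?rho0 ?orbT.
  have -> : psum c N (z + w) - psum c N z - lN N * w =
     \sum_(j < N) c j * ((z + w) ^+ j - z ^+ j - j%:R * z ^+ j.-1 * w).
    rewrite /psum /lN mulr_suml -!sumrB; apply: eq_bigr => j _; ring.
  rewrite /B mulrAC ler_pdivlMr ?exprn_gt0//.
  apply: (@le_trans _ _ (\sum_(j < N) (C * rho ^+ j) * nc w ^+ 2)).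
    apply: le_trans (ler_wpM2r _ (ler_normc_sum _ _ _)) _; first by rewrite exprn_ge0// ltW.
    rewrite mulr_suml; apply: ler_sum => j _; rewrite Normc.normcM.
    apply: (@le_trans _ _ (nc (c j) * ((j%:R + 1) ^+ 2 * r ^+ j * nc w ^+ 2))).
      rewrite -[leLHS]mulrA; apply: ler_wpM2l; first exact: normc_ge0.
      by rewrite mulrC; apply: expr_taylor2 => //; exact: ltW.
    have -> : nc (c j) * ((j%:R + 1) ^+ 2 * r ^+ j * nc w ^+ 2) =
      ((j%:R + 1) ^+ 2 * (nc (c j) * r ^+ j)) * nc w ^+ 2 by ring.
    by apply: ler_wpM2r; rewrite ?exprn_ge0 ?normc_ge0.
  rewrite -mulr_suml -mulr_sumr; apply: ler_wpM2r; first by rewrite exprn_ge0 ?normc_ge0.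
  apply: ler_wpM2l => //.
  by have := geom_partial_le 0 N rho01; rewrite expr0 mul1r big_mkord.
apply/derivable_complexP; exists l => e e0.
exists (Num.min (r - nc z) (e / (B + 1))).
  by rewrite lt_min subr_gt0 zr divr_gt0// ltr_wpDl.
move=> w; rewrite lt_min => /andP[w1 w2].
apply: le_trans (key w _) _.
  by apply: le_trans (le_normcD _ _) _; lra.
rewrite expr2 mulrA ler_wpM2r ?normc_ge0//.
move: w2; rewrite ltr_pdivlMr ?ltr_wpDl// => /ltW; apply: le_trans.
by rewrite mulrC ler_wpM2l ?normc_ge0// lerDl.
Qed.

End PowerSeries.

(** * Parseval's identity on circles *)

Section Parseval.
Variable R : realType.
Local Notation nc := (@Normc.normc R).
Local Notation cj := (@conjc R).
Implicit Types (c d : nat -> R[i]) (F G : R -> R[i]) (r : R).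

Let pi2 : (0 : R) <= 2 * pi. Proof. by rewrite mulr_ge0// pi_ge0. Qed.

Lemma ccont_psum c N r A : ccont A (fun x => psum c N (r%:C * cis x)).
Proof.
apply: ccont_sum => j; apply: ccontM; first exact: ccont_cst.
by apply: ccontX; apply: ccontM; [exact: ccont_cst|exact: ccont_cis].
Qed.

Lemma cint_psum_conj c d N r :
  cint 0 (2 * pi) (fun x => psum c N (r%:C * cis x) * cj (psum d N (r%:C * cis x))) =
  (2 * pi)%:C * \sum_(k < N) c k * cj (d k) * (r ^+ (2 * k))%:C.
Proof.
have cc (j k : nat) : ccont `[0, 2 * pi] (fun x => cis x ^+ j * cj (cis x) ^+ k).
  by apply: ccontM; apply: ccontX; [|apply: ccont_conj]; exact: ccont_cis.
have cc2 (j k : nat) : ccont `[0, 2 * pi] (fun x => (c j * cj (d k) * (r ^+ (j + k))%:C) * (cis x ^+ j * cj (cis x) ^+ k)).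
  by apply: ccontM; [exact: ccont_cst|exact: cc].
have cc3 (j : nat) : ccont `[0, 2 * pi] (fun x => \sum_(k < N) (c j * cj (d k) * (r ^+ (j + k))%:C) * (cis x ^+ j * cj (cis x) ^+ k)).
  by apply: ccont_sum => k; exact: cc2.
rewrite (@eq_cint _ _ _ _ (fun x => \sum_(j < N) \sum_(k < N) (c j * cj (d k) * (r ^+ (j + k))%:C) *
   (cis x ^+ j * cj (cis x) ^+ k))); last first.
  move=> x _; rewrite /psum (big_morph cj (@rmorphD _ _ _) (@rmorph0 _ _ _)) mulr_suml.
  apply: eq_bigr => j _; rewrite mulr_sumr; apply: eq_bigr => k _.
  rewrite conjcM conjcX conjcM conjc_real !exprMn exprD !rmorphM !rmorphXn; ring.
rewrite cint_sum; last by move=> j; exact: cc3.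
rewrite mulr_sumr; apply: eq_bigr => j _.
rewrite cint_sum; last by move=> k; exact: cc2.
rewrite (bigD1 j)//= big1 ?addr0; last first.
  move=> k kj; rewrite cintZ; last exact: cc.
  rewrite cint_cis_conj ifF ?mulr0//.
  by apply/negbTE; apply: contra kj => /eqP E; apply/eqP/val_inj.
rewrite cintZ; last exact: cc.
by rewrite cint_cis_conj eqxx mulrC addnn -muln2 mulnC.
Qed.

(** [F] and [G] are arbitrary functions on the circle approximated by partial sums, so the lemma
    applies to expansions whose coefficients are not yet known to be independent of the radius. *)
Lemma circle_parseval F G c d r C rho : 0 <= C -> 0 <= rho < 1 ->
  ccont `[0, 2 * pi] F -> ccont `[0, 2 * pi] G ->
  (forall N x, 0 <= x <= 2 * pi -> nc (F x - psum c N (r%:C * cis x)) <= C * rho ^+ N) ->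
  (forall N x, 0 <= x <= 2 * pi -> nc (G x - psum d N (r%:C * cis x)) <= C * rho ^+ N) ->
  exists C', forall N, nc (cint 0 (2 * pi) (fun x => F x * cj (G x)) -
    (2 * pi)%:C * \sum_(k < N) c k * cj (d k) * (r ^+ (2 * k))%:C) <= C' * rho ^+ N.
Proof.
move=> C0 rho01 cF cG hF hG; case/andP: (rho01) => rho0 /ltW rho1.
have [MF hMF] := ccont_bounded pi2 cF.
have [MG hMG] := ccont_bounded pi2 cG.
have z0 : 0 <= (0 : R) <= 2 * pi by rewrite lexx.
have MF0 : 0 <= MF by apply: le_trans (hMF _ z0); exact: normc_ge0.
have MG0 : 0 <= MG by apply: le_trans (hMG _ z0); exact: normc_ge0.
exists (2 * (C * (MG + (MF + C))) * (2 * pi - 0)) => N.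
have cS := @ccont_psum c N r `[0, 2 * pi].
have cT := @ccont_psum d N r `[0, 2 * pi].
have cFG := ccontM cF (ccont_conj cG).
have cST := ccontM cS (ccont_conj cT).
rewrite -cint_psum_conj -(cintB cFG cST).
have -> : 2 * (C * (MG + (MF + C))) * (2 * pi - 0) * rho ^+ N =
  2 * (C * rho ^+ N * (MG + (MF + C))) * (2 * pi - 0) by ring.
apply: (ler_cint pi2 (ccontB cFG cST)) => x x2pi.
have -> : F x * cj (G x) - psum c N (r%:C * cis x) * cj (psum d N (r%:C * cis x)) =
  (F x - psum c N (r%:C * cis x)) * cj (G x) + psum c N (r%:C * cis x) * cj (G x - psum d N (r%:C * cis x)).
  by rewrite rmorphB; ring.
have rN : 0 <= C * rho ^+ N by rewrite mulr_ge0 ?exprn_ge0.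
apply: le_trans (le_normcD _ _) _; rewrite !Normc.normcM !normc_conj mulrDr; apply: lerD.
  by apply: ler_pM; rewrite ?normc_ge0 ?hF ?hMG.
rewrite mulrC; apply: ler_pM; rewrite ?normc_ge0 ?hG//.
have -> : psum c N (r%:C * cis x) = F x - (F x - psum c N (r%:C * cis x)) by ring.
apply: le_trans (ler_normcB _ _) _; apply: lerD; first exact: hMF.
apply: le_trans (hF N x x2pi) _; rewrite -[leRHS]mulr1; apply: ler_wpM2l => //.
exact: exprn_ile1.
Qed.

Lemma tame_delta k : @tame R (fun j => (j == k)%:R).
Proof.
move=> r /andP[/ltW r0 /ltW r1]; exists 1 => j; case: eqP => _.
  by rewrite Normc.normc1 mul1r exprn_ile1.
by rewrite Normc.normc0 mul0r.
Qed.

Lemma psum_delta k N z : (k < N)%N -> psum (fun j => (j == k)%:R : R[i]) N z = z ^+ k.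
Proof.
move=> kN; rewrite /psum (bigD1 (Ordinal kN))//= eqxx mul1r big1 ?addr0// => j jk.
rewrite (_ : (_ == _) = false) ?mul0r//.
by apply/negbTE; apply: contra jk => /eqP E; apply/eqP/val_inj.
Qed.

Lemma pseries_monomial k : has_pseries (fun z : R[i] => z ^+ k) (fun j => (j == k)%:R).
Proof.
split; first exact: tame_delta.
move=> z _; apply: cvg_near_cst; exists k.+1 => // N /= kN.
by rewrite psum_delta// subrr Normc.normc0.
Qed.

End Parseval.

(** * Taylor expansion of analytic functions on the disk *)

Section AnalyticExpansion.
Variable R : realType.
Local Notation nc := (@Normc.normc R).
Local Notation cj := (@conjc R).
Variable f : R[i] -> R[i].
Hypothesis af : analytic_on_disk f.

Let pi2 : (0 : R) <= 2 * pi. Proof. by rewrite mulr_ge0// pi_ge0. Qed.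
Let pi20 : (0 : R) < 2 * pi. Proof. by rewrite mulr_gt0// pi_gt0. Qed.

Let nc_circle (r x : R) : 0 <= r -> nc (r%:C * cis x) = r.
Proof. by move=> r0; rewrite Normc.normcM normcR normc_cis mulr1 ger0_norm. Qed.

Lemma ccont_circle r A : 0 <= r < 1 -> ccont A (fun x => f (r%:C * cis x)).
Proof.
move=> /andP[r0 r1]; apply: ccont_comp.
  by apply: ccontM; [exact: ccont_cst|exact: ccont_cis].
by move=> x _; apply: (analytic_continuous af); rewrite -[disk _]/(is_true (nc (r%:C * cis x) < 1)) nc_circle.
Qed.

Let fc (r : R) j := ((2 * pi)^-1)%:C *
  cint 0 (2 * pi) (fun x => f (r%:C * cis x) * ((r^-1)%:C * cj (cis x)) ^+ j).

(** In the expansion of the kernel against the constant 1, only the term [j = 0] survives by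
    orthogonality. *)
Let kernel_total r z0 : 0 < r -> nc z0 < r ->
  cint 0 (2 * pi) (fun x => (1 - z0 * ((r^-1)%:C * cj (cis x)))^-1) = (2 * pi)%:C.
Proof.
move=> r0 z0r; apply/eqP; rewrite -subr_eq0 -normc_eq0 eq_le normc_ge0 andbT.
have rho01 : 0 <= nc z0 / r < 1.
  by rewrite ltr_pdivrMr// mul1r z0r andbT divr_ge0 ?normc_ge0// ltW.
apply: (@expr_geom_le0 _ _ (4 * pi * 1 * (1 - nc z0 / r)^-1) (nc z0 / r) 1%N rho01) => N N1.
have c1 : ccont `[0, 2 * pi] (fun=> 1 : R[i]) by exact: ccont_cst.
have c1b (x : R) : 0 <= x <= 2 * pi -> nc (1 : R[i]) <= 1 by rewrite Normc.normc1.
have := cauchy_kernel_expand r0 z0r N c1 c1b.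
rewrite (eq_bigr (fun j : 'I_N => if nat_of_ord j == 0%N then (2 * pi)%:C else 0)); last first.
  move=> j _; rewrite (@eq_cint _ _ _ _ (fun x => ((r^-1)%:C ^+ j) * (cj (cis x) ^+ j))); last first.
    by move=> x _; rewrite mul1r exprMn.
  rewrite cintZ ?cint_cis_conjX; last by apply: ccontX; apply: ccont_conj; exact: ccont_cis.
  by case: eqP => [->|_]; rewrite ?expr0 ?mulr1 ?mul1r// mulr0 mul0r.
have -> : \sum_(j < N) (if nat_of_ord j == 0%N then (2 * pi)%:C else 0) = (2 * pi)%:C :> R[i].
  case: N N1 => // N _; rewrite big_ord_recl big1; last by move=> i _.
  exact: addr0.
move=> H.
apply: le_trans H.
rewrite le_eqVlt; apply/orP; left; apply/eqP; congr (nc (_ - _)).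
by apply: eq_cint => x _; rewrite mul1r.
Qed.

Let expand r z0 M N : 0 < r -> r < 1 -> nc z0 < r ->
  (forall x, 0 <= x <= 2 * pi -> nc (f (r%:C * cis x)) <= M) ->
  nc (f z0 - psum (fc r) N z0) <= 2 * M * (1 - nc z0 / r)^-1 * (nc z0 / r) ^+ N.
Proof.
move=> r0 r1 z0r hM.
have cf : ccont `[0, 2 * pi] (fun x => f (r%:C * cis x)).
  by apply: ccont_circle; rewrite (ltW r0).
have := cauchy_kernel_expand r0 z0r N cf hM.
rewrite (cone_cauchy af r0 r1 z0r) kernel_total// => H.
rewrite -(ler_pM2l pi20); apply: le_trans (le_trans _ H) _; last first.
  by rewrite le_eqVlt; apply/orP; left; apply/eqP; ring.
apply: (@le_trans _ _ (nc ((2 * pi)%:C * (f z0 - psum (fc r) N z0)))).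
  by rewrite Normc.normcM normcR ger0_norm.
rewrite mulrBr (mulrC (f z0)) le_eqVlt; apply/orP; left; apply/eqP; congr (nc (_ - _)).
rewrite /psum mulr_sumr; apply: eq_bigr => j _; rewrite /fc !mulrA -rmorphM mulfV ?gt_eqF//.
by rewrite rmorph1 mul1r.
Qed.

(** On the smaller circle [f] is expanded with the coefficients of the larger one. Pairing it there
    with [z ^ j] isolates [fc r j], while the integral itself is by definition a multiple of
    [fc r' j]. *)
Let fc_const r r' j : 0 < r' -> r' < r -> r < 1 -> fc r' j = fc r j.
Proof.
move=> r'0 r'r r1; have r0 : 0 < r by exact: lt_trans r'r.
have r'1 : r' < 1 by exact: lt_trans r1.
have cf : ccont `[0, 2 * pi] (fun x => f (r%:C * cis x)).
  by apply: ccont_circle; rewrite (ltW r0).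
have cf' : ccont `[0, 2 * pi] (fun x => f (r'%:C * cis x)).
  by apply: ccont_circle; rewrite (ltW r'0).
have [M hM] := ccont_bounded pi2 cf.
have M0 : 0 <= M by apply: le_trans (hM 0 _); rewrite ?normc_ge0// lexx.
have rho01 : 0 <= r' / r < 1 by rewrite ltr_pdivrMr// mul1r r'r andbT divr_ge0// ltW.
have K0 : 0 <= (1 - r' / r)^-1 by rewrite invr_ge0; lra.
have cm : ccont `[0, 2 * pi] (fun x => (r'%:C * cis x) ^+ j).
  by apply: ccontX; apply: ccontM; [exact: ccont_cst|exact: ccont_cis].
have MK0 : 0 <= 2 * M * (1 - r' / r)^-1 by rewrite !mulr_ge0.
pose C1 := 2 * M * (1 - r' / r)^-1 + 1 / (r' / r) ^+ j.
have rj : 0 < (r' / r) ^+ j by rewrite exprn_gt0// divr_gt0.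
have C10 : 0 <= C1 by rewrite /C1 addr_ge0// divr_ge0// ltW.
have [||C' hC'] := @circle_parseval R _ _ (fc r) (fun i => (i == j)%:R) r' C1 _ C10 rho01 cf' cm.
- move=> N x _; apply: le_trans (expand N r0 r1 _ hM) _; first by rewrite nc_circle// ltW.
  rewrite nc_circle ?(ltW r'0)//; apply: ler_wpM2r; first by rewrite exprn_ge0//; case/andP: rho01.
  by rewrite /C1 lerDl divr_ge0// ltW.
- move=> N x _; have [jN|Nj] := ltnP j N.
    by rewrite psum_delta// subrr Normc.normc0 mulr_ge0// exprn_ge0//; case/andP: rho01.
  rewrite /psum big1 ?subr0; last first.
    move=> i _; rewrite (_ : (_ == _) = false) ?mul0r//.
    by apply/negbTE; rewrite neq_ltn (leq_trans (ltn_ord i) Nj).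
  rewrite normcX nc_circle ?(ltW r'0)//.
  apply: (@le_trans _ _ 1); first by apply: exprn_ile1; rewrite ltW.
  apply: (@le_trans _ _ (1 / (r' / r) ^+ j * (r' / r) ^+ N)).
    rewrite mulrAC ler_pdivlMr// !mul1r; apply: ler_wiXn2l => //; [by case/andP: rho01|by case/andP: rho01 => _ /ltW].
  by apply: ler_wpM2r; [rewrite exprn_ge0//; case/andP: rho01|rewrite /C1 lerDr].
have E : cint 0 (2 * pi) (fun x => f (r'%:C * cis x) * cj ((r'%:C * cis x) ^+ j)) =
   (2 * pi)%:C * (fc r' j * (r' ^+ (2 * j))%:C).
  rewrite (@eq_cint _ _ _ _ (fun x => (r' ^+ (2 * j))%:C * (f (r'%:C * cis x) * ((r'^-1)%:C * cj (cis x)) ^+ j))); last first.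
    move=> x _; rewrite conjcX conjcM conjc_real mulrCA; congr (_ * _).
    rewrite (_ : (r' ^+ (2 * j))%:C = (r' ^+ 2)%:C ^+ j); last by rewrite exprM rmorphXn.
    rewrite -exprMn; congr (_ ^+ _).
    by rewrite mulrA -rmorphM expr2 mulfK ?gt_eqF.
  rewrite cintZ; last first.
    apply: ccontM; first exact: cf'.
    by apply: ccontX; apply: ccontM; [exact: ccont_cst|apply: ccont_conj; exact: ccont_cis].
  rewrite /fc mulrC -mulrA [RHS]mulrA -!rmorphM mulfV ?gt_eqF// rmorph1 mul1r.
  by rewrite mulrC.
suff E2 : (2 * pi)%:C * (fc r' j * (r' ^+ (2 * j))%:C) = (2 * pi)%:C * (fc r j * (r' ^+ (2 * j))%:C).
  have nz (x : R) : 0 < x -> x%:C != 0 by move=> x0; rewrite fmorph_eq0 gt_eqF.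
  have := mulfI (nz _ pi20) E2; apply: mulIf; apply: nz; exact: exprn_gt0.
apply/eqP; rewrite -subr_eq0 -normc_eq0 eq_le normc_ge0 andbT.
apply: (@expr_geom_le0 _ _ C' _ j.+1 rho01) => N jN.
have S : \sum_(k < N) fc r k * cj ((nat_of_ord k == j)%:R) * (r' ^+ (2 * k))%:C = fc r j * (r' ^+ (2 * j))%:C.
  rewrite (bigD1 (Ordinal jN))//= eqxx big1; last first.
    move=> i ij; rewrite (_ : (_ == _) = false); last first.
      by apply/negbTE; apply: contra ij => /eqP E2; apply/eqP/val_inj.
    by rewrite conjc0 mulr0 mul0r.
  by rewrite conjc1 mulr1 addr0.
by have := hC' N; rewrite E S.
Qed.

Lemma analytic_pseries : exists c, has_pseries f c.
Proof.
have fcE r j : 0 < r -> r < 1 -> fc r j = fc (1 / 2) j.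
  move=> r0 r1; have [rh|hr|->//] := ltgtP r (1 / 2).
    by apply: fc_const => //; lra.
  by apply/esym/fc_const => //; lra.
(* Any fixed radius would do, as [fc] does not depend on it. *)
exists (fc (1 / 2)); split.
  move=> r /andP[r0 r1].
  have cf : ccont `[0, 2 * pi] (fun x => f (r%:C * cis x)).
    by apply: ccont_circle; rewrite (ltW r0).
  have [M hM] := ccont_bounded pi2 cf.
  exists (2 * M) => j; rewrite -(fcE r)// -ler_pdivlMr ?exprn_gt0// /fc Normc.normcM normcR.
  rewrite gtr0_norm ?invr_gt0// mulrC ler_pdivrMr//.
  have -> : 2 * M / r ^+ j * (2 * pi) = 2 * (M / r ^+ j) * (2 * pi - 0) by ring.
  apply: ler_cint => //.
    apply: ccontM; first exact: cf.
    by apply: ccontX; apply: ccontM; [exact: ccont_cst|apply: ccont_conj; exact: ccont_cis].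
  move=> x xpi; rewrite Normc.normcM normcX Normc.normcM normcR normc_conj normc_cis mulr1.
  rewrite gtr0_norm ?invr_gt0// exprVn; apply: ler_wpM2r; first by rewrite invr_ge0 exprn_ge0// ltW.
  exact: hM.
move=> z; rewrite /disk/= => z1; have z0 := normc_ge0 z.
have [r [r0 r1 zr]] : exists r, [/\ 0 < r, r < 1 & nc z < r].
  by exists ((nc z + 1) / 2); split; lra.
have cf : ccont `[0, 2 * pi] (fun x => f (r%:C * cis x)).
  by apply: ccont_circle; rewrite (ltW r0).
have [M hM] := ccont_bounded pi2 cf.
have rho01 : 0 <= nc z / r < 1 by rewrite ltr_pdivrMr// mul1r zr andbT divr_ge0// ltW.
apply: (geom_cvg0 (C := 2 * M * (1 - nc z / r)^-1) rho01) => N.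
have E : psum (fc r) N z = psum (fc (1 / 2)) N z.
  rewrite /psum; apply: eq_bigr => j _.
  by rewrite (fcE r j r0 r1).
by rewrite normc_ge0 -E; exact: (expand N r0 r1 zr hM).
Qed.

End AnalyticExpansion.

(** * Integration in polar coordinates *)

Section ComplexMeasurable.
Context d (T : measurableType d) (R : realType).
Local Notation nc := (@Normc.normc R).
Local Notation cj := (@conjc R).
Implicit Types (D : set T) (F G : T -> R[i]).

Definition cmeas D F := measurable_fun D (fun x => complex.Re (F x)) /\
  measurable_fun D (fun x => complex.Im (F x)).

Lemma cmeasD D F G : cmeas D F -> cmeas D G -> cmeas D (fun x => F x + G x).
Proof.
move=> [rF iF] [rG iG]; split.
  by under [X in measurable_fun _ X]eq_fun do rewrite RecD; exact: measurable_funD.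
by under [X in measurable_fun _ X]eq_fun do rewrite ImcD; exact: measurable_funD.
Qed.

Lemma cmeasM D F G : cmeas D F -> cmeas D G -> cmeas D (fun x => F x * G x).
Proof.
move=> [rF iF] [rG iG]; split.
  under [X in measurable_fun _ X]eq_fun do rewrite RecM.
  by apply: measurable_funB; exact: measurable_funM.
under [X in measurable_fun _ X]eq_fun do rewrite ImcM.
by apply: measurable_funD; exact: measurable_funM.
Qed.

Lemma cmeas_cst D c : cmeas D (fun=> c).
Proof. by split; exact: measurable_cst. Qed.

Lemma cmeasN D F : cmeas D F -> cmeas D (fun x => - F x).
Proof.
move=> mF; have := cmeasM (cmeas_cst D (-1)) mF.
by under [X in cmeas _ X -> _]eq_fun do rewrite mulN1r.
Qed.

Lemma cmeasB D F G : cmeas D F -> cmeas D G -> cmeas D (fun x => F x - G x).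
Proof. by move=> mF mG; apply: cmeasD => //; exact: cmeasN. Qed.

Lemma cmeasX D F n : cmeas D F -> cmeas D (fun x => F x ^+ n).
Proof.
move=> mF; elim: n => [|n IH]; first exact: cmeas_cst.
by under [X in cmeas _ X]eq_fun do rewrite exprS; exact: cmeasM.
Qed.

Lemma cmeas_conj D F : cmeas D F -> cmeas D (fun x => cj (F x)).
Proof.
move=> [rF iF]; split.
  by rewrite (_ : (fun x => complex.Re (cj (F x))) = (fun x => complex.Re (F x)))//; apply/funext => x; case: (F x).
rewrite (_ : (fun x => complex.Im (cj (F x))) = (fun x => - complex.Im (F x))); last by apply/funext => x; case: (F x).
exact: measurable_funN.
Qed.

Lemma cmeas_real D (u : T -> R) : measurable_fun D u -> cmeas D (fun x => (u x)%:C).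
Proof. by move=> mu; split => //; exact: measurable_cst. Qed.

Lemma cmeas_sum D I (s : seq I) (F : I -> T -> R[i]) : (forall i, cmeas D (F i)) ->
  cmeas D (fun x => \sum_(i <- s) F i x).
Proof.
move=> mF; elim: s => [|i s IH].
  by under [X in cmeas _ X]eq_fun do rewrite big_nil; exact: cmeas_cst.
by under [X in cmeas _ X]eq_fun do rewrite big_cons; exact: cmeasD.
Qed.

Lemma cmeas_normc2 D F : cmeas D F -> measurable_fun D (fun x => nc (F x) ^+ 2).
Proof.
move=> [rF iF]; under [X in measurable_fun _ X]eq_fun do rewrite sqr_normcE.
by apply: measurable_funD; exact: measurable_funX.
Qed.

Lemma normc_cvg_ReIm (u : nat -> R[i]) (l : R[i]) : (fun N => nc (l - u N)) @ \oo --> 0 ->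
  ((fun N => complex.Re (u N)) @ \oo --> complex.Re l) /\
  ((fun N => complex.Im (u N)) @ \oo --> complex.Im l).
Proof.
move=> /cvgrPdist_lt H; split; apply/cvgrPdist_lt => e e0; have := H e e0;
  apply: filterS => N; rewrite sub0r normrN ger0_norm ?normc_ge0// => H1; apply: le_lt_trans H1.
  by rewrite -RecN -RecD; exact: ger_normc_Re.
by rewrite -ImcN -ImcD; exact: ger_normc_Im.
Qed.

Lemma ReIm_cvg_normc (u : nat -> R[i]) (l : R[i]) :
  ((fun N => complex.Re (u N)) @ \oo --> complex.Re l) ->
  ((fun N => complex.Im (u N)) @ \oo --> complex.Im l) ->
  (fun N => nc (l - u N)) @ \oo --> 0.
Proof.
move=> hr hi.
have n0 (v : nat -> R) (x : R) : v @ \oo --> x -> (fun N => `|x - v N|) @ \oo --> 0.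
  move=> vx; rewrite -(normr0 R) -[X in `|X|](subrr x).
  by apply: cvg_norm; apply: cvgB => //; exact: cvg_cst.
have H := cvgD (n0 _ _ hr) (n0 _ _ hi).
rewrite addr0 in H; apply: (squeeze_cvgr _ (cvg_cst 0) (H _)); apply: nearW => N; rewrite normc_ge0/=.
apply: le_trans (ler_normc_ReIm _) _.
by rewrite RecD ImcD RecN ImcN.
Qed.

Lemma cmeas_cvg D (u : nat -> T -> R[i]) F : (forall N, cmeas D (u N)) ->
  (forall x, D x -> (fun N => nc (F x - u N x)) @ \oo --> 0) -> cmeas D F.
Proof.
move=> mu cu; split.
  apply: (measurable_fun_cvg (h := fun N x => complex.Re (u N x))); first by move=> N; have [] := mu N.
  by move=> x /cu /normc_cvg_ReIm[].
apply: (measurable_fun_cvg (h := fun N x => complex.Im (u N x))); first by move=> N; have [] := mu N.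
by move=> x /cu /normc_cvg_ReIm[].
Qed.

End ComplexMeasurable.

Section PolarBox.
Variable R : realType.
Local Notation nc := (@Normc.normc R).
Local Notation cj := (@conjc R).
Local Notation leb := (@lebesgue_measure R).
Local Notation leb2 := (leb \x leb)%E.
Local Notation box := (@polar_box R).

Lemma polarE (x : R * R) : polar x = x.1%:C * cis x.2.
Proof. by apply: complex_eqP; rewrite /polar /cis/=; ring. Qed.

Lemma measurable_box : measurable box.
Proof. by apply: measurableX; exact: measurable_itv. Qed.

Lemma patch_box (f : R * R -> \bar R) r t :
  (f \_ box) (r, t) = (((fun r => ((fun t => f (r, t)) \_ `[0, 2 * pi[) t) \_ `[0, 1[) r).
Proof.
rewrite !patchE/= /polar_box.
case: (boolP (r \in ([set` `[0, 1[] : set R))) => rU; case: (boolP (t \in ([set` `[0, 2 * pi[] : set R))) => tV.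
- by rewrite ifT//; apply/mem_set; split; exact: set_mem.
- by rewrite ifF//; apply/negbTE; apply: contra tV => /set_mem[_ ?]; exact: mem_set.
- by rewrite ifF//; apply/negbTE; apply: contra rU => /set_mem[? _]; exact: mem_set.
- by rewrite ifF//; apply/negbTE; apply: contra rU => /set_mem[? _]; exact: mem_set.
Qed.

Lemma fubini_F_box (f : R * R -> \bar R) :
  fubini_F leb (f \_ box) = (fun r => \int[leb]_(t in `[0%R, (2 * pi)%R[) f (r, t))%E \_ `[0, 1[.
Proof.
apply/funext => r; rewrite /fubini_F patchE; case: ifPn => rU.
  rewrite [RHS]integral_mkcond; apply: eq_integral => t _.
  by rewrite patch_box patchE rU.
rewrite (eq_integral (cst 0%E)); last by move=> t _; rewrite patch_box patchE (negbTE rU).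
by rewrite integral0.
Qed.

Lemma tonelli_box (f : R * R -> \bar R) : measurable_fun box f ->
  (forall x, box x -> (0 <= f x)%E) ->
  (\int[leb2]_(x in box) f x =
   \int[leb]_(r in `[0%R, 1%R[) \int[leb]_(t in `[0%R, (2 * pi)%R[) f (r, t))%E.
Proof.
move=> mf f0; rewrite integral_mkcond fubini_tonelli1.
- rewrite [RHS]integral_mkcond; apply: eq_integral => r _.
  exact: (congr1 (fun g => g r) (fubini_F_box f)).
- exact: (measurable_restrictT f measurable_box).1 mf.
- by move=> x; rewrite patchE; case: ifPn => // /set_mem; exact: f0.
Qed.

Lemma fubini_box (f : R * R -> \bar R) : leb2.-integrable box f ->
  (\int[leb2]_(x in box) f x =
   \int[leb]_(r in `[0%R, 1%R[) \int[leb]_(t in `[0%R, (2 * pi)%R[) f (r, t))%E /\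
  leb.-integrable `[0, 1[ (fun r => \int[leb]_(t in `[0%R, (2 * pi)%R[) f (r, t))%E.
Proof.
move=> if_; have imf := (@integrable_mkcond _ _ R leb2 box f measurable_box).1 if_; split.
  rewrite integral_mkcond -(integral12_prod_meas1 imf) [RHS]integral_mkcond.
  apply: eq_integral => r _; exact: (congr1 (fun g => g r) (fubini_F_box f)).
apply: (@integrable_mkcond _ _ R leb _ _ (measurable_itv _)).2.
have := integrable_fubini_F imf; apply: eq_integrable => // r _.
exact: (congr1 (fun g => g r) (fubini_F_box f)).
Qed.

Lemma cmeas_polar D : cmeas D (@polar R).
Proof.
split; rewrite /polar/=; apply: measurable_funM.
- exact: measurable_funTS measurable_fst.
- apply: measurable_funTS; apply: measurableT_comp measurable_snd.
  by apply: continuous_measurable_fun; exact: continuous_cos.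
- exact: measurable_funTS measurable_fst.
- apply: measurable_funTS; apply: measurableT_comp measurable_snd.
  by apply: continuous_measurable_fun; exact: continuous_sin.
Qed.

Lemma normc_polar (x : R * R) : 0 <= x.1 -> nc (polar x) = x.1.
Proof. by move=> x0; rewrite polarE Normc.normcM normcR normc_cis mulr1 ger0_norm. Qed.

Lemma box_disk x : box x -> disk (polar x).
Proof.
by move=> [/=]; rewrite in_itv/= => /andP[x0 x1] _; rewrite -[disk _]/(is_true (nc (polar x) < 1)) normc_polar.
Qed.

(** Measurability comes from the power series: the function is a pointwise limit of polynomials in
    [polar x]. *)
Lemma cmeas_pseries h c : has_pseries h c -> cmeas box (fun x => h (polar x)).
Proof.
move=> hc; apply: (@cmeas_cvg _ _ _ _ (fun N x => psum c N (polar x))).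
  move=> N; apply: cmeas_sum => j; apply: cmeasM; first exact: cmeas_cst.
  by apply: cmeasX; exact: cmeas_polar.
by move=> x /box_disk dx; exact: (hc.2 _ dx).
Qed.

End PolarBox.

Section ComplexIntegrable.
Context d (T : measurableType d) (R : realType) (mu : {measure set T -> \bar R}).
Local Notation nc := (@Normc.normc R).
Implicit Types (D : set T) (F G : T -> R[i]).

Definition cintegrable D F := mu.-integrable D (EFin \o (fun x => complex.Re (F x))) /\
  mu.-integrable D (EFin \o (fun x => complex.Im (F x))).

Lemma integrable_real_lin D (u v : T -> R) (x y : R) : measurable D ->
  mu.-integrable D (EFin \o u) -> mu.-integrable D (EFin \o v) ->
  mu.-integrable D (EFin \o (fun t => x * u t + y * v t)).
Proof.
move=> mD iu iv; have iZ (w : T -> R) z : mu.-integrable D (EFin \o w) ->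
    mu.-integrable D (EFin \o (fun t => z * w t)).
  by move=> iw; have := @integrableZl _ _ _ mu D mD z _ iw; apply: eq_integrable.
by have := integrableD mD (iZ _ x iu) (iZ _ y iv); apply: eq_integrable.
Qed.

Lemma cintegrableD D F G : measurable D -> cintegrable D F -> cintegrable D G ->
  cintegrable D (fun x => F x + G x).
Proof.
move=> mD [rF iF] [rG iG]; split.
  have := integrable_real_lin 1 1 mD rF rG; apply: eq_integrable => // x _ /=.
  by rewrite RecD !mul1r.
have := integrable_real_lin 1 1 mD iF iG; apply: eq_integrable => // x _ /=.
by rewrite ImcD !mul1r.
Qed.

Lemma cintegrableZ D F c : measurable D -> cintegrable D F -> cintegrable D (fun x => c * F x).
Proof.
move=> mD [rF iF]; split.
  have := integrable_real_lin (complex.Re c) (- complex.Im c) mD rF iF.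
  by apply: eq_integrable => // x _ /=; rewrite RecM mulNr.
have := integrable_real_lin (complex.Re c) (complex.Im c) mD iF rF.
by apply: eq_integrable => // x _ /=; rewrite ImcM.
Qed.

Lemma cintegralD D F G : measurable D -> cintegrable D F -> cintegrable D G ->
  cintegral mu D (fun x => F x + G x) = cintegral mu D F + cintegral mu D G.
Proof.
move=> mD [rF iF] [rG iG]; apply: complex_eqP; rewrite /cintegral ?RecD ?ImcD.
  rewrite [LHS]/= [X in _ = X + _]/= [X in _ = _ + X]/=.
  by under eq_Rintegral do rewrite RecD; rewrite RintegralD.
rewrite [LHS]/= [X in _ = X + _]/= [X in _ = _ + X]/=.
by under eq_Rintegral do rewrite ImcD; rewrite RintegralD.
Qed.

Lemma cintegralZ D F c : measurable D -> cintegrable D F ->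
  cintegral mu D (fun x => c * F x) = c * cintegral mu D F.
Proof.
move=> mD [rF iF]; have iZ (w : T -> R) z : mu.-integrable D (EFin \o w) ->
    mu.-integrable D (EFin \o (fun t => z * w t)).
  by move=> iw; have := @integrableZl _ _ _ mu D mD z _ iw; apply: eq_integrable.
apply: complex_eqP; rewrite ?RecM ?ImcM.
  transitivity (Rintegral mu D (fun x => complex.Re c * complex.Re (F x) - complex.Im c * complex.Im (F x))).
    by apply: eq_Rintegral => x _; rewrite RecM.
  by rewrite RintegralB ?RintegralZl//; exact: iZ.
transitivity (Rintegral mu D (fun x => complex.Re c * complex.Im (F x) + complex.Im c * complex.Re (F x))).
  by apply: eq_Rintegral => x _; rewrite ImcM.
by rewrite RintegralD ?RintegralZl//; exact: iZ.
Qed.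

Lemma cintegrable0 D : cintegrable D (fun=> 0).
Proof. by split; exact: integrable0. Qed.

Lemma cintegral0 D : cintegral mu D (fun=> 0) = 0.
Proof. by apply: complex_eqP; rewrite /= /Rintegral integral0_eq. Qed.

Lemma cintegrable_sum D I (s : seq I) (F : I -> T -> R[i]) : measurable D ->
  (forall i, cintegrable D (F i)) -> cintegrable D (fun x => \sum_(i <- s) F i x) /\
  cintegral mu D (fun x => \sum_(i <- s) F i x) = \sum_(i <- s) cintegral mu D (F i).
Proof.
move=> mD iF; elim: s => [|i s [IH1 IH2]].
  rewrite (_ : (fun x => \sum_(i <- [::]) F i x) = (fun=> 0)); last first.
    by apply/funext => x; rewrite big_nil.
  by rewrite big_nil cintegral0; split => //; exact: cintegrable0.
rewrite (_ : (fun x => \sum_(i <- i :: s) F i x) = (fun x => F i x + \sum_(i <- s) F i x)); last first.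
  by apply/funext => x; rewrite big_cons.
split; first exact: cintegrableD.
by rewrite cintegralD// IH2 big_cons.
Qed.

Lemma le_cintegrable D F (u : T -> R) : measurable D -> cmeas D F ->
  mu.-integrable D (EFin \o u) -> (forall x, D x -> nc (F x) <= u x) -> cintegrable D F.
Proof.
move=> mD [rF iF] iu Fu.
have key (v : T -> R) : measurable_fun D v -> (forall x, D x -> `|v x| <= nc (F x)) ->
    mu.-integrable D (EFin \o v).
  move=> mv vF; apply: (le_integrable mD _ _ iu); first exact/measurable_EFinP.
  move=> x Dx /=; rewrite lee_fin (le_trans (vF x Dx))// (le_trans (Fu x Dx))// ler_norm//.
by split; apply: key => // x Dx; [exact: ger_normc_Re|exact: ger_normc_Im].
Qed.

Lemma dominated_Rintegral D (s : nat -> T -> R) (l u : T -> R) : measurable D ->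
  (forall N, measurable_fun D (s N)) -> mu.-integrable D (EFin \o u) ->
  (forall N x, D x -> `|s N x| <= u x) -> (forall x, D x -> (fun N => s N x) @ \oo --> l x) ->
  (fun N => Rintegral mu D (s N)) @ \oo --> Rintegral mu D l.
Proof.
move=> mD ms iu su sl.
have il : mu.-integrable D (EFin \o l).
  apply: (le_integrable mD _ _ iu).
    by apply/measurable_EFinP; exact: (measurable_fun_cvg ms sl).
  move=> x Dx /=; rewrite lee_fin (le_trans _ (ler_norm _))//.
  have H : (fun N => `|s N x|) @ \oo --> `|l x| by apply: cvg_norm; exact: sl.
  rewrite -(cvg_lim _ H)//; apply: limr_le; first by apply/cvg_ex; exists `|l x|.
  by apply: nearW => N; exact: su.
rewrite /Rintegral; apply: (fine_cvg (f := fun N => \int[mu]_(x in D) (s N x)%:E)%E).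
rewrite fineK; last exact: (integrable_fin_num mD il).
apply: (@dominated_cvg _ _ _ _ _ mD (fun N x => (s N x)%:E) _ (EFin \o u)) => //.
- by move=> N; exact/measurable_EFinP/ms.
- by move=> x Dx; apply: cvg_EFin; [exact: nearW|exact: sl].
Qed.

End ComplexIntegrable.

(** * The Bergman norm circle by circle *)

Section Energy.
Variable R : realType.
Local Notation nc := (@Normc.normc R).
Local Notation cj := (@conjc R).
Local Notation leb := (@lebesgue_measure R).
Local Notation leb2 := (leb \x leb)%E.
Local Notation box := (@polar_box R).

Implicit Types (h g F G : R[i] -> R[i]) (c d : nat -> R[i]) (r : R).

Let pi2 : (0 : R) <= 2 * pi. Proof. by rewrite mulr_ge0// pi_ge0. Qed.

Definition shift q (c : nat -> R[i]) j := if (j < q)%N then 0 else c (j - q)%N.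

Lemma pseries_lin h g c d (al : R[i]) : has_pseries h c -> has_pseries g d ->
  has_pseries (fun z => al * h z - g z) (fun j => al * c j - d j).
Proof.
move=> [tc hc] [td hd]; split.
  move=> r r01; have [M hM] := tc r r01; have [M' hM'] := td r r01.
  exists (nc al * M + M') => j; case/andP: (r01) => /ltW r0 _.
  apply: le_trans (ler_wpM2r (exprn_ge0 _ r0) (ler_normcB _ _)) _.
  rewrite mulrDl Normc.normcM -mulrA; apply: lerD; last exact: hM'.
  by apply: ler_wpM2l; rewrite ?normc_ge0.
move=> z dz.
have H : (fun N => nc al * nc (h z - psum c N z) + nc (g z - psum d N z)) @ \oo --> (nc al * 0 + 0 : R).
  by apply: cvgD; [apply: cvgM; [exact: cvg_cst|exact: hc]|exact: hd].
rewrite mulr0 addr0 in H; apply: (squeeze_cvgr _ (cvg_cst 0) H); apply: nearW => N.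
rewrite normc_ge0/= -Normc.normcM.
have -> : al * h z - g z - psum (fun j => al * c j - d j) N z =
   al * (h z - psum c N z) - (g z - psum d N z).
  have -> : psum (fun j => al * c j - d j) N z = al * psum c N z - psum d N z.
    by rewrite /psum mulr_sumr -sumrB; apply: eq_bigr => j _; ring.
  by ring.
exact: ler_normcB.
Qed.

Lemma psum_shift q c N z : psum (shift q c) (q + N) z = z ^+ q * psum c N z.
Proof.
rewrite /psum big_split_ord/= big1 ?add0r; last by move=> i _; rewrite /shift ltn_ord mul0r.
rewrite mulr_sumr; apply: eq_bigr => i _.
by rewrite /shift ltnNge leq_addr/= addKn exprD; ring.
Qed.

Lemma tame_shift q c : tame c -> tame (shift q c).
Proof.
move=> tc r r01; have [M hM] := tc r r01; case/andP: (r01) => /ltW r0 /ltW r1.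
have M0 : 0 <= M by apply: le_trans (hM 0%N); rewrite mulr_ge0 ?normc_ge0.
exists M => j; rewrite /shift; case: ltnP => [_|qj]; first by rewrite Normc.normc0 mul0r.
apply: le_trans (hM (j - q)%N); apply: ler_wpM2l; first exact: normc_ge0.
by apply: ler_wiXn2l => //; exact: leq_subr.
Qed.

Lemma pseries_shift q h c : has_pseries h c -> has_pseries (fun z => z ^+ q * h z) (shift q c).
Proof.
move=> hc; split; first exact: tame_shift hc.1.
move=> z dz; rewrite -(cvg_shiftn q).
under eq_fun do rewrite addnC psum_shift -mulrBr Normc.normcM.
have H : (fun N => nc (z ^+ q) * nc (h z - psum c N z)) @ \oo --> (nc (z ^+ q) * 0 : R).
  by apply: cvgM; [exact: cvg_cst|exact: hc.2].
by rewrite mulr0 in H.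
Qed.

Lemma pseries_circle_parseval F G c d r : has_pseries F c -> has_pseries G d -> 0 <= r < 1 ->
  (fun N => nc (cint 0 (2 * pi) (fun t => F (r%:C * cis t) * cj (G (r%:C * cis t))) -
    (2 * pi)%:C * \sum_(k < N) c k * cj (d k) * (r ^+ (2 * k))%:C)) @ \oo --> 0.
Proof.
move=> hF hG r01.
have r'01 : 0 < (r + 1) / 2 < 1 by lra.
have [C1 [r1 [C10 r101 T1]]] := pseries_tail hF r'01.
have [C2 [r2 [C20 r201 T2]]] := pseries_tail hG r'01.
pose q := Num.max r1 r2.
have q01 : 0 <= q < 1 by rewrite /q le_max gt_max; case/andP: r101 => -> ->; case/andP: r201 => _ ->.
have q0 : 0 <= q by case/andP: q01.
have r1q : r1 <= q by rewrite /q le_max lexx.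
have r2q : r2 <= q by rewrite /q le_max lexx orbT.
have ncr t : nc (r%:C * cis t) <= (r + 1) / 2.
  by rewrite Normc.normcM normcR normc_cis mulr1 ger0_norm; lra.
have C120 : 0 <= C1 + C2 by rewrite addr_ge0.
have cvr f f' : has_pseries f f' -> ccont `[0, 2 * pi] (fun t => f (r%:C * cis t)).
  by move=> hf; apply: ccont_circle => //; exact: pseries_analytic hf.
have [||C' hC'] := @circle_parseval R _ _ c d r _ q C120 q01 (cvr _ _ hF) (cvr _ _ hG).
- move=> N t _; apply: le_trans (T1 _ (ncr t) N) _; apply: ler_pM => //.
  + by case/andP: r101 => ? _; exact: exprn_ge0.
  + by rewrite lerDl.
  + by case/andP: r101 => r10 _; apply: lerXn2r; rewrite ?nnegrE.
- move=> N t _; apply: le_trans (T2 _ (ncr t) N) _; apply: ler_pM => //.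
  + by case/andP: r201 => ? _; exact: exprn_ge0.
  + by rewrite lerDr.
  + by case/andP: r201 => r20 _; apply: lerXn2r; rewrite ?nnegrE.
by apply: (@geom_cvg0 _ _ C' q q01) => N; rewrite normc_ge0 hC'.
Qed.

(** Radial density of the squared Bergman norm. By Parseval it equals the sum of
    [2 r |c_k|^2 r^(2k)], whose partial sums are [energy_psum]. *)
Definition circ_energy h (r : R) : R :=
  r / pi * Rintegral leb `[0, 2 * pi] (fun t => nc (h (r%:C * cis t)) ^+ 2).

Definition energy_psum (c : nat -> R[i]) N (r : R) : R :=
  \sum_(k < N) 2 * r * (nc (c k) ^+ 2 * r ^+ (2 * k)).

Lemma energy_psum_cvg h c r : has_pseries h c -> 0 <= r < 1 ->
  (fun N => energy_psum c N r) @ \oo --> circ_energy h r.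
Proof.
move=> hc r01; have [+ _] := normc_cvg_ReIm (pseries_circle_parseval hc hc r01).
rewrite Re_cint => H.
have : (fun N => r / pi * complex.Re ((2 * pi)%:C * \sum_(k < N) c k * cj (c k) * (r ^+ (2 * k))%:C)) @ \oo -->
    (r / pi * Rintegral leb `[0, 2 * pi] (fun t => complex.Re (h (r%:C * cis t) * cj (h (r%:C * cis t))))).
  by apply: cvgM; [exact: cvg_cst|exact: H].
have -> : r / pi * Rintegral leb `[0, 2 * pi] (fun t => complex.Re (h (r%:C * cis t) * cj (h (r%:C * cis t)))) = circ_energy h r.
  by congr (_ * _); apply: eq_Rintegral => t _; rewrite mulc_conj.
apply: cvg_trans; apply: near_eq_cvg; apply: nearW => N /=.
rewrite RecZ Re_sum /energy_psum mulrA.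
have pn : pi != 0 :> R by rewrite lt0r_neq0// pi_gt0.
have -> : r / pi * (2 * pi) = 2 * r by rewrite mulrCA mulfVK.
rewrite mulr_sumr; apply: eq_bigr => k _; congr (_ * _).
by rewrite mulc_conj -rmorphM.
Qed.

Lemma energy_psum_le h c r N : has_pseries h c -> 0 <= r < 1 ->
  energy_psum c N r <= circ_energy h r.
Proof.
move=> hc r01; have H := energy_psum_cvg hc r01; rewrite -(cvg_lim _ H)//.
have r0 : 0 <= r by lra.
apply: (nondecreasing_cvgn_le (u_ := fun N => energy_psum c N r)); last by apply/cvg_ex; eexists; exact: H.
apply/nondecreasing_seqP => k; rewrite /energy_psum big_ord_recr/= lerDl.
by rewrite !mulr_ge0 ?exprn_ge0 ?normc_ge0.
Qed.

Lemma circ_energy_ge0 h c r : has_pseries h c -> 0 <= r < 1 -> 0 <= circ_energy h r.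
Proof. by move=> hc r01; have := energy_psum_le 0 hc r01; rewrite /energy_psum big_ord0. Qed.

Lemma measurable_circ_energy h c : has_pseries h c -> measurable_fun (`[0, 1[ : set R) (circ_energy h).
Proof.
move=> hc; apply: (measurable_fun_cvg (h := fun N r => energy_psum c N r)); last first.
  by move=> r; rewrite /= in_itv/= => r01; exact: energy_psum_cvg.
move=> N; apply: measurable_sum => k; apply: measurable_funM; first by apply: measurable_funM.
by apply: measurable_funM => //; exact: exprn_measurable.
Qed.

Lemma Rintegral_circle (v : R -> R) : {within `[0, 2 * pi], continuous v} ->
  (\int[leb]_(t in `[0%R, (2 * pi)%R[) (v t)%:E)%E = (Rintegral leb `[0, 2 * pi] v)%:E.
Proof.
move=> cv.
have iv : leb.-integrable `[0, 2 * pi] (EFin \o v).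
  by apply: continuous_compact_integrable; [exact: segment_compact|exact: cv].
rewrite /Rintegral fineK; last exact: (integrable_fin_num _ iv).
apply: integral_itv_bndo_bndc.
have /integrableP[mv _] := iv; apply: measurable_funS mv => //.
by apply: subset_itvl; rewrite bnd_simp.
Qed.

Lemma circ_energyE h c r : has_pseries h c -> 0 <= r < 1 ->
  (\int[leb]_(t in `[0%R, (2 * pi)%R[) (nc (h (polar (r, t))) ^+ 2 * (r / pi))%:E)%E =
  (circ_energy h r)%:E.
Proof.
move=> hc r01.
have ch : ccont `[0, 2 * pi] (fun t => h (r%:C * cis t)).
  by apply: ccont_circle => //; exact: pseries_analytic hc.
have cn := ccont_normc ch.
have cn2 : {within `[0, 2 * pi], continuous (fun t => nc (h (r%:C * cis t)) ^+ 2)}.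
  by move=> t; apply: (@cvgM R); exact: cn.
under eq_integral do rewrite polarE/=.
rewrite (@Rintegral_circle (fun t => nc (h (r%:C * cis t)) ^+ 2 * (r / pi))); last first.
  by move=> t; apply: (@cvgM R); [exact: cn2|exact: cvg_cst].
rewrite RintegralZr//; first by rewrite mulrC.
by apply: continuous_compact_integrable; [exact: segment_compact|exact: cn2].
Qed.

(** Tonelli reduces square integrability to one radial integral; with the bounds on [energy_psum],
    it can then be compared coefficient by coefficient. *)
Lemma square_integrableP h c : has_pseries h c ->
  square_integrable h <-> leb.-integrable `[0, 1[ (EFin \o circ_energy h).
Proof.
move=> hc.
have mh := cmeas_pseries hc.
have mf : measurable_fun box (fun x => (nc (h (polar x)) ^+ 2 * (x.1 / pi))%:E).
  apply/measurable_EFinP; apply: measurable_funM; first exact: cmeas_normc2.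
  by apply: measurable_funM => //; exact: measurable_funTS measurable_fst.
have f0 x : box x -> (0 <= (nc (h (polar x)) ^+ 2 * (x.1 / pi))%:E)%E.
  move=> [/=]; rewrite in_itv/= => /andP[x0 _] _.
  by rewrite lee_fin mulr_ge0 ?exprn_ge0 ?normc_ge0// divr_ge0// pi_ge0.
have E : (\int[leb2]_(x in box) (nc (h (polar x)) ^+ 2 * (x.1 / pi))%:E =
   \int[leb]_(r in `[0%R, 1%R[) (circ_energy h r)%:E)%E.
  rewrite tonelli_box//; apply: eq_integral => r; rewrite inE/= in_itv/= => r01.
  exact: (circ_energyE hc).
have me : measurable_fun (`[0, 1[ : set R) (EFin \o circ_energy h).
  by apply/measurable_EFinP; exact: measurable_circ_energy hc.
have e0 r : (`[0, 1[%classic : set R) r -> (0 <= (circ_energy h r)%:E)%E.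
  by rewrite /= in_itv/= => r01; rewrite lee_fin (circ_energy_ge0 hc).
have E1 : (\int[leb]_(r in `[0%R, 1%R[) `|(EFin \o circ_energy h) r| =
    \int[leb]_(r in `[0%R, 1%R[) (circ_energy h r)%:E)%E.
  by apply: eq_integral => r; rewrite inE => /e0 ?; rewrite gee0_abs.
have E2 : (\int[leb2]_(x in box) `|(nc (h (polar x)) ^+ 2 * (x.1 / pi))%:E| =
    \int[leb2]_(x in box) (nc (h (polar x)) ^+ 2 * (x.1 / pi))%:E)%E.
  by apply: eq_integral => x; rewrite inE => /f0 ?; rewrite gee0_abs.
have E3 := etrans E2 (etrans E (esym E1)).
split => /integrableP[_ H]; apply/integrableP; split; [exact: me| |exact: mf|].
  by apply: le_lt_trans H; rewrite le_eqVlt; apply/orP; left; apply/eqP; exact: esym E3.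
by apply: le_lt_trans H; rewrite le_eqVlt; apply/orP; left; apply/eqP; exact: E3.
Qed.

Lemma circ_energy_shift q h c r : has_pseries h c -> 0 <= r < 1 ->
  circ_energy (fun z => z ^+ q * h z) r = r ^+ (2 * q) * circ_energy h r.
Proof.
move=> hc r01; rewrite /circ_energy.
have ch : ccont `[0, 2 * pi] (fun t => h (r%:C * cis t)).
  by apply: ccont_circle => //; exact: pseries_analytic hc.
have cn := ccont_normc ch.
rewrite [RHS]mulrCA; congr (_ * _); rewrite -RintegralZl//; last first.
  apply: continuous_compact_integrable; first exact: segment_compact.
  by move=> t; apply: (@cvgM R); exact: cn.
apply: eq_Rintegral => t _.
rewrite Normc.normcM normcX Normc.normcM normcR normc_cis mulr1 ger0_norm; last by lra.
by rewrite exprMn -exprM mulnC.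
Qed.

End Energy.

(** * Toeplitz operators on Taylor coefficients *)

Section Inner.
Variable R : realType.
Local Notation nc := (@Normc.normc R).
Local Notation cj := (@conjc R).
Local Notation leb := (@lebesgue_measure R).
Local Notation leb2 := (leb \x leb)%E.
Local Notation box := (@polar_box R).
Implicit Types (h g F G : R[i] -> R[i]) (c d : nat -> R[i]) (r : R).

Lemma conjcE (z : R[i]) : Num.conj z = cj z.
Proof. by []. Qed.

(** Fubini with a change of endpoints: the radial interval becomes open, so that division by [r] is
    allowed, and the angular one closed, as in [cint]. *)
Lemma box_Rintegral (v : R * R -> R) : leb2.-integrable box (EFin \o v) ->
  (forall r, 0 <= r < 1 -> {within `[0, 2 * pi], continuous (fun t => v (r, t))}) ->
  Rintegral leb2 box v =
    Rintegral leb `]0, 1[ (fun r => Rintegral leb `[0, 2 * pi] (fun t => v (r, t))).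
Proof.
move=> iv cv; have [E iF] := fubini_box iv.
have EV r : 0 <= r < 1 -> (\int[leb]_(t in `[0%R, (2 * pi)%R[) (EFin \o v) (r, t))%E =
    (Rintegral leb `[0, 2 * pi] (fun t => v (r, t)))%:E.
  by move=> r01; apply: Rintegral_circle; exact: cv.
have iR : leb.-integrable `[0, 1[ (EFin \o (fun r => Rintegral leb `[0, 2 * pi] (fun t => v (r, t)))).
  by apply: eq_integrable iF => // r; rewrite inE/= in_itv/= => r01; rewrite EV.
rewrite Rintegral_itv_obnd_cbnd; last first.
  by apply: integrableS iR => //; apply: subset_itvr; rewrite bnd_simp.
rewrite /Rintegral E; congr fine; apply: eq_integral => r; rewrite inE/= in_itv/= => r01.
by rewrite EV.
Qed.

Variables (phi : R -> R[i]) (q : nat) (M : R).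
Hypothesis mphi : cmeas (`[0, 1[ : set R) phi.
Hypothesis phiM : forall r, 0 <= r < 1 -> nc (phi r) <= M.

Variables (h g k : R[i] -> R[i]) (c d e : nat -> R[i]).
Hypotheses (hc : has_pseries h c) (gd : has_pseries g d) (ke : has_pseries k e).
Hypotheses (h2 : square_integrable h) (g2 : square_integrable g) (k2 : square_integrable k).

Definition moment (f : R -> R[i]) n := cintegral leb `]0, 1[ (fun r => f r * (r ^+ n)%:C).

Let w (x : R * R) : R[i] := (x.1 / pi)%:C *
  ((cis x.2 ^+ q * phi x.1 * h (polar x) - g (polar x)) * cj (k (polar x))).

Let M0 : 0 <= M.
Proof. by apply: le_trans (phiM (r := 0) _); rewrite ?normc_ge0// lexx ltr01. Qed.

Let inner_w : inner (fun z => quasihomogeneous q phi z * h z - g z) k = cintegral leb2 box w.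
Proof.
have E x : box x -> (x.1 / pi)%:C * ((quasihomogeneous q phi (polar x) * h (polar x) - g (polar x)) *
   Num.conj (k (polar x))) = w x.
  move=> [/=]; rewrite in_itv/= => /andP[x0 x1] _; rewrite conjcE /w.
  have [->|xn] := eqVneq x.1 0; first by rewrite mul0r !mul0r.
  congr (_ * ((_ * _ - _) * _)).
  rewrite /quasihomogeneous normc_polar//; congr (_ ^+ _ * _).
  by rewrite polarE mulrAC divff ?mul1r// fmorph_eq0.
by apply: complex_eqP => /=; apply: eq_Rintegral => x; rewrite inE => bx; rewrite E.
Qed.

Let w_meas : cmeas box w.
Proof.
have mfst : measurable_fun box (@fst R R) by exact: measurable_funTS measurable_fst.
have mphi1 : cmeas box (fun x : R * R => phi x.1).
  case: mphi => mr mi; split; [apply: (measurable_comp _ _ mr)|apply: (measurable_comp _ _ mi)] => //.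
  - by move=> _ [x [/= ? _] <-].
  - by move=> _ [x [/= ? _] <-].
apply: cmeasM; first by apply: cmeas_real; exact: measurable_funM.
apply: cmeasM; last by apply: cmeas_conj; exact: cmeas_pseries ke.
apply: cmeasB; last exact: cmeas_pseries gd.
apply: cmeasM; last exact: cmeas_pseries hc.
apply: cmeasM => //; apply: cmeasX; split; apply: measurable_funTS; apply: measurableT_comp measurable_snd.
  by apply: continuous_measurable_fun; exact: continuous_cos.
by apply: continuous_measurable_fun; exact: continuous_sin.
Qed.

(** From [u s <= u^2 + s^2], the integrand is dominated by [M^2 |h|^2 + |g|^2 + 2 |k|^2] with
    density [r / pi]. *)
Let w_int : cintegrable leb2 box w.
Proof.
have i1 := @integrable_real_lin _ _ _ leb2 box _ _ (M ^+ 2) 1 (@measurable_box R) h2 g2.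
have i2 := @integrable_real_lin _ _ _ leb2 box _ _ 1 2 (@measurable_box R) i1 k2.
apply: (@le_cintegrable _ _ _ leb2 _ _ _ (@measurable_box R) w_meas i2) => x bx.
have [/=] := bx; rewrite in_itv/= => /andP[x0 x1] _.
have xp : 0 <= x.1 / pi by rewrite divr_ge0// pi_ge0.
rewrite !Normc.normcM normcR ger0_norm// normc_conj.
apply: (@le_trans _ _ (x.1 / pi * ((M * nc (h (polar x)) + nc (g (polar x))) * nc (k (polar x))))).
  apply: ler_wpM2l => //; apply: ler_wpM2r; first exact: normc_ge0.
  apply: le_trans (ler_normcB _ _) _; rewrite lerD2r Normc.normcM; apply: ler_wpM2r; first exact: normc_ge0.
  by rewrite Normc.normcM normcX normc_cis expr1n mul1r phiM// x0.
move: (nc (h _)) (nc (g _)) (nc (k _)) (x.1 / pi) xp => a b s y y0.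
have -> : 1 * (M ^+ 2 * (a ^+ 2 * y) + 1 * (b ^+ 2 * y)) + 2 * (s ^+ 2 * y) =
  y * ((M * a) ^+ 2 + b ^+ 2 + 2 * s ^+ 2) by ring.
apply: ler_wpM2l => //; move: (M * a) => u.
by have := sqr_ge0 (u - s); have := sqr_ge0 (b - s); have := sqr_ge0 u; have := sqr_ge0 b;
  have := sqr_ge0 s; nra.
Qed.

Let w_ccont r : 0 <= r < 1 -> ccont `[0, 2 * pi] (fun t => w (r, t)).
Proof.
move=> r01.
have cc f b : has_pseries f b -> ccont `[0, 2 * pi] (fun t => f (polar (r, t))).
  move=> hf; have := ccont_circle (pseries_analytic hf) r01 (A := `[0, 2 * pi]).
  by congr (ccont _ _); apply/funext => t; rewrite polarE.
have -> : (fun t => w (r, t)) = (fun t => (r / pi)%:C *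
  ((cis t ^+ q * phi r * h (polar (r, t)) - g (polar (r, t))) * cj (k (polar (r, t))))) by [].
apply: ccontM; first exact: ccont_cst.
apply: ccontM; last by apply: ccont_conj; exact: cc ke.
apply: ccontB; last exact: cc gd.
apply: ccontM; last exact: cc hc.
apply: ccontM; last exact: ccont_cst.
by apply: ccontX; exact: ccont_cis.
Qed.

Let I r := cint 0 (2 * pi) (fun t => w (r, t)).

Let inner_I : inner (fun z => quasihomogeneous q phi z * h z - g z) k = cintegral leb `]0, 1[ I.
Proof.
rewrite inner_w; case: w_int => iR iI; apply: complex_eqP => /=.
  rewrite (@box_Rintegral (fun x => complex.Re (w x)))//.
  by move=> r r01; exact: ccont_Re (w_ccont r01).
rewrite (@box_Rintegral (fun x => complex.Im (w x)))//.
by move=> r r01; exact: ccont_Im (w_ccont r01).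
Qed.

(** Term [j] of Parseval's sum on the circle of radius [r]. The subtraction is truncated only when
    [j < q], where [shift q c j] is 0. *)
Let T j r : R[i] := (2 * shift q c j * cj (e j)) * (phi r * (r ^+ (2 * j + 1 - q))%:C) +
  (- 2 * d j * cj (e j)) * (r ^+ (2 * j + 1))%:C.
Let S N r := \sum_(j < N) T j r.
(** On a circle of radius [r > 0] the symbol is [al r * z ^ q], so the product with [h] is a
    constant times a power series. *)
Let al r : R[i] := phi r * ((r ^+ q)^-1)%:C.

Let TE j r : 0 < r < 1 -> T j r = (2 * r)%:C * ((al r * shift q c j - d j) * cj (e j) * (r ^+ (2 * j))%:C).
Proof.
move=> /andP[r0 _]; rewrite /T /shift /al; have rn : r != 0 by rewrite gt_eqF.
case: ltnP => [_|qj]; first by rewrite addn1 exprS !rmorphM rmorph_nat; ring.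
have E : r ^+ (2 * j + 1 - q) = r * r ^+ (2 * j) * (r ^+ q)^-1.
  rewrite -exprS -(addn1 (2 * j)) -{2}(subnK (_ : q <= 2 * j + 1)%N); last by lia.
  by rewrite exprD mulfK// expf_neq0.
rewrite E addn1 exprS !rmorphM rmorph_nat; ring.
Qed.

Let circle_I r : 0 < r < 1 -> (fun N => nc (I r - S N r)) @ \oo --> 0.
Proof.
move=> r01; case/andP: (r01) => r0 r1; have rn : r != 0 by rewrite gt_eqF.
have r01' : 0 <= r < 1 by rewrite (ltW r0).
have pn : pi != 0 :> R by rewrite lt0r_neq0// pi_gt0.
have hl := pseries_lin (al r) (pseries_shift q hc) gd.
have P := pseries_circle_parseval hl ke r01'.
have IE : I r = (r / pi)%:C * cint 0 (2 * pi) (fun t =>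
   (al r * ((r%:C * cis t) ^+ q * h (r%:C * cis t)) - g (r%:C * cis t)) * cj (k (r%:C * cis t))).
  rewrite -cintZ; last first.
    apply: ccontM; first exact: (ccont_circle (pseries_analytic hl) r01').
    by apply: ccont_conj; exact: (ccont_circle (pseries_analytic ke) r01').
  apply: eq_cint => t _; rewrite /w polarE /=; congr (_ * ((_ - _) * _)).
  have E1 : ((r ^+ q)^-1)%:C * r%:C ^+ q = 1.
    by rewrite -rmorphXn -rmorphM mulVf ?expf_neq0// rmorph1.
  rewrite mulrA; congr (_ * _); rewrite /al exprMn.
  have -> : phi r * ((r ^+ q)^-1)%:C * (r%:C ^+ q * cis t ^+ q) =
    (((r ^+ q)^-1)%:C * r%:C ^+ q) * (cis t ^+ q * phi r) by ring.
  by rewrite E1 mul1r.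
have P2 : (fun N => nc (r / pi)%:C * nc (cint 0 (2 * pi) (fun t =>
   (al r * ((r%:C * cis t) ^+ q * h (r%:C * cis t)) - g (r%:C * cis t)) * cj (k (r%:C * cis t))) -
   (2 * pi)%:C * \sum_(j < N) (al r * shift q c j - d j) * cj (e j) * (r ^+ (2 * j))%:C)) @ \oo --> (nc (r / pi)%:C * 0 : R).
  by apply: cvgM; [exact: cvg_cst|exact: P].
rewrite mulr0 in P2.
have E N : nc (I r - S N r) = nc (r / pi)%:C * nc (cint 0 (2 * pi) (fun t =>
   (al r * ((r%:C * cis t) ^+ q * h (r%:C * cis t)) - g (r%:C * cis t)) * cj (k (r%:C * cis t))) -
   (2 * pi)%:C * \sum_(j < N) (al r * shift q c j - d j) * cj (e j) * (r ^+ (2 * j))%:C).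
  rewrite -Normc.normcM mulrBr -IE; congr (nc (_ - _)).
  rewrite mulrA -rmorphM mulrCA mulfVK// mulr_sumr; apply: eq_bigr => j _.
  by rewrite TE.
by under eq_fun do rewrite E.
Qed.

Let A f r := circ_energy f r.
(** Dominating function for the partial sums [S N], integrable because [h], [g] and [k] are square
    integrable. *)
Let D r := M ^+ 2 * A h r + (1 * A g r + 2 * A k r).

Let bound_S N r : 0 < r < 1 -> nc (S N r) <= D r.
Proof.
move=> r01; case/andP: (r01) => r0 r1; have rn : r != 0 by rewrite gt_eqF.
have r01' : 0 <= r < 1 by rewrite (ltW r0).
have a0 := normc_ge0 (al r).
apply: (@le_trans _ _ (nc (al r) ^+ 2 * energy_psum (shift q c) N r +
   (1 * energy_psum d N r + 2 * energy_psum e N r))).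
  rewrite /S; apply: le_trans (ler_normc_sum _ _ _) _.
  rewrite /energy_psum !mulr_sumr -!big_split/=; apply: ler_sum => j _.
  rewrite TE//; move: (al r) a0 => L L0.
  rewrite !Normc.normcM !normcR normc_conj ger0_norm ?mulr_ge0 ?(ltW r0)//.
  rewrite ger0_norm ?exprn_ge0 ?(ltW r0)//.
  have H : nc (L * shift q c j - d j) <= nc L * nc (shift q c j) + nc (d j).
    by apply: le_trans (ler_normcB _ _) _; rewrite Normc.normcM.
  have rj : 0 <= r ^+ (2 * j) by rewrite exprn_ge0// ltW.
  have := normc_ge0 (d j); have := normc_ge0 (e j); have := normc_ge0 (shift q c j).
  move: H rj; move: (nc (L * _ - _)) (nc L) (nc (shift q c j)) (nc (d j)) (nc (e j)) (r ^+ (2 * j)) => X a s b y R2 H R20 s0 y0 b0.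
  have -> : a ^+ 2 * (2 * r * (s ^+ 2 * R2)) + (1 * (2 * r * (b ^+ 2 * R2)) + 2 * (2 * r * (y ^+ 2 * R2))) =
    2 * r * (((a * s) ^+ 2 + b ^+ 2 + 2 * y ^+ 2) * R2) by ring.
  apply: ler_wpM2l; first by rewrite mulr_ge0// ltW.
  apply: ler_wpM2r => //; apply: le_trans (ler_wpM2r y0 H) _; move: (a * s) => u.
  by have := sqr_ge0 (u - y); have := sqr_ge0 (b - y); have := sqr_ge0 u; have := sqr_ge0 b;
    have := sqr_ge0 y; nra.
rewrite /D; apply: lerD; last first.
  by apply: lerD; rewrite ler_wpM2l//; [exact: energy_psum_le gd _|exact: energy_psum_le ke _].
(* Although [al] may blow up at 0, the factor [r ^ (2 q)] in the energy of [z ^ q * h] compensates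
   the [r ^ (- 2 q)] in the square of its modulus. *)
have ep := energy_psum_le N (pseries_shift q hc) r01'.
apply: le_trans (ler_wpM2l (exprn_ge0 2 a0) ep) _.
rewrite (circ_energy_shift q hc r01') mulrA; apply: ler_wpM2r; first exact: (circ_energy_ge0 hc r01').
rewrite /al Normc.normcM normcR ger0_norm ?invr_ge0 ?exprn_ge0 ?(ltW r0)//.
rewrite mulnC exprM -exprMn mulfVK ?expf_neq0//.
by rewrite lerXn2r ?nnegrE ?normc_ge0// phiM.
Qed.

Let D_int : leb.-integrable `]0, 1[ (EFin \o D).
Proof.
have ih := (square_integrableP hc).1 h2.
have ig := (square_integrableP gd).1 g2.
have ik := (square_integrableP ke).1 k2.
have m01 : measurable (`[0, 1[ : set (measurableTypeR R)) by exact: measurable_itv.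
have i1 := @integrable_real_lin _ _ _ leb `[0, 1[ _ _ 1 2 m01 ig ik.
have i2 := @integrable_real_lin _ _ _ leb `[0, 1[ _ _ (M ^+ 2) 1 m01 ih i1.
have := @integrableS _ _ _ leb `[0, 1[ `]0, 1[ _ m01 (measurable_itv _) _ i2.
move=> H; have {}H := H (@subset_itvr _ _ _ _ _ _).
apply: eq_integrable (H _) => //; last by rewrite bnd_simp.
by move=> r _ /=; rewrite mul1r.
Qed.

Let sub01 : (`]0, 1[ : set R) `<=` `[0, 1[.
Proof. by apply: subset_itvr; rewrite bnd_simp. Qed.

Let m01 : measurable (`]0, 1[ : set R). Proof. exact: measurable_itv. Qed.

Lemma phi_pow_cintegrable n : cintegrable leb `]0, 1[ (fun r => phi r * (r ^+ n)%:C).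
Proof.
apply: (@le_cintegrable _ _ _ leb _ _ (fun=> M)) => //.
- apply: cmeasM; last by apply: cmeas_real; exact: exprn_measurable.
  by case: mphi => mr mi; split; [exact: measurable_funS mr|exact: measurable_funS mi].
- apply: (@integrableS _ _ _ leb `[0, 1] `]0, 1[) => //.
    by apply: subset_itvW; rewrite bnd_simp.
  apply: continuous_compact_integrable; first exact: segment_compact.
  by move=> x; exact: cvg_cst.
- move=> r; rewrite /= in_itv/= => /andP[r0 r1].
  rewrite Normc.normcM normcR ger0_norm ?exprn_ge0 ?(ltW r0)// -[leRHS]mulr1.
  by apply: ler_pM; rewrite ?normc_ge0 ?exprn_ge0 ?(ltW r0)// ?phiM ?(ltW r0)//; exact: exprn_ile1 (ltW r0) (ltW r1).
Qed.

Lemma moment_one n : cintegrable leb `]0, 1[ (fun r => (r ^+ n)%:C) /\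
  cintegral leb `]0, 1[ (fun r => (r ^+ n)%:C) = (n.+1%:R^-1)%:C.
Proof.
have cX : {within `[0, 1], continuous (fun r : R => r ^+ n)}.
  by apply: continuous_subspaceT => x; exact: exprn_continuous.
have iX : leb.-integrable `[0, 1] (EFin \o (fun r : R => r ^+ n)).
  by apply: continuous_compact_integrable; [exact: segment_compact|exact: cX].
have iX' : leb.-integrable `]0, 1[ (EFin \o (fun r : R => r ^+ n)).
  by apply: integrableS iX => //; apply: subset_itvW; rewrite bnd_simp.
split; first by split => //; exact: integrable0.
have : cint 0 1 (fun r => (r ^+ n)%:C) = (n.+1%:R^-1)%:C :> R[i].
  pose G r : R[i] := (n.+1%:R^-1 * r ^+ n.+1)%:C.
  transitivity (G 1 - G 0); last by rewrite /G expr1n expr0n mulr1 mulr0 subr0.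
  apply: cint_FTC => //.
  - by apply: ccont_Ri => //; apply: continuous_subspaceT => x; exact: cvg_cst.
  - move=> x /=; rewrite (_ : (fun y : R => n.+1%:R^-1 * y ^+ n.+1) = (n.+1%:R^-1 \*: (@id R ^+ n.+1))); last first.
      by apply/funext => y; rewrite exprfctE.
    apply: is_derive_eq; rewrite /GRing.scale/= mulr1 mulrA mulVf ?mul1r//.
  - by move=> x /=; exact: is_derive_cst.
move=> <-; apply: complex_eqP => /=; last by rewrite /Rintegral !integral0_eq.
rewrite Rintegral_itv_obnd_cbnd// Rintegral_itv_bndo_bndc//.
by apply: integrableS iX => //; apply: subset_itvl; rewrite bnd_simp.
Qed.

(** Parseval on each circle, then dominated convergence in [r]. The symbol contributes moments of
    [phi], and [g] contributes the integrals of [r ^ (2 j + 1)], equal to [1 / (2 j + 2)]. *)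
Lemma inner_cvg : (fun N => nc (inner (fun z => quasihomogeneous q phi z * h z - g z) k -
   \sum_(j < N) (2 * shift q c j * moment phi (2 * j + 1 - q) - d j / (j.+1)%:R) * cj (e j))) @ \oo --> 0.
Proof.
have iT j : cintegrable leb `]0, 1[ (T j).
  apply: cintegrableD => //; apply: cintegrableZ => //; first exact: phi_pow_cintegrable.
  by have [] := moment_one (2 * j + 1).
have iS N : cintegrable leb `]0, 1[ (S N) /\ cintegral leb `]0, 1[ (S N) =
    \sum_(j < N) (2 * shift q c j * moment phi (2 * j + 1 - q) - d j / (j.+1)%:R) * cj (e j).
  have [H1 H2] := @cintegrable_sum _ _ _ leb `]0, 1[ _ (index_enum 'I_N) (fun j : 'I_N => T j) m01 (fun j => iT j).
  split => //; rewrite [LHS]H2; apply: eq_bigr => j _.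
  rewrite cintegralD//; last 2 first.
  - by apply: cintegrableZ => //; exact: phi_pow_cintegrable.
  - by apply: cintegrableZ => //; have [] := moment_one (2 * j + 1).
  rewrite !cintegralZ//; last 2 first.
  - by have [] := moment_one (2 * j + 1).
  - exact: phi_pow_cintegrable.
  have [_ ->] := moment_one (2 * j + 1).
  have E2 : (2 * j).+2%:R = 2 * j.+1%:R :> R[i].
    by rewrite -addn2 natrD natrM -natr1; ring.
  rewrite -/(moment _ _) addn1 fmorphV rmorph_nat E2.
  have jn : j.+1%:R != 0 :> R[i] by rewrite pnatr_eq0.
  move: (j.+1%:R) jn (moment _ _) => jj jn m.
  by field.
rewrite inner_I.
have conv : forall r, ([set` `]0, 1[] : set R) r -> (fun N => nc (I r - S N r)) @ \oo --> 0.
  by move=> r; rewrite /= in_itv/= => r01; exact: circle_I.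
have bnd N r : ([set` `]0, 1[] : set R) r -> nc (S N r) <= D r.
  by rewrite /= in_itv/= => r01; exact: bound_S.
have E N : \sum_(j < N) (2 * shift q c j * moment phi (2 * j + 1 - q) - d j / (j.+1)%:R) * cj (e j) =
   cintegral leb `]0, 1[ (S N) by have [] := iS N.
under eq_fun do rewrite E.
apply: ReIm_cvg_normc.
  apply: (@dominated_Rintegral _ _ _ leb `]0, 1[ (fun N r => complex.Re (S N r)) (fun r => complex.Re (I r)) D m01) => //.
  - by move=> N; have [[/integrableP[/measurable_EFinP ? _] _] _] := iS N.
  - by move=> N r /(bnd N); apply: le_trans; exact: ger_normc_Re.
  - by move=> r /conv/normc_cvg_ReIm[].
apply: (@dominated_Rintegral _ _ _ leb `]0, 1[ (fun N r => complex.Im (S N r)) (fun r => complex.Im (I r)) D m01) => //.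
- by move=> N; have [[_ /integrableP[/measurable_EFinP ? _]] _] := iS N.
- by move=> N r /(bnd N); apply: le_trans; exact: ger_normc_Im.
- by move=> r /conv/normc_cvg_ReIm[].
Qed.

End Inner.

(** * The projection computed on coefficients *)

Section ToeplitzCoefficients.
Variable R : realType.
Local Notation nc := (@Normc.normc R).
Local Notation cj := (@conjc R).
Local Notation leb := (@lebesgue_measure R).
Implicit Types (h g : R[i] -> R[i]) (c d : nat -> R[i]) (r : R).

Lemma bounded_radialP (phi : R -> R[i]) : bounded_radial phi ->
  cmeas (`[0, 1[ : set R) phi /\ exists M, forall r, 0 <= r < 1 -> nc (phi r) <= M.
Proof. by case=> mr mi [M hM]; split=> //; exists M. Qed.

Lemma moment_bound (phi : R -> R[i]) M n : cmeas (`[0, 1[ : set R) phi ->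
  (forall r, 0 <= r < 1 -> nc (phi r) <= M) -> nc (moment phi n) <= 2 * M / n.+1%:R.
Proof.
move=> mphi hM; have m01 : measurable (`]0, 1[ : set R) by exact: measurable_itv.
have [iR iI] := phi_pow_cintegrable mphi hM n.
have [[iX _] EX] := @moment_one R n.
have key (v : R -> R) : leb.-integrable `]0, 1[ (EFin \o v) ->
    (forall r, 0 < r < 1 -> `|v r| <= M * r ^+ n) -> `|Rintegral leb `]0, 1[ v| <= M / n.+1%:R.
  move=> iv vM; apply: le_trans (@le_normr_Rintegral _ _ _ leb `]0, 1[ v m01 iv) _.
  have -> : M / n.+1%:R = Rintegral leb `]0, 1[ (fun r => M * r ^+ n).
    by rewrite RintegralZl//; congr (_ * _); have := congr1 (@complex.Re R) EX.
  apply: le_Rintegral => //.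
  - exact: integrable_norm iv.
  - by have := @integrableZl _ _ _ leb `]0, 1[ m01 M _ iX; apply: eq_integrable.
have nb r : 0 < r < 1 -> nc (phi r * (r ^+ n)%:C) <= M * r ^+ n.
  move=> /andP[r0 r1]; rewrite Normc.normcM normcR ger0_norm ?exprn_ge0 ?(ltW r0)//.
  by apply: ler_wpM2r; [exact: exprn_ge0 (ltW r0)|apply: hM; rewrite (ltW r0)].
apply: le_trans (ler_normc_ReIm _) _.
have -> : 2 * M / n.+1%:R = M / n.+1%:R + M / n.+1%:R by ring.
apply: lerD; apply: key => // r r01; apply: le_trans (nb r r01).
  exact: ger_normc_Re.
exact: ger_normc_Im.
Qed.

Lemma energy_square_integrable f g c d (C : R) : has_pseries f c -> has_pseries g d -> 0 <= C ->
  (forall r, 0 <= r < 1 -> forall N, energy_psum c N r <= C * circ_energy g r) ->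
  square_integrable g -> square_integrable f.
Proof.
move=> fc gd C0 H /(square_integrableP gd) ig; apply/(square_integrableP fc).
have m01 : measurable (`[0, 1[ : set R) by exact: measurable_itv.
have iCg : leb.-integrable `[0, 1[ (EFin \o (fun r => C * circ_energy g r)).
  by have := @integrableZl _ _ _ leb `[0, 1[ m01 C _ ig; apply: eq_integrable.
apply: (@le_integrable _ _ _ leb _ m01 _ _ _ _ iCg).
  by apply/measurable_EFinP; exact: measurable_circ_energy fc.
move=> r; rewrite /= in_itv/= => r01; rewrite lee_fin ger0_norm ?(circ_energy_ge0 fc)//.
rewrite /= (ger0_norm (mulr_ge0 C0 (circ_energy_ge0 gd r01))).
have cv := energy_psum_cvg fc r01; rewrite -(cvg_lim _ cv)//; apply: limr_le.
  by apply/cvg_ex; eexists; exact: cv.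
by apply: nearW => N; exact: H.
Qed.

Lemma bergman_monomial k : bergman (fun z : R[i] => z ^+ k).
Proof.
have hk := @pseries_monomial R k; split; first exact: pseries_analytic hk.
apply/(square_integrableP hk).
have m01 : measurable (`[0, 1[ : set R) by exact: measurable_itv.
have i2 : leb.-integrable `[0, 1[ (EFin \o (fun=> 2 : R)).
  apply: (@integrableS _ _ _ leb `[0, 1] `[0, 1[) => //.
    by apply: subset_itvl; rewrite bnd_simp.
  apply: continuous_compact_integrable; first exact: segment_compact.
  by move=> x; exact: cvg_cst.
apply: (@le_integrable _ _ _ leb _ m01 _ _ _ _ i2).
  by apply/measurable_EFinP; exact: measurable_circ_energy hk.
move=> r; rewrite /= in_itv/= => r01; rewrite lee_fin ger0_norm ?(circ_energy_ge0 hk)//.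
rewrite ger0_norm//; have cv := energy_psum_cvg hk r01; rewrite -(cvg_lim _ cv)//; apply: limr_le.
  by apply/cvg_ex; eexists; exact: cv.
apply: nearW => N; case/andP: r01 => r0 /ltW r1.
have D0 (j : nat) : j != k -> 2 * r * (nc ((j == k)%:R : R[i]) ^+ 2 * r ^+ (2 * j)) = 0.
  by move=> /negbTE ->; rewrite Normc.normc0 expr0n mul0r mulr0.
have [kN|Nk] := ltnP k N; last first.
  rewrite /energy_psum big1// => j _; apply: D0.
  by rewrite neq_ltn (leq_trans (ltn_ord j) Nk).
rewrite /energy_psum (bigD1 (Ordinal kN))//= big1 ?addr0; last first.
  by move=> j jk; apply: D0; apply: contra jk => /eqP E; apply/eqP/val_inj.
rewrite eqxx Normc.normc1 expr1n mul1r -[leRHS]mulr1 -mulrA.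
apply: ler_wpM2l => //; rewrite -exprS; exact: exprn_ile1.
Qed.

Lemma cvg_eventually_eq (u : nat -> R[i]) (x y : R[i]) N0 :
  (fun N => nc (x - u N)) @ \oo --> 0 -> (forall N, (N0 <= N)%N -> u N = y) -> x = y.
Proof.
move=> cu uy; apply: (normc_cvg0_unique cu).
apply: cvg_near_cst; exists N0 => // N /= NN0.
by rewrite uy// subrr Normc.normc0.
Qed.

Definition toeplitz_coef q (phi : R -> R[i]) c j : R[i] :=
  2 * j.+1%:R * shift q c j * moment phi (2 * j + 1 - q).

(** The projection is exhibited by its coefficients, chosen so that every term of [inner_cvg] is
    zero. Testing against monomials shows that any other projection has the same coefficients, so
    the choice made by [xget] does not matter. *)
Lemma toeplitz_pseries (phi : R -> R[i]) q h c : bounded_radial phi -> bergman h ->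
  has_pseries h c -> bergman (toeplitz (quasihomogeneous q phi) h) /\
  has_pseries (toeplitz (quasihomogeneous q phi) h) (toeplitz_coef q phi c).
Proof.
move=> /bounded_radialP[mphi [M hM]] [ah h2] hc.
set d := toeplitz_coef q phi c.
have jn j : j.+1%:R != 0 :> R[i] by rewrite pnatr_eq0.
have M0 : 0 <= M by apply: le_trans (hM 0 _); rewrite ?normc_ge0// lexx ltr01.
have nnat n : nc n%:R = n%:R :> R.
  by rewrite -[n%:R](rmorph_nat (real_complex R)) normcR ger0_norm.
(* The moment is at most [2 M / (2 j + 2 - q)], and [q <= j] makes that denominator at least
   [j + 1]. This inequality makes the candidate both tame and square integrable. *)
have dle j : nc (d j) <= 4 * M * nc (shift q c j).
  rewrite /d /toeplitz_coef /shift; case: ltnP => [_|qj]; first by rewrite mulr0 mul0r Normc.normc0 mulr0.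
  rewrite !Normc.normcM !nnat.
  have := moment_bound (2 * j + 1 - q) mphi hM; rewrite ler_pdivlMr// => mb.
  have jj : j.+1%:R <= (2 * j + 1 - q).+1%:R :> R by rewrite ler_nat; lia.
  have m0 := normc_ge0 (moment phi (2 * j + 1 - q)).
  rewrite mulrAC; apply: ler_wpM2r; first exact: normc_ge0.
  have : nc (moment phi (2 * j + 1 - q)) * j.+1%:R <= 2 * M.
    by apply: le_trans mb; apply: ler_wpM2l.
  lra.
have td : tame d.
  move=> r r01; have [M' hM'] := tame_shift q hc.1 r01; exists (4 * M * M') => j.
  case/andP: (r01) => /ltW r0 _; apply: le_trans (ler_wpM2r (exprn_ge0 j r0) (dle j)) _.
  by rewrite -[leLHS]mulrA; apply: ler_wpM2l (hM' j); rewrite mulr_ge0.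
have [g0 g0d] := pseries_exists td.
have g02 : square_integrable g0.
  apply: (energy_square_integrable (C := (4 * M) ^+ 2) g0d hc) => //; first exact: exprn_ge0 (mulr_ge0 _ _).
  move=> r r01 N; have r0 : 0 <= r by case/andP: r01.
  have H1 : energy_psum d N r <= (4 * M) ^+ 2 * energy_psum (shift q c) N r.
    rewrite /energy_psum mulr_sumr; apply: ler_sum => j _.
    have -> : (4 * M) ^+ 2 * (2 * r * (nc (shift q c j) ^+ 2 * r ^+ (2 * j))) =
      2 * r * ((4 * M * nc (shift q c j)) ^+ 2 * r ^+ (2 * j)) by ring.
    apply: ler_wpM2l; first by rewrite mulr_ge0.
    apply: ler_wpM2r; first exact: exprn_ge0.
    by apply: lerXn2r; rewrite ?nnegrE ?mulr_ge0 ?normc_ge0.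
  apply: le_trans H1 _; apply: ler_wpM2l; first by rewrite exprn_ge0// mulr_ge0.
  apply: le_trans (energy_psum_le N (pseries_shift q hc) r01) _.
  rewrite (circ_energy_shift q hc r01) -[leRHS]mul1r; apply: ler_wpM2r.
    exact: (circ_energy_ge0 hc r01).
  by apply: exprn_ile1 => //; case/andP: r01 => _ /ltW.
have b0 : bergman g0 by split; [exact: pseries_analytic g0d|exact: g02].
have proj0 : is_bergman_proj (fun z => quasihomogeneous q phi z * h z) g0.
  split; first exact: b0.
  move=> k [ak k2]; have [e ke] := analytic_pseries ak.
  have := inner_cvg q mphi hM hc g0d ke h2 g02 k2.
  move/(@cvg_eventually_eq _ _ 0 0%N); apply => N _; apply: big1 => j _.
  by rewrite /d /toeplitz_coef; move: (moment _ _) (shift _ _ _) => x y; field.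
have : is_bergman_proj (fun z => quasihomogeneous q phi z * h z) (toeplitz (quasihomogeneous q phi) h).
  by rewrite /toeplitz /bergman_proj; exact: (xgetPex _ (ex_intro _ g0 proj0)).
move: (toeplitz _ _) => g [bg og]; split; first exact: bg.
have [d' gd'] := analytic_pseries bg.1.
suff -> : d = d' by [].
apply/funext => j.
(* Against [z ^ j] the sum in [inner_cvg] is constant once [N > j], and equal to its single term of
   index [j]. *)
have bk := bergman_monomial j.
have := inner_cvg q mphi hM hc gd' (@pseries_monomial R j) h2 bg.2 bk.2.
rewrite (og _ bk); move/(@cvg_eventually_eq _ _ ((2 * shift q c j * moment phi (2 * j + 1 - q) - d' j / (j.+1)%:R)) j.+1).
move=> H; have {H} : 0 = 2 * shift q c j * moment phi (2 * j + 1 - q) - d' j / (j.+1)%:R.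
  apply: H => N jN; rewrite (bigD1 (Ordinal jN))//= eqxx big1 ?addr0.
    by rewrite conjc1 mulr1.
  move=> i ij; rewrite (_ : (_ == _) = false) ?conjc0 ?mulr0//.
  by apply/negbTE; apply: contra ij => /eqP E; apply/eqP/val_inj.
move/esym/eqP; rewrite subr_eq0 => /eqP E.
rewrite /d /toeplitz_coef; have -> : d' j = d' j / j.+1%:R * j.+1%:R by rewrite mulfVK.
by rewrite -E; ring.
Qed.

End ToeplitzCoefficients.

(** * Moments of radial profiles *)

Section HardyOperator.
Variable R : realType.
Local Notation leb := (@lebesgue_measure R).
Implicit Types (f g : R -> R) (r a : R).

(** Nothing is required at 0, where the profiles may oscillate: moments of positive order are
    insensitive to it. Continuity up to 1 makes the fundamental theorem of calculus applicable on
    [[0, 1]]. *)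
Definition bdcont (B : R) f := [/\ {in `]0, 1[, continuous f},
  f x @[x --> 1^'-] --> f 1 & forall r, 0 < r <= 1 -> `|f r| <= B].

Lemma bdcont_within B f c : bdcont B f -> 0 < c -> c < 1 -> {within `[c, 1], continuous f}.
Proof.
move=> [cf f1 _] c0 c1; apply/continuous_within_itvP => //; split => //.
- by move=> x; rewrite in_itv/= => /andP[cx x1]; apply: cf; rewrite in_itv/= (lt_trans c0 cx).
- by apply: cvg_at_right_filter; apply: cf; rewrite in_itv/= c0.
Qed.

Lemma bdcont_B0 B f : bdcont B f -> 0 <= B.
Proof. by case=> _ _ /(_ 1); rewrite ltr01 lexx => /(_ isT); apply: le_trans. Qed.

Lemma cvg_bounded_mul0 (F : set_system R) (FF : Filter F) f (u : R -> R) (B : R) :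
  (\forall x \near F, `|f x| <= B) -> u x @[x --> F] --> 0 -> f x * u x @[x --> F] --> 0.
Proof.
move=> fB u0; apply/cvgr0Pnorm_le => e e0.
have B1 : 0 < `|B| + 1 by rewrite ltr_wpDl.
have : \forall x \near F, `|u x| <= e / (`|B| + 1).
  by move/cvgr0Pnorm_le : u0; apply; rewrite divr_gt0.
apply: filterS2 fB => x fx ux; rewrite normrM.
apply: le_trans (ler_pM (normr_ge0 _) (normr_ge0 _) fx ux) _.
rewrite mulrA ler_pdivrMr// mulrC ler_wpM2l ?(ltW e0)//.
by rewrite (le_trans (ler_norm B))// lerDl.
Qed.

Lemma bdcont_moment_within B f n : bdcont B f -> (0 < n)%N ->
  {within `[0, 1], continuous (fun r => f r * r ^+ n)}.
Proof.
move=> [cf f1 fB] n0; apply/continuous_within_itvP => //; split => //.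
- by move=> x x01; apply: cvgM; [exact: cf|exact: exprn_continuous].
- rewrite expr0n gtn_eqF// mulr0; apply: cvg_bounded_mul0.
    near=> x; apply: (fB x); apply/andP; split; near: x.
      exact: nbhs_right_gt.
    by apply: nbhs_right_le.
  rewrite -[X in _ --> X](_ : (0 : R) ^+ n = 0); last by rewrite expr0n gtn_eqF.
  by apply: cvg_at_right_filter; exact: exprn_continuous.
- by apply: cvgM => //; apply: cvg_at_left_filter; exact: exprn_continuous.
Unshelve. all: by end_near.
Qed.

Definition moment01 f n := Rintegral leb `[0, 1] (fun r => f r * r ^+ n).

(* The Hardy operator: it multiplies the Mellin transform at [z] by
   [(z + a)^-1]. *)
Definition hardy a f r := r `^ a * Rintegral leb `[r, 1] (fun s => f s * s `^ (- a - 1)).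

Lemma powR_continuous_within (b c : R) : 0 < c -> c < 1 ->
  {within `[c, 1], continuous (fun s : R => s `^ b)}.
Proof.
move=> c0 c1; apply: derivable_within_continuous => x; rewrite in_itv/= => /andP[cx _].
by apply: derivable_powR; rewrite in_itv/= andbT (lt_le_trans c0 cx).
Qed.

Lemma powR_continuous_at (b x : R) : 0 < x -> {for x, continuous (fun s : R => s `^ b)}.
Proof.
move=> x0; apply: differentiable_continuous; apply/derivable1_diffP.
by apply: derivable_powR; rewrite in_itv/= andbT.
Qed.

Section Fixed.
Variables (B : R) (f : R -> R) (a : R).
Hypothesis fB : bdcont B f.
Hypothesis a0 : 0 < a.

Let G s := f s * s `^ (- a - 1).
Let F r := Rintegral leb `[r, 1] G.

Let G_within c : 0 < c -> c < 1 -> {within `[c, 1], continuous G}.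
Proof.
move=> c0 c1 x; apply: (@cvgM R); first exact: (bdcont_within fB c0 c1).
exact: powR_continuous_within.
Qed.

Let G_int c : 0 < c -> c < 1 -> leb.-integrable `[c, 1] (EFin \o G).
Proof.
by move=> c0 c1; apply: continuous_compact_integrable; [exact: segment_compact|exact: G_within].
Qed.

(** Moves the variable from the lower to the upper limit, where derivatives and limits of integrals
    are available; [c > 0] avoids the singularity of [G] at 0. *)
Let F_split c x : 0 < c -> c < 1 -> c <= x <= 1 ->
  F x = Rintegral leb `[c, 1] G - Rintegral leb `[c, x] G.
Proof.
move=> c0 c1 /andP[cx x1]; rewrite (@Rintegral_itvB R G (BLeft c) (BRight 1) x) ?bnd_simp//; last exact: G_int.
rewrite /F; apply/esym/Rintegral_itv_obnd_cbnd.
by apply: integrableS (G_int c0 c1) => //; apply: subset_itvr; rewrite bnd_simp.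
Qed.

Let F_deriv r : 0 < r < 1 -> is_derive r (1:R) F (- G r).
Proof.
move=> /andP[r0 r1]; pose c := r / 2; have c0 : 0 < c by rewrite /c; lra.
have cr : c < r by rewrite /c; lra.
have c1 : c < 1 by lra.
have cG : {for r, continuous G}.
  case: fB => cf _ _; apply: cvgM; first by apply: cf; rewrite in_itv/= r0.
  exact: powR_continuous_at.
have [dI EI] := continuous_FTC1_closed r1 (G_int c0 c1) cr cG.
have dI2 : is_derive r (1:R) (fun x => Rintegral leb `[c, x] G) (G r).
  by apply: DeriveDef => //; rewrite -derive1E EI.
have H := is_deriveB (is_derive_cst (Rintegral leb `[c, 1] G) r (1:R)) dI2.
rewrite sub0r in H.
apply: near_eq_is_derive H; near=> x; rewrite (@F_split c)//; last first.
have : x \in `]c, 1[ by near: x; apply: near_in_itvoo; rewrite in_itv/= cr.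
by rewrite in_itv/= => /andP[/ltW -> /ltW ->].
Unshelve. all: by end_near.
Qed.

Let F_cvg1 : F x @[x --> 1^'-] --> 0.
Proof.
pose c := 1 / 2 : R; have c0 : 0 < c by rewrite /c; lra.
have c1 : c < 1 by rewrite /c; lra.
have H := parameterized_integral_cvg_at_left c1 (G_int c0 c1).
have H2 : (Rintegral leb `[c, 1] G - Rintegral leb `[c, x] G) @[x --> 1^'-] -->
    Rintegral leb `[c, 1] G - Rintegral leb `[c, 1] G.
  by apply: cvgB; [exact: cvg_cst|exact: H].
rewrite subrr in H2; apply: cvg_trans H2; apply: near_eq_cvg; near=> x.
rewrite (@F_split c)//; apply/andP; split; near: x; last exact: nbhs_left_le.
by apply: nbhs_left_ge.
Unshelve. all: by end_near.
Qed.

(** The norm bound [1 / a] comes from integrating [s ^ (- a - 1)] over [[r, 1]] and multiplying by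
    [r ^ a], which leaves [(1 - r ^ a) / a]. *)
Lemma hardy_bdcont : bdcont (B / a) (hardy a f).
Proof.
have hd r : 0 < r < 1 -> {for r, continuous (hardy a f)}.
  move=> r01; case/andP: (r01) => r0 r1; apply: cvgM; first exact: powR_continuous_at.
  by apply: differentiable_continuous; apply/derivable1_diffP; have [] := F_deriv r01.
split.
- by move=> r; rewrite in_itv/= => r01; exact: hd.
- rewrite {2}/hardy set_itv1 Rintegral_set1 mulr0.
  rewrite -[X in _ --> X](mulr0 (1 `^ a)); apply: cvgM; last exact: F_cvg1.
  by apply: cvg_at_left_filter; exact: powR_continuous_at.
move=> r /andP[r0 r1]; rewrite /hardy normrM ger0_norm ?powR_ge0//.
have B0 := bdcont_B0 fB.
have [->|rn1] := eqVneq r 1; first by rewrite set_itv1 Rintegral_set1 normr0 mulr0 divr_ge0// ltW.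
have {rn1}r1 : r < 1 by rewrite lt_neqAle rn1.
have iG := G_int r0 r1.
apply: (@le_trans _ _ (r `^ a * (B / a * (r `^ (- a) - 1)))); last first.
  rewrite mulrCA mulrBr mulr1 -powRD ?subrr ?powRr0; last by rewrite (gt_eqF r0) implybT.
  rewrite -[leRHS]mulr1 ler_wpM2l ?divr_ge0 ?(ltW a0)//.
  by rewrite lerBlDr lerDl powR_ge0.
apply: ler_wpM2l; first exact: powR_ge0.
apply: le_trans (le_normr_Rintegral _ iG) _ => //.
have cP : {within `[r, 1], continuous (fun s : R => B * s `^ (- a - 1))}.
  by move=> x; apply: (@cvgM R); [exact: cvg_cst|exact: powR_continuous_within].
have <- : Rintegral leb `[r, 1] (fun s => B * s `^ (- a - 1)) = B / a * (r `^ (- a) - 1).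
  have dP x : r <= x -> is_derive x (1:R) (fun s : R => - (B / a) * s `^ (- a)) (B * x `^ (- a - 1)).
    move=> rx; have xp : 0 < x by exact: lt_le_trans rx.
    have H := is_derive1_powR (- a) xp.
    have K := is_deriveZ (- (B / a)) H.
    by apply: (is_derive_eq K); rewrite /GRing.scale/= mulrA mulrNN divfK ?gt_eqF.
  rewrite /Rintegral (@continuous_FTC2 R _ (fun s : R => - (B / a) * s `^ (- a)))//.
  - by rewrite -EFinB/= powR1; ring.
  - split.
    + by move=> x; rewrite in_itv/= => /andP[/ltW rx _]; have [] := dP x rx.
    + by apply: cvgM; [exact: cvg_cst|apply: cvg_at_right_filter; exact: powR_continuous_at].
    + by apply: cvgM; [exact: cvg_cst|apply: cvg_at_left_filter; exact: powR_continuous_at].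
  - by move=> x; rewrite in_itv/= => /andP[/ltW rx _]; rewrite derive1E; have [_ ->] := dP x rx.
apply: le_Rintegral => //.
- exact: integrable_norm iG.
- by apply: continuous_compact_integrable; [exact: segment_compact|exact: cP].
- move=> x; rewrite /= in_itv/= => /andP[rx x1]; rewrite normrM (ger0_norm (powR_ge0 _ _)).
  by apply: ler_wpM2r; [exact: powR_ge0|case: fB => _ _; apply; rewrite (lt_le_trans r0 rx)].
Qed.

(** The derivative of [W] is the difference of the two integrands. [W] vanishes at 1, where the
    inner integral is empty, and at 0, because [hardy a f] is bounded. *)
Lemma hardy_moment n : (0 < n)%N -> (n.+1%:R + a) * moment01 (hardy a f) n = moment01 f n.
Proof.
move=> n0; have n1 : (0 < n.+1)%N by [].
have cH := bdcont_moment_within hardy_bdcont n0.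
have cf := bdcont_moment_within fB n0.
have cH1 := bdcont_moment_within hardy_bdcont n1.
pose W r := hardy a f r * r ^+ n.+1.
have dW r : 0 < r < 1 -> is_derive r (1:R) W ((n.+1%:R + a) * (hardy a f r * r ^+ n) - f r * r ^+ n).
  move=> r01; case/andP: (r01) => r0 r1.
  have H1 := is_derive1_powR a r0.
  have H2 := F_deriv r01.
  have H3 : is_derive r (1:R) (fun x : R => x ^+ n.+1) (n.+1%:R * r ^+ n).
    rewrite (_ : (fun y : R => y ^+ n.+1) = (@id R ^+ n.+1)); last by apply/funext => y; rewrite exprfctE.
    by apply: is_derive_eq; rewrite /GRing.scale/= mulr1.
  have K := is_deriveM (is_deriveM H1 H2) H3; apply: (is_derive_eq K).
  rewrite /GRing.scale/= /hardy -/(F r) /G.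
  have -> : r `^ (- a - 1) = (r `^ a)^-1 * r^-1.
    by rewrite powRB ?powRN ?powRr1 ?(ltW r0)//; rewrite (gt_eqF r0) implybT.
  have -> : r `^ (a - 1) = r `^ a * r^-1.
    by rewrite powRB ?powRr1 ?(ltW r0)//; rewrite (gt_eqF r0) implybT.
  have rn : r != 0 by rewrite gt_eqF.
  have ran : r `^ a != 0 by rewrite gt_eqF ?powR_gt0.
  rewrite exprS -[(_ * F) r]/(r `^ a * F r); field.
  by rewrite rn ran.
have E : Rintegral leb `[0, 1] (fun r => (n.+1%:R + a) * (hardy a f r * r ^+ n) - f r * r ^+ n) = 0.
  have /(continuous_within_itvP _ ltr01)[_ W0 W1] := cH1.
  rewrite /Rintegral (@continuous_FTC2 R _ W)//.
  - by rewrite /W /hardy set_itv1 Rintegral_set1 expr0n !mulr0 mul0r -EFinB subrr.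
  - by move=> x; apply: (@cvgB R); [apply: (@cvgM R); [exact: cvg_cst|exact: cH]|exact: cf].
  - split => //.
    by move=> x; rewrite in_itv/= => x01; have [] := dW x x01.
  - by move=> x; rewrite in_itv/= => x01; rewrite derive1E; have [_ ->] := dW x x01.
have iH : leb.-integrable `[0, 1] (EFin \o (fun r => hardy a f r * r ^+ n)).
  by apply: continuous_compact_integrable; [exact: segment_compact|exact: cH].
have if_ : leb.-integrable `[0, 1] (EFin \o (fun r => f r * r ^+ n)).
  by apply: continuous_compact_integrable; [exact: segment_compact|exact: cf].
move: E; rewrite RintegralB// ?RintegralZl//; first by move/eqP; rewrite subr_eq0 => /eqP.
have m01 : measurable (`[0, 1] : set R) by exact: measurable_itv.
by have := @integrableZl _ _ _ leb `[0, 1] m01 (n.+1%:R + a) _ iH; apply: eq_integrable.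
Qed.

End Fixed.
End HardyOperator.

(** * Inserting one balanced pair of factors *)

Section PairStep.
Variable R : realType.
Local Notation leb := (@lebesgue_measure R).
Implicit Types (f g : R -> R) (r : R).

Lemma bdcontD B B' f g k : bdcont B f -> bdcont B' g -> bdcont (B + `|k| * B') (fun r => f r + k * g r).
Proof.
move=> [cf f1 fB] [cg g1 gB]; split.
- move=> x x01; apply: (@cvgD _ R); first exact: cf.
  by apply: (@cvgM R); [exact: cvg_cst|exact: cg].
- apply: (@cvgD _ R) => //; apply: (@cvgM R) => //; exact: cvg_cst.
- move=> x x01; apply: le_trans (ler_normD _ _) _; rewrite normrM.
  by apply: lerD; [exact: fB|apply: ler_wpM2l => //; exact: gB].
Qed.

Lemma bdcont_moment_int B f n : bdcont B f -> (0 < n)%N ->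
  leb.-integrable `[0, 1] (EFin \o (fun r => f r * r ^+ n)).
Proof.
move=> fB n0; apply: continuous_compact_integrable; first exact: segment_compact.
exact: bdcont_moment_within fB n0.
Qed.

Lemma moment01D B B' f g k n : bdcont B f -> bdcont B' g -> (0 < n)%N ->
  moment01 (fun r => f r + k * g r) n = moment01 f n + k * moment01 g n.
Proof.
move=> fB gB n0; rewrite /moment01.
have m01 : measurable (`[0, 1] : set R) by exact: measurable_itv.
have i1 := bdcont_moment_int fB n0.
have i2 := bdcont_moment_int gB n0.
have i3 : leb.-integrable `[0, 1] (EFin \o (fun r => k * (g r * r ^+ n))).
  by have := @integrableZl _ _ _ leb `[0, 1] m01 k _ i2; apply: eq_integrable.
rewrite -RintegralZl// -RintegralD//; apply: eq_Rintegral => r _.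
by rewrite mulrDl mulrA.
Qed.

Lemma moment01_close B B' f g n (t : R) : bdcont B f -> bdcont B' g -> (0 < n)%N ->
  (forall r, 0 < r <= 1 -> `|f r - g r| <= t) -> `|moment01 f n - moment01 g n| <= t.
Proof.
move=> fB gB n0 fg.
have m01 : measurable (`[0, 1] : set R) by exact: measurable_itv.
have t0 : 0 <= t by apply: le_trans (fg 1 _); rewrite ?ltr01 ?lexx.
have i1 := bdcont_moment_int fB n0.
have i2 := bdcont_moment_int gB n0.
rewrite /moment01 -RintegralB//.
have i3 : leb.-integrable `[0, 1] (EFin \o (fun r => f r * r ^+ n - g r * r ^+ n)).
  by have := @integrableB _ _ _ leb `[0, 1] m01 _ _ i1 i2; apply: eq_integrable.
apply: le_trans (@le_normr_Rintegral _ _ _ leb `[0, 1] _ m01 i3) _.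
have -> : t = Rintegral leb `[0, 1] (fun=> t).
  rewrite Rintegral_cst//; have /= -> := @lebesgue_measure_itv R `[0, 1].
  by rewrite lte_fin ltr01/= subr0 mulr1.
apply: le_Rintegral => //.
- exact: integrable_norm i3.
- apply: continuous_compact_integrable; first exact: segment_compact.
  by move=> x; exact: cvg_cst.
move=> r; rewrite /= in_itv/= => /andP[r0 r1].
rewrite -mulrBl normrM (ger0_norm (exprn_ge0 _ r0)).
move: r0; rewrite le_eqVlt => /orP[/eqP <-|r0]; first by rewrite expr0n gtn_eqF// mulr0.
rewrite -[leRHS]mulr1; apply: ler_pM => //; first by rewrite exprn_ge0// ltW.
  by apply: fg; rewrite r0.
by apply: exprn_ile1 => //; exact: ltW.
Qed.

(** Three-epsilon argument, run once for an arbitrary filter so that it covers both interior points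
    and the left limit at 1. *)
Lemma bdcont_unif_limit B g (u : nat -> R -> R) (t : R^nat) : (forall N, bdcont B (u N)) ->
  (forall N r, 0 < r <= 1 -> `|g r - u N r| <= t N) -> t @ \oo --> 0 ->
  bdcont (B + t 0%N) g.
Proof.
move=> uB gt t0.
have key (F : set_system R) (FF : Filter F) (x : R) : 0 < x <= 1 ->
    (\forall y \near F, 0 < y <= 1) -> (forall N, u N y @[y --> F] --> u N x) ->
    g y @[y --> F] --> g x.
  move=> x01 Fy uc; apply/cvgrPdist_le => e e0.
  have [N hN] : exists N, t N <= e / 3.
    have e3 : 0 < e / 3 by rewrite divr_gt0.
    move/cvgrPdist_le : t0 => /(_ _ e3)[N _ /(_ N (leqnn N))].
    by rewrite sub0r normrN => H; exists N; apply: le_trans (ler_norm _) H.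
  have e3 : 0 < e / 3 by rewrite divr_gt0.
  have := uc N; move/cvgrPdist_le => /(_ _ e3).
  apply: filterS2 Fy => y y01 uxy.
  have -> : g x - g y = (g x - u N x) + (u N x - u N y) - (g y - u N y) by ring.
  apply: le_trans (ler_normB _ _) _; have H1 := ler_normD (g x - u N x) (u N x - u N y).
  by have := gt N x x01; have := gt N y y01; lra.
split.
- move=> x; rewrite in_itv/= => x01; apply: key.
  + by case/andP: x01 => -> /ltW.
  + have xi : x \in `]0, 1[ by rewrite in_itv.
    have := near_in_itvoo xi; apply: filterS => y; rewrite in_itv/= => /andP[-> /ltW ->//].
  + by move=> N; have [cu _ _] := uB N; apply: cu; rewrite in_itv.
- apply: key; first by rewrite ltr01 lexx.
  + near=> y; apply/andP; split; near: y; last exact: nbhs_left_le.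
    by apply: nbhs_left_gt.
  + by move=> N; have [_ cu _] := uB N.
- move=> x x01; have -> : g x = u 0%N x + (g x - u 0%N x) by ring.
  apply: le_trans (ler_normD _ _) _; apply: lerD; last exact: gt.
  by have [_ _] := uB 0%N; apply.
Unshelve. all: by end_near.
Qed.

Lemma inv_sqr_prod_bound (K : R) N : 0 <= K ->
  \prod_(j < N) (1 + K / (j.+1%:R) ^+ 2) <= expR (2 * K).
Proof.
move=> K0.
(* The sharper exponent makes the induction close: its increment [2 K / ((N + 1) (N + 2))] is at
   least [K / (N + 1) ^ 2]. *)
have H : \prod_(j < N) (1 + K / (j.+1%:R) ^+ 2) <= expR (2 * K - 2 * K / N.+1%:R).
  elim: N => [|N IH]; first by rewrite big_ord0 divr1 subrr expR0.
  rewrite big_ord_recr/=.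
  have e0 : 0 <= 1 + K / N.+1%:R ^+ 2 by rewrite addr_ge0// divr_ge0// exprn_ge0.
  apply: le_trans (ler_wpM2r e0 IH) _.
  have E1 : 1 + K / N.+1%:R ^+ 2 <= expR (K / N.+1%:R ^+ 2) by exact: expR_ge1Dx.
  apply: le_trans (ler_wpM2l (expR_ge0 _) E1) _.
  rewrite -expRD ler_expR -subr_ge0.
  have -> : 2 * K - 2 * K / N.+2%:R - (2 * K - 2 * K / N.+1%:R + K / N.+1%:R ^+ 2) =
     K * (N%:R / (N.+1%:R ^+ 2 * N.+2%:R)).
    rewrite -!natr1; field.
    by rewrite !natr1 !pnatr_eq0.
  by rewrite mulr_ge0// divr_ge0// mulr_ge0// exprn_ge0.
apply: le_trans H _; rewrite ler_expR gerBl.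
by rewrite divr_ge0// mulr_ge0.
Qed.

Lemma harmonic_tail_cvg0 (C : R) : (fun N : nat => C / N.+1%:R) @ \oo --> 0.
Proof.
rewrite -(mulr0 C); apply: cvgM; first exact: cvg_cst.
exact: cvg_harmonic.
Qed.

Variables (s : nat) (B : R) (f : R -> R) (a b de rho : R).
Hypothesis s0 : (0 < s)%N.
Hypothesis fB : bdcont B f.
Hypothesis a0 : 0 < a.
Hypothesis b0 : 0 < b.
Hypothesis balance : de + rho = a + b.
Hypothesis de_pos : forall n, (2 <= n)%N -> 0 < n.+1%:R + de.
Hypothesis rho_pos : forall n, (2 <= n)%N -> 0 < n.+1%:R + rho.

(** Because [de + rho = a + b], the difference [(z + de + x) (z + rho + x) - (z + a + x) (z + b +
    x)] equals [kap] for all [z] and [x]. *)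
Let kap := de * rho - a * b.
Let aj j := a + s%:R * j%:R.
Let bj j := b + s%:R * j%:R.

Fixpoint pair_iter N : R -> R := if N is N'.+1 then
  fun r => pair_iter N' r + kap * hardy (aj N') (hardy (bj N') (pair_iter N')) r else f.

Let shift_ge (x : R) j (m : R) : 0 < m -> m <= 1 -> m <= x -> m * j.+1%:R <= x + s%:R * j%:R.
Proof.
move=> m0 m1 mx; rewrite -natr1 mulrDr mulr1 addrC; apply: lerD => //.
apply: ler_wpM2r => //; apply: le_trans m1 _.
by rewrite ler1n.
Qed.

Let m := Num.min 1 (Num.min a b).
Let m0 : 0 < m. Proof. by rewrite /m !lt_min ltr01 a0 b0. Qed.
Let m1 : m <= 1. Proof. by rewrite /m ge_min lexx. Qed.
Let ma : m <= a. Proof. by rewrite /m !ge_min lexx orbT. Qed.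
Let mb : m <= b. Proof. by rewrite /m !ge_min lexx !orbT. Qed.
Let K := `|kap| / m ^+ 2.
Let K0 : 0 <= K. Proof. by rewrite divr_ge0// exprn_ge0// ltW. Qed.

Let aj_gt0 j : 0 < aj j. Proof. by rewrite /aj ltr_wpDr// mulr_ge0. Qed.
Let bj_gt0 j : 0 < bj j. Proof. by rewrite /bj ltr_wpDr// mulr_ge0. Qed.

(** Bounds the norm of the [j]-th perturbation [kap * H_a H_b]. It is summable, since both [aj j]
    and [bj j] are at least [m * (j + 1)]. *)
Let kap_le j : `|kap| / (aj j * bj j) <= K / j.+1%:R ^+ 2.
Proof.
rewrite /K -mulrA -invfM -exprMn; apply: ler_wpM2l => //.
have mj : 0 < m * j.+1%:R by rewrite mulr_gt0.
rewrite lef_pV2 ?posrE ?mulr_gt0 ?exprn_gt0//.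
by rewrite expr2; apply: ler_pM; rewrite ?(ltW mj)//; exact: shift_ge.
Qed.

Let C := B * expR (2 * K).

Let iter_bd N : bdcont (B * \prod_(j < N) (1 + K / j.+1%:R ^+ 2)) (pair_iter N) /\
  bdcont C (pair_iter N).
Proof.
have B0 := bdcont_B0 fB.
have W B1 B2 g : B1 <= B2 -> bdcont B1 g -> bdcont B2 g.
  by move=> B12 [cg g1 gB]; split => // r r01; exact: le_trans (gB r r01) B12.
suff H : bdcont (B * \prod_(j < N) (1 + K / j.+1%:R ^+ 2)) (pair_iter N).
  by split => //; apply: W H; apply: ler_wpM2l => //; exact: inv_sqr_prod_bound.
elim: N => [|N IH]; first by rewrite big_ord0 mulr1.
have H1 := hardy_bdcont IH (bj_gt0 N).
have H2 := hardy_bdcont H1 (aj_gt0 N).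
have H3 := bdcontD kap IH H2.
apply: W H3; rewrite big_ord_recr/= [leRHS]mulrA.
set P := B * _; have P0 : 0 <= P by exact: bdcont_B0 IH.
rewrite [leRHS]mulrDr mulr1; apply: lerD => //.
have -> : `|kap| * (P / bj N / aj N) = P * (`|kap| / (aj N * bj N)).
  by rewrite invfM; ring.
by apply: ler_wpM2l.
Qed.

Let C0 : 0 <= C. Proof. by rewrite mulr_ge0 ?expR_ge0//; exact: bdcont_B0 fB. Qed.

Let iter_step N r : 0 < r <= 1 -> `|pair_iter N.+1 r - pair_iter N r| <= C * (K / N.+1%:R ^+ 2).
Proof.
move=> r01; rewrite /= addrC addKr normrM.
have [_ H] := iter_bd N.
have [_ _ /(_ r r01) H2] := hardy_bdcont (hardy_bdcont H (bj_gt0 N)) (aj_gt0 N).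
apply: le_trans (ler_wpM2l (normr_ge0 _) H2) _.
have -> : `|kap| * (C / bj N / aj N) = C * (`|kap| / (aj N * bj N)).
  by rewrite invfM; ring.
by apply: ler_wpM2l.
Qed.

(** A bound for the tail of the steps [C * K / (N + 1) ^ 2], by the same telescoping comparison as
    in [inv_sqr_prod_bound]. *)
Let t N := 2 * K * C / N.+1%:R.

Let iter_limit : exists g, forall N r, 0 < r <= 1 -> `|g r - pair_iter N r| <= t N.
Proof.
have /choice[g hg] : forall r, exists l, forall N, 0 < r <= 1 -> `|l - pair_iter N r| <= t N.
  move=> r; have [r01|nr] := boolP (0 < r <= 1); last by exists 0.
  have tS N : C * (K / N.+1%:R ^+ 2) <= t N - t N.+1.
    rewrite -subr_ge0 /t.
    have -> : 2 * K * C / N.+1%:R - 2 * K * C / N.+2%:R - C * (K / N.+1%:R ^+ 2) =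
      C * (K * (N%:R / (N.+1%:R ^+ 2 * N.+2%:R))).
      rewrite -!natr1; field.
      by rewrite !natr1 !pnatr_eq0.
    rewrite mulr_ge0// mulr_ge0// divr_ge0// mulr_ge0// exprn_ge0//.
  have [l hl] : exists l, forall N, pair_iter N r - t N <= l <= (pair_iter N r - t N) + 2 * t N.
    apply: squeeze_intervals => N.
    - have := iter_step N r01; have := tS N; rewrite ler_norml.
      by move: (C * _) (t N) (t N.+1) (pair_iter N.+1 r) (pair_iter N r) => c x y z w h1 /andP[h2 h3]; lra.
    - have := iter_step N r01; have := tS N; rewrite ler_norml.
      by move: (C * _) (t N) (t N.+1) (pair_iter N.+1 r) (pair_iter N r) => c x y z w h1 /andP[h2 h3]; lra.
    - apply: mulr_ge0 => //; apply: divr_ge0 => //; apply: mulr_ge0 C0.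
      by apply: mulr_ge0.
  by exists l => N _; have := hl N; rewrite ler_norml; lra.
by exists g => N r r01; exact: hg.
Qed.

(** Also [1 + kap / ((z + a + s j) (z + b + s j))], the effect of one operator on the Mellin
    transform. The product over all [j] is the Gamma quotient with [(z + a) / s] and [(z + b) / s]
    above, [(z + de) / s] and [(z + rho) / s] below. *)
Let fac (z : R) j := (z + de + s%:R * j%:R) * (z + rho + s%:R * j%:R) /
  ((z + a + s%:R * j%:R) * (z + b + s%:R * j%:R)).

Let sj0 j : (0 : R) <= s%:R * j%:R. Proof. exact: mulr_ge0. Qed.

Let iter_moment n N : (2 <= n)%N ->
  moment01 (pair_iter N) n = moment01 f n * \prod_(j < N) fac n.+1%:R j.
Proof.
move=> n2; have n0 : (0 < n)%N by exact: leq_trans n2.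
elim: N => [|N IH]; first by rewrite big_ord0 mulr1.
have [H _] := iter_bd N.
have H1 := hardy_bdcont H (bj_gt0 N).
have H2 := hardy_bdcont H1 (aj_gt0 N).
rewrite /= (moment01D kap H H2 n0) big_ord_recr/= mulrA -IH.
have E1 := hardy_moment H (bj_gt0 N) n0.
have E2 := hardy_moment H1 (aj_gt0 N) n0.
have p1 : n.+1%:R + bj N != 0 by rewrite gt_eqF// addr_gt0.
have p2 : n.+1%:R + aj N != 0 by rewrite gt_eqF// addr_gt0.
have -> : moment01 (hardy (aj N) (hardy (bj N) (pair_iter N))) n =
   moment01 (pair_iter N) n / (n.+1%:R + bj N) / (n.+1%:R + aj N).
  rewrite -E1 -E2; move: p1 p2; move: (n.+1%:R + bj N) (n.+1%:R + aj N) (moment01 (hardy _ _) n) => x y M xn yn.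
  by field; rewrite xn yn.
rewrite /fac /kap; have -> : rho = a + b - de by rewrite -balance; ring.
move: p1 p2; rewrite /aj /bj; move: (s%:R * N%:R) (n.+1%:R) (moment01 _ n) => S z M; rewrite !addrA => p1 p2.
by field; rewrite p1 p2.
Qed.

Let fac_pos n j : (2 <= n)%N -> 0 < fac n.+1%:R j.
Proof.
by move=> n2; apply: divr_gt0; apply: mulr_gt0; apply: ltr_wpDr => //;
  [exact: de_pos|exact: rho_pos|exact: addr_gt0|exact: addr_gt0].
Qed.

(** The inverse factors have the same shape with [de, rho] and [a, b] exchanged, so
    [inv_sqr_prod_bound] bounds their product. The limit moment thereby stays positive, as the next
    insertion requires. *)
Let fac_prod_lower n : (2 <= n)%N -> exists2 c, 0 < c & forall N, c <= \prod_(j < N) fac n.+1%:R j.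
Proof.
move=> n2.
pose m' := Num.min 1 (Num.min (n.+1%:R + de) (n.+1%:R + rho)).
have m'0 : 0 < m' by rewrite /m' !lt_min ltr01 de_pos// rho_pos.
have m'1 : m' <= 1 by rewrite /m' ge_min lexx.
have md : m' <= n.+1%:R + de by rewrite /m' !ge_min lexx orbT.
have mr : m' <= n.+1%:R + rho by rewrite /m' !ge_min lexx !orbT.
pose K' := `|kap| / m' ^+ 2.
have K'0 : 0 <= K' by rewrite divr_ge0// exprn_ge0// ltW.
exists (expR (2 * K'))^-1; first by rewrite invr_gt0 expR_gt0.
move=> N; rewrite -[leRHS]invrK lef_pV2 ?posrE ?expR_gt0//; last first.
  by rewrite invr_gt0; apply: prodr_gt0 => j _; exact: fac_pos.
apply: le_trans (inv_sqr_prod_bound N K'0).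
rewrite -prodfV; apply: ler_prod => j _.
rewrite invr_ge0 (ltW (fac_pos _ n2))/=.
have dj : 0 < n.+1%:R + de + s%:R * j%:R by rewrite ltr_wpDr// de_pos.
have rj : 0 < n.+1%:R + rho + s%:R * j%:R by rewrite ltr_wpDr// rho_pos.
have mj : 0 < m' * j.+1%:R by rewrite mulr_gt0.
have H : `|kap| / ((n.+1%:R + de + s%:R * j%:R) * (n.+1%:R + rho + s%:R * j%:R)) <= K' / j.+1%:R ^+ 2.
  rewrite /K' -mulrA -invfM -exprMn; apply: ler_wpM2l => //.
  rewrite lef_pV2 ?posrE ?mulr_gt0 ?exprn_gt0//.
  by rewrite expr2; apply: ler_pM; rewrite ?(ltW mj)//; exact: shift_ge.
have E : (fac n.+1%:R j)^-1 = 1 - kap / ((n.+1%:R + de + s%:R * j%:R) * (n.+1%:R + rho + s%:R * j%:R)).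
  rewrite /fac invf_div /kap.
  have bE : b = de + rho - a by rewrite balance; ring.
  rewrite bE; move: dj rj; move: (n.+1%:R) (s%:R * j%:R) => z S dj rj; field.
  by rewrite !gt_eqF.
rewrite E lerD2l; apply: le_trans H; rewrite -mulNr; apply: ler_wpM2r.
  by rewrite invr_ge0 mulr_ge0// ltW.
by rewrite -normrN ler_norm.
Qed.

(** Raising [z] by [s] moves [fac] one index up, so the product telescopes to its end factors. Since
    [fac] tends to 1, the limit picks up the inverse of [fac z 0]. *)
Let fac_shift n N : (2 <= n)%N ->
  \prod_(j < N) fac (n + s).+1%:R j * fac n.+1%:R 0%N = \prod_(j < N) fac n.+1%:R j * fac n.+1%:R N.
Proof.
move=> n2.
have E j : fac (n + s).+1%:R j = fac n.+1%:R j.+1.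
  rewrite /fac -addSn natrD -(natr1 j).
  have X (x : R) : n.+1%:R + s%:R + x + s%:R * j%:R = n.+1%:R + x + s%:R * (j%:R + 1) by ring.
  by rewrite !X.
under eq_bigr do rewrite E.
by have := @big_ord_recl R 1 *%R N (fun j : 'I_N.+1 => fac n.+1%:R j); rewrite big_ord_recr/= => ->; rewrite mulrC.
Qed.

Let fac_cvg1 n : (2 <= n)%N -> (fun N => fac n.+1%:R N) @ \oo --> (1 : R).
Proof.
move=> n2.
have H : (fun N : nat => 1 + K / N.+1%:R * N.+1%:R^-1) @ \oo --> (1 + 0 * 0 : R).
  apply: cvgD; first exact: cvg_cst.
  by apply: cvgM; [exact: harmonic_tail_cvg0|exact: cvg_harmonic].
have H' : (fun N : nat => 1 - K / N.+1%:R * N.+1%:R^-1) @ \oo --> (1 - 0 * 0 : R).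
  apply: cvgB; first exact: cvg_cst.
  by apply: cvgM; [exact: harmonic_tail_cvg0|exact: cvg_harmonic].
rewrite mulr0 addr0 in H; rewrite mulr0 subr0 in H'.
apply: (squeeze_cvgr _ H' H); apply: nearW => N.
have aN : 0 < n.+1%:R + a + s%:R * N%:R by rewrite ltr_wpDr// addr_gt0.
have bN : 0 < n.+1%:R + b + s%:R * N%:R by rewrite ltr_wpDr// addr_gt0.
have E : fac n.+1%:R N = 1 + kap / ((n.+1%:R + a + s%:R * N%:R) * (n.+1%:R + b + s%:R * N%:R)).
  rewrite /fac /kap; have -> : rho = a + b - de by rewrite -balance; ring.
  move: aN bN; move: (n.+1%:R) (s%:R * N%:R) => z S aN bN.
  by field; rewrite !gt_eqF.
have Q : `|kap / ((n.+1%:R + a + s%:R * N%:R) * (n.+1%:R + b + s%:R * N%:R))| <= K / N.+1%:R * N.+1%:R^-1.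
  rewrite -mulrA -invfM -expr2; apply: le_trans (kap_le N).
  rewrite normrM normfV (gtr0_norm (mulr_gt0 aN bN)); apply: ler_wpM2l => //.
  rewrite lef_pV2 ?posrE ?mulr_gt0//; apply: ler_pM; rewrite ?(ltW (aj_gt0 _)) ?(ltW (bj_gt0 _))//.
    by rewrite -addrA lerDr.
  by rewrite -addrA lerDr.
by move: Q; rewrite E ler_norml => /andP[Q1 Q2]; rewrite !lerD2l Q1.
Qed.

(* One balanced pair of gamma quotients, realized as an infinite product of
   operators [1 + kap H_(a + s j) H_(b + s j)] on bounded functions. *)
Lemma pair_step (u : nat -> R) : (forall n, (2 <= n)%N ->
    0 < moment01 f n /\ moment01 f (n + s) = u n * moment01 f n) ->
  exists B' g, bdcont B' g /\ forall n, (2 <= n)%N -> 0 < moment01 g n /\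
    moment01 g (n + s) = u n * ((n.+1%:R + a) * (n.+1%:R + b) / ((n.+1%:R + de) * (n.+1%:R + rho))) * moment01 g n.
Proof.
move=> fu; have [g hg] := iter_limit.
have gB : bdcont (C + t 0%N) g.
  apply: (bdcont_unif_limit (u := pair_iter) (t := t)) => //; last exact: harmonic_tail_cvg0.
  by move=> N; have [] := iter_bd N.
exists (C + t 0%N), g; split => //.
have mcv n : (2 <= n)%N -> (fun N => moment01 f n * \prod_(j < N) fac n.+1%:R j) @ \oo --> moment01 g n.
  move=> n2; have n0 : (0 < n)%N by exact: leq_trans n2.
  apply/cvgrPdist_le => e e0.
  have T0 : t @ \oo --> 0 by exact: harmonic_tail_cvg0.
  move/cvgrPdist_le : T0 => /(_ _ e0); apply: filterS => N.
  rewrite sub0r normrN => tN; rewrite -iter_moment//.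
  apply: le_trans (le_trans _ (ler_norm _)) tN.
  by have [_ H] := iter_bd N; apply: (moment01_close gB H n0) => r r01; exact: hg.
move=> n n2; have [f0 fs] := fu n n2; split.
  have [c c0 hc] := fac_prod_lower n2.
  apply: (@lt_le_trans _ _ (moment01 f n * c)); first exact: mulr_gt0.
  have cv := mcv n n2; rewrite -(cvg_lim _ cv)//; apply: limr_ge; first by apply/cvg_ex; eexists; exact: cv.
  by apply: nearW => N; apply: ler_wpM2l; [exact: ltW|exact: hc].
have ns2 : (2 <= n + s)%N by exact: leq_trans (leq_addr _ _).
(* By [fac_shift] the sequences of [cv1] and [cv2] coincide; comparing their limits gives the ratio
   of the moments of [g]. *)
have cv1 : (fun N => moment01 f (n + s) * \prod_(j < N) fac (n + s).+1%:R j * (fac n.+1%:R 0%N * moment01 f n)) @ \oo -->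
   (moment01 g (n + s) * (fac n.+1%:R 0%N * moment01 f n)).
  by apply: cvgM; [exact: mcv|exact: cvg_cst].
have cv2 : (fun N => moment01 f (n + s) * (moment01 f n * \prod_(j < N) fac n.+1%:R j) * fac n.+1%:R N) @ \oo -->
   (moment01 f (n + s) * moment01 g n * 1).
  by apply: cvgM; [apply: cvgM; [exact: cvg_cst|exact: mcv]|exact: fac_cvg1].
have E : moment01 g (n + s) * (fac n.+1%:R 0%N * moment01 f n) = moment01 f (n + s) * moment01 g n * 1.
  rewrite -(cvg_lim _ cv1)// -(cvg_lim _ cv2)//; congr (limn _); apply/funext => N.
  have S := fac_shift N n2.
  transitivity (moment01 f (n + s) * moment01 f n *
    (\prod_(j < N) fac (n + s).+1%:R j * fac n.+1%:R 0%N)); first by ring.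
  by rewrite S; ring.
have fn : moment01 f n != 0 by rewrite gt_eqF.
have d1 : n.+1%:R + de != 0 by rewrite gt_eqF// de_pos.
have d2 : n.+1%:R + rho != 0 by rewrite gt_eqF// rho_pos.
have d3 : n.+1%:R + a != 0 by rewrite gt_eqF// addr_gt0.
have d4 : n.+1%:R + b != 0 by rewrite gt_eqF// addr_gt0.
move: E; rewrite fs mulr1 /fac mulr0 !addr0.
move: (n.+1%:R) d1 d2 d3 d4 => z1 d1 d2 d3 d4.
move: (moment01 g (n + s)) (moment01 g n) (moment01 f n) fn => x y w wn E.
have {E} E : x * ((z1 + de) * (z1 + rho) / ((z1 + a) * (z1 + b))) = u n * y.
  by apply: (mulIf wn); rewrite -(mulrA x) E mulrAC.
have F0 : (z1 + de) * (z1 + rho) / ((z1 + a) * (z1 + b)) != 0.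
  by rewrite mulf_neq0 ?invr_eq0 ?mulf_neq0.
apply: (mulIf F0); rewrite E; field.
by rewrite d1 d2 d3 d4.
Qed.

End PairStep.

(** * The initial profile of beta type *)

Section StartFunction.
Variable R : realType.
Local Notation leb := (@lebesgue_measure R).
Variables (be e : R) (s : nat).
Hypothesis be0 : 0 < be.
Hypothesis e0 : 0 <= e.
Hypothesis s0 : (0 < s)%N.

Definition beta_profile (r : R) := r `^ be * (1 - r ^+ s) `^ e.

Let base_gt0 (r : R) : 0 < r < 1 -> 0 < 1 - r ^+ s.
Proof. by move=> /andP[r0 r1]; rewrite subr_gt0 exprn_ilt1 ?(ltW r0)// -lt0n. Qed.

Let base_bd (r : R) : 0 < r <= 1 -> 0 <= 1 - r ^+ s <= 1.
Proof.
move=> /andP[r0 r1]; rewrite subr_ge0 exprn_ile1 ?(ltW r0)//.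
by rewrite gerBl exprn_ge0// ltW.
Qed.

Let powR_base_cvg1 (c : R) : 0 < c -> (1 - r ^+ s) `^ c @[r --> 1^'-] --> 0.
Proof.
move=> c0; apply/cvgr0Pnorm_le => d d0.
have H : (1 - r ^+ s) @[r --> 1^'-] --> (0 : R).
  rewrite (_ : 0 = 1 - 1 ^+ s); last by rewrite expr1n subrr.
  apply: cvgB; first exact: cvg_cst.
  by apply: cvg_at_left_filter; exact: exprn_continuous.
have d1 : 0 < d `^ c^-1 by rewrite powR_gt0.
move/cvgr0Pnorm_le : H => /(_ _ d1) H.
near=> r; rewrite ger0_norm ?powR_ge0//.
have r01 : 0 < r <= 1.
  apply/andP; split; near: r; last exact: nbhs_left_le.
  by apply: nbhs_left_gt.
have /andP[b0 b1] := base_bd r01.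
have -> : d = (d `^ c^-1) `^ c by rewrite -powRrM mulVf ?gt_eqF// powRr1// ltW.
apply: ge0_ler_powR; rewrite ?nnegrE ?(ltW c0) ?powR_ge0//.
have : `|1 - r ^+ s| <= d `^ c^-1 by near: r.
by rewrite ger0_norm.
Unshelve. all: by end_near.
Qed.

Let powR_base_cvg1' : (1 - r ^+ s) `^ e @[r --> 1^'-] --> (1 - 1 ^+ s) `^ e.
Proof.
rewrite expr1n subrr; move: e0; rewrite le_eqVlt => /orP[/eqP <-|e1].
  rewrite powRr0; under eq_fun do rewrite powRr0; exact: cvg_cst.
by rewrite powR0 ?gt_eqF//; exact: powR_base_cvg1.
Qed.

Let base_continuous (r c : R) : 0 < r < 1 -> {for r, continuous (fun x : R => (1 - x ^+ s) `^ c)}.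
Proof.
move=> r01; apply: (@continuous_comp _ _ _ (fun x : R => 1 - x ^+ s) (fun x : R => x `^ c)).
  by apply: (@cvgB R); [exact: cvg_cst|exact: exprn_continuous].
by apply: powR_continuous_at; exact: base_gt0.
Qed.

Lemma beta_profile_bdcont : bdcont 1 beta_profile.
Proof.
have one_powR (c : R) : 1 `^ c = 1 by rewrite powR1.
split.
- move=> r; rewrite in_itv/= => r01; apply: (@cvgM R); last exact: base_continuous.
  by apply: powR_continuous_at; case/andP: r01.
- apply: (@cvgM R); last exact: powR_base_cvg1'.
  by apply: cvg_at_left_filter; exact: powR_continuous_at.
move=> r r01; have /andP[b0 b1] := base_bd r01.
rewrite normrM !ger0_norm ?powR_ge0// -[leRHS](mulr1 1); apply: ler_pM; rewrite ?powR_ge0//.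
- rewrite -[leRHS](one_powR be); case/andP: r01 => r0 r1.
  by apply: ge0_ler_powR; rewrite ?nnegrE ?ler01// ltW.
- by rewrite -[leRHS](one_powR e); apply: ge0_ler_powR; rewrite ?nnegrE ?ler01.
Qed.

(** The integrand is nonnegative, and on [[1/4, 1/2]] each of its three factors is monotone, hence
    bounded below by its value at one end. *)
Lemma beta_profile_moment_gt0 n : (0 < n)%N -> 0 < moment01 beta_profile n.
Proof.
move=> n0; pose c : R := (1 / 4) `^ be * (1 - (1 / 2) ^+ s) `^ e * (1 / 4) ^+ n.
have h12 : 0 < (1 / 2 : R) < 1 by lra.
have c0 : 0 < c.
  rewrite /c !mulr_gt0 ?exprn_gt0 ?powR_gt0//; try lra.
  exact: base_gt0.
have cW := bdcont_moment_within beta_profile_bdcont n0.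
have iW : leb.-integrable `[0, 1] (EFin \o (fun r => beta_profile r * r ^+ n)).
  by apply: continuous_compact_integrable; [exact: segment_compact|exact: cW].
have sub : `[1 / 4, 1 / 2] `<=` (`[0, 1] : set R).
  by move=> x; rewrite /= !in_itv/= => /andP[h1 h2]; apply/andP; split; lra.
have P0 r : 0 <= r -> 0 <= beta_profile r * r ^+ n.
  by move=> r0; rewrite mulr_ge0 ?exprn_ge0// mulr_ge0 ?powR_ge0.
have mI : measurable (`[1 / 4, 1 / 2] : set R) by exact: measurable_itv.
apply: (@lt_le_trans _ _ (Rintegral leb `[1 / 4, 1 / 2] (fun=> c))).
  rewrite Rintegral_cst//; have /= -> := @lebesgue_measure_itv R `[1 / 4, 1 / 2].
  have h : (1 / 4 : R) < 1 / 2 by lra.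
  by rewrite lte_fin h/= mulr_gt0//; lra.
apply: (@le_trans _ _ (Rintegral leb `[1 / 4, 1 / 2] (fun r => beta_profile r * r ^+ n))).
  apply: le_Rintegral => //.
  - by apply: continuous_compact_integrable; [exact: segment_compact|move=> x; exact: cvg_cst].
  - exact: integrableS iW.
  move=> r; rewrite /= in_itv/= => /andP[h1 h2].
  have r0 : 0 < r by lra.
  have q0 : 0 <= (1 / 4 : R) by lra.
  have E1 : (1 / 4) `^ be <= r `^ be by apply: ge0_ler_powR; rewrite ?nnegrE ?(ltW be0) ?(ltW r0).
  have E2 : (1 - (1 / 2) ^+ s) `^ e <= (1 - r ^+ s) `^ e.
    apply: ge0_ler_powR; rewrite ?nnegrE//; first by rewrite ltW// base_gt0.
      by rewrite ltW// base_gt0// r0; lra.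
    by rewrite lerD2l lerN2; apply: lerXn2r; rewrite ?nnegrE ?(ltW r0)//; lra.
  have E3 : (1 / 4) ^+ n <= r ^+ n by apply: lerXn2r; rewrite ?nnegrE ?(ltW r0).
  rewrite /c /beta_profile; apply: ler_pM => //; rewrite ?mulr_ge0 ?powR_ge0 ?exprn_ge0//.
  by apply: ler_pM; rewrite ?powR_ge0.
rewrite /moment01 /Rintegral; apply: fine_le.
- by apply: integrable_fin_num => //; apply: integrableS iW.
- by apply: integrable_fin_num.
apply: ge0_subset_integral => //.
- by case/integrableP: iW.
- by move=> x; rewrite /= in_itv/= => /andP[x0 _]; rewrite lee_fin P0.
Qed.

(** The recursion of the Beta function: the difference of the two sides is the integral of the
    derivative of [r^(n + 1 + be) (1 - r^s)^(e + 1)], which vanishes at 0 and at 1. *)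
Lemma beta_profile_moment_shift n : (0 < n)%N ->
  (n.+1%:R + be + s%:R * (1 + e)) * moment01 beta_profile (n + s) =
  (n.+1%:R + be) * moment01 beta_profile n.
Proof.
move=> n0; have n1 : (0 < n + s)%N by rewrite addn_gt0 n0.
have c1 := bdcont_moment_within beta_profile_bdcont n0.
have c2 := bdcont_moment_within beta_profile_bdcont n1.
have i1 : leb.-integrable `[0, 1] (EFin \o (fun r => beta_profile r * r ^+ n)).
  by apply: continuous_compact_integrable; [exact: segment_compact|exact: c1].
have i2 : leb.-integrable `[0, 1] (EFin \o (fun r => beta_profile r * r ^+ (n + s))).
  by apply: continuous_compact_integrable; [exact: segment_compact|exact: c2].
have m01 : measurable (`[0, 1] : set R) by exact: measurable_itv.
pose W (r : R) := r ^+ n.+1 * (r `^ be * (1 - r ^+ s) `^ (e + 1)).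
pose g (r : R) := (n.+1%:R + be) * (beta_profile r * r ^+ n) -
  (n.+1%:R + be + s%:R * (1 + e)) * (beta_profile r * r ^+ (n + s)).
have dX k (r : R) : is_derive r (1:R) (fun x : R => x ^+ k) (k%:R * r ^+ k.-1).
  rewrite (_ : (fun y : R => y ^+ k) = (@id R ^+ k)); last by apply/funext => y; rewrite exprfctE.
  by apply: is_derive_eq; rewrite /GRing.scale/= mulr1.
have dW (r : R) : 0 < r < 1 -> is_derive r (1:R) W (g r).
  move=> r01; case/andP: (r01) => r0 r1.
  have b0 := base_gt0 r01.
  have H1 := is_derive1_powR be r0.
  have H2 : is_derive r (1:R) (fun x : R => 1 - x ^+ s) (- (s%:R * r ^+ s.-1)).
    by have := is_deriveB (is_derive_cst (1:R) r (1:R)) (dX s r); rewrite sub0r.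
  have H3 := @is_derive1_comp R (fun y => y `^ (e + 1)) (fun y => 1 - y ^+ s) r _ _ (is_derive1_powR (e + 1) b0) H2.
  have K := is_deriveM (dX n.+1 r) (is_deriveM H1 H3); apply: (is_derive_eq K).
  rewrite -[(_ * (_ \o _)) r]/(r `^ be * (1 - r ^+ s) `^ (e + 1)).
  rewrite /GRing.scale/= /g /beta_profile.
  have -> : (1 - r ^+ s) `^ (e + 1 - 1) = (1 - r ^+ s) `^ e by congr (_ `^ _); ring.
  have -> : r `^ (be - 1) = r `^ be * r^-1.
    by rewrite powRB ?powRr1 ?(ltW r0)//; rewrite (gt_eqF r0) implybT.
  have -> : (1 - r ^+ s) `^ (e + 1) = (1 - r ^+ s) `^ e * (1 - r ^+ s).
    by rewrite powRD ?powRr1 ?(ltW b0)//; rewrite (gt_eqF b0) implybT.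
  have -> : r ^+ s.-1 = r ^+ s * r^-1.
    by rewrite -{2}(prednK s0) exprSr mulfK ?gt_eqF.
  have rn : r != 0 by rewrite gt_eqF.
  rewrite exprS exprD.
  move: (r ^+ s) (r ^+ n) (r `^ be) (n.+1%:R) ((1 - _) `^ e) => S N b N1 b1.
  by field.
have E : Rintegral leb `[0, 1] g = 0.
  rewrite /Rintegral (@continuous_FTC2 R _ W)//.
  - by rewrite /W expr0n/= mul0r !expr1n subrr powR0 ?gt_eqF ?ltr_wpDl// !mulr0 /= subrr.
  - move=> x; apply: (@cvgB R); first by apply: (@cvgM R); [exact: cvg_cst|exact: c1].
    by apply: (@cvgM R); [exact: cvg_cst|exact: c2].
  - split.
    + by move=> x; rewrite in_itv/= => x01; have [] := dW x x01.
    + rewrite /W expr0n mul0r; under eq_fun do rewrite mulrC; apply: (@cvg_bounded_mul0 R _ _ _ _ 1).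
        near=> x; rewrite normrM !ger0_norm ?powR_ge0//.
        have /andP[x0 x1] : 0 < x <= 1.
          by apply/andP; split; near: x; [exact: nbhs_right_gt|exact: nbhs_right_le].
        have /andP[b0 b1] : 0 <= 1 - x ^+ s <= 1 by apply: base_bd; rewrite x0.
        have one_powR (c : R) : 1 `^ c = 1 by rewrite powR1.
        rewrite -[leRHS](mulr1 1); apply: ler_pM; rewrite ?powR_ge0//.
          by rewrite -[leRHS](one_powR be); apply: ge0_ler_powR; rewrite ?nnegrE ?ler01// ltW.
        by rewrite -[leRHS](one_powR (e + 1)); apply: ge0_ler_powR; rewrite ?nnegrE ?ler01// addr_ge0.
      rewrite [X in _ --> X](_ : _ = 0 ^+ n.+1); last by rewrite expr0n.
      by apply: cvg_at_right_filter; exact: exprn_continuous.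
    + rewrite /W (expr1n _ s) subrr powR0 ?gt_eqF ?ltr_wpDl// !mulr0.
      rewrite -(mulr0 (1 ^+ n.+1 * 1 `^ be)); under eq_fun do rewrite mulrA.
      apply: cvgM; last by apply: powR_base_cvg1; rewrite ltr_wpDl.
      apply: cvgM; apply: cvg_at_left_filter; first exact: exprn_continuous.
      exact: powR_continuous_at.
  - by move=> x; rewrite in_itv/= => x01; rewrite derive1E; have [_ ->] := dW x x01.
have Z k h : leb.-integrable `[0, 1] (EFin \o h) -> leb.-integrable `[0, 1] (EFin \o (fun r : R => k * h r)).
  by move=> ih; have := @integrableZl _ _ _ leb `[0, 1] m01 k _ ih; apply: eq_integrable.
move: E; rewrite /g RintegralB//; [|exact: Z|exact: Z].
by rewrite !RintegralZl//; move/eqP; rewrite subr_eq0 => /eqP.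
Unshelve. all: by end_near.
Qed.
End StartFunction.

(** * Chaining the insertions *)

Section GammaQuotient.
Variable R : realType.
Implicit Types (l : seq (R * R)).

(** Inserting [(al, de)] turns the auxiliary parameter [rho] into [rho + de - al], so the auxiliary
    quotients telescope along the list. The bound on the sum of absolute values keeps every
    intermediate parameter positive, whatever the order of the signs. *)
Lemma pair_chain (s : nat) l : (0 < s)%N ->
  {in l, forall q, 0 < q.1 /\ forall n, (2 <= n)%N -> 0 < n.+1%:R + q.2} ->
  forall rho B (f : R -> R) (u : nat -> R), \sum_(q <- l) `|q.2 - q.1| < rho -> bdcont B f ->
  (forall n, (2 <= n)%N -> 0 < moment01 f n /\ moment01 f (n + s) = u n * moment01 f n) ->
  exists B' g, bdcont B' g /\ forall n, (2 <= n)%N -> 0 < moment01 g n /\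
    moment01 g (n + s) = u n * (\prod_(q <- l) ((n.+1%:R + q.1) / (n.+1%:R + q.2)) *
      ((n.+1%:R + rho + \sum_(q <- l) (q.2 - q.1)) / (n.+1%:R + rho))) * moment01 g n.
Proof.
move=> s0; elim: l => [|[al de] l IH] hl rho B f u.
  rewrite big_nil => rho0 fB fu; exists B, f; split=> // n n2; have [h1 h2] := fu n n2; split=> //.
  rewrite !big_nil addr0 divff; last by rewrite gt_eqF// addr_gt0.
  by rewrite !mulr1.
rewrite big_cons/= => hrho fB fu.
have [al0 de0] : 0 < al /\ forall n, (2 <= n)%N -> 0 < n.+1%:R + de by apply: (hl (al, de)); exact: mem_head.
have S0 : 0 <= \sum_(q <- l) `|q.2 - q.1| by apply: sumr_ge0.
have habs : - (de - al) <= `|de - al| by rewrite -normrN ler_norm.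
have rho0 : 0 < rho by apply: le_lt_trans hrho; rewrite addr_ge0.
have b0 : 0 < rho + de - al by lra.
have bal : de + rho = al + (rho + de - al) by ring.
have rp n : (2 <= n)%N -> 0 < n.+1%:R + rho by move=> _; rewrite addr_gt0.
have [B' [g [gB hg]]] := pair_step s0 fB al0 b0 bal de0 rp fu.
have hl' : {in l, forall q, 0 < q.1 /\ forall n, (2 <= n)%N -> 0 < n.+1%:R + q.2}.
  by move=> q ql; apply: hl; rewrite inE ql orbT.
have hrho' : \sum_(q <- l) `|q.2 - q.1| < rho + de - al by lra.
have [B2 [g2 [g2B hg2]]] := IH hl' _ _ _ _ hrho' gB hg.
exists B2, g2; split=> // n n2; have [h1 h2] := hg2 n n2; split=> //.
rewrite h2 !big_cons /=; congr (_ * _); rewrite -mulrA; congr (_ * _).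
have d1 : n.+1%:R + de != 0 by rewrite gt_eqF// de0.
have d2 : n.+1%:R + rho != 0 by rewrite gt_eqF// rp.
have d3 : n.+1%:R + (rho + de - al) != 0 by rewrite gt_eqF// addr_gt0.
move: (\prod_(q <- l) ((n.+1%:R + q.1) / (n.+1%:R + q.2))) (\sum_(q <- l) (q.2 - q.1)) (n.+1%:R) d1 d2 d3 => P S z d1 d2 d3.
by field; rewrite d1 d2 !addrA in d3 *; rewrite d3.
Qed.

Lemma gamma_quotient_moments (s : nat) (e : R) l : (0 < s)%N -> 0 <= e ->
  {in l, forall q, 0 < q.1 /\ forall n, (2 <= n)%N -> 0 < n.+1%:R + q.2} ->
  \sum_(q <- l) (q.2 - q.1) = s%:R * (1 + e) ->
  exists B (g : R -> R), bdcont B g /\ forall n, (2 <= n)%N -> 0 < moment01 g n /\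
    moment01 g (n + s) = \prod_(q <- l) ((n.+1%:R + q.1) / (n.+1%:R + q.2)) * moment01 g n.
Proof.
(* Starting from the profile with [be = rho], of ratio [(z + rho) / (z + rho + s (1 + e))], the
   auxiliary quotient of [pair_chain] is exactly the inverse, by the hypothesis on the total
   excess. *)
move=> s0 e0 hl hS; pose rho := 1 + \sum_(q <- l) `|q.2 - q.1|.
have rho0 : 0 < rho by rewrite ltr_pwDl// sumr_ge0.
have hrho : \sum_(q <- l) `|q.2 - q.1| < rho by rewrite /rho ltrDr.
have se0 : 0 <= s%:R * (1 + e) by rewrite mulr_ge0// addr_ge0.
have fu n : (2 <= n)%N -> 0 < moment01 (beta_profile rho e s) n /\
    moment01 (beta_profile rho e s) (n + s) =
    (n.+1%:R + rho) / (n.+1%:R + rho + s%:R * (1 + e)) * moment01 (beta_profile rho e s) n.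
  move=> n2; have n0 : (0 < n)%N by exact: leq_trans n2.
  split; first exact: beta_profile_moment_gt0.
  have d : n.+1%:R + rho + s%:R * (1 + e) != 0.
    by rewrite gt_eqF// ltr_pwDl// addr_gt0.
  apply: (mulfI d); rewrite beta_profile_moment_shift//.
  by rewrite mulrA mulrCA divff// mulr1.
have [B [g [gB hg]]] := pair_chain s0 hl hrho (beta_profile_bdcont rho0 e0 s0) fu.
exists B, g; split=> // n n2; have [h1 h2] := hg n n2; split=> //.
rewrite h2 hS; congr (_ * _).
have d1 : n.+1%:R + rho != 0 by rewrite gt_eqF// addr_gt0.
have d2 : n.+1%:R + rho + s%:R * (1 + e) != 0 by rewrite gt_eqF// ltr_pwDl// addr_gt0.
move: (\prod_(q <- l) ((n.+1%:R + q.1) / (n.+1%:R + q.2))) => P.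
move: (n.+1%:R + rho) (s%:R * (1 + e)) d1 d2 => x y d1 d2.
by field; rewrite d1 d2.
Qed.
End GammaQuotient.

(** * A profile with the prescribed products of moments *)

Section RootSymbol.
Variable R : realType.
Local Notation leb := (@lebesgue_measure R).

(** Dividing the identities at [l + 1] and at [l] leaves one ratio of moments at distance [2p],
    since the products overlap in all but their end factors. The ratios together with the case
    [l = 0] give everything. *)
Lemma root_moments (p m n : nat) (a : 'I_m -> R) (b : 'I_n -> R) (Lam : R -> R) :
  (0 < p)%N -> (m < n)%N -> (forall j, 0 < a j + p%:R + 1) -> (forall k, 0 < b k + p%:R - 1) ->
  (forall z, Lam z = \prod_(j < m) (z + a j) / \prod_(k < n) (z + b k)) ->
  exists B (g : R -> R), bdcont B g /\ forall l,
    \prod_(i < p) (2 * (l + i).+2%:R * moment01 g (2 * (l + i).+1)) =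
    2 * (l + p).+1%:R * Lam (2 * l + p + 2)%:R.
Proof.
move=> p0 mn ha hb hL; pose P : R := p%:R; have P0 : 1 <= P by rewrite ler1n.
pose la := [seq (P + 1 + a j, P - 1 + a j) | j <- index_enum 'I_m].
pose lb := [seq (P - 1 + b k, P + 1 + b k) | k <- index_enum 'I_n].
(* The head is the ratio [(k + 2) / (k + p + 1)] of the weights, rewritten with [z = 2 k + 3]; the
   other pairs come from the fraction at [z + p + 1] over its value at [z + p - 1]. *)
pose l := (1, 2 * P - 1) :: la ++ lb.
pose e := (n - m.+1)%:R / P.
have s0 : (0 < 2 * p)%N by rewrite muln_gt0.
have e0 : 0 <= e by rewrite divr_ge0// (le_trans ler01).
have hl : {in l, forall q, 0 < q.1 /\ forall n, (2 <= n)%N -> 0 < n.+1%:R + q.2}.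
  move=> q; rewrite inE mem_cat => /orP[/eqP ->|/orP[/mapP[j _ ->]|/mapP[k _ ->]]] /=; split.
  - exact: ltr01.
  - by move=> N N2; rewrite -natr1; have : (0 : R) <= N%:R by []; lra.
  - by have := ha j; rewrite -/P; lra.
  (* Here the shift [P - 1 + a j] is only known to exceed [-2]; the restriction to orders at least 2
     makes the sum positive. *)
  - move=> N N2; have : (2%:R : R) <= N%:R by rewrite ler_nat.
    by rewrite -natr1; have := ha j; rewrite -/P; lra.
  - by have := hb k; rewrite -/P; lra.
  - by move=> N _; rewrite -natr1; have : (0 : R) <= N%:R by []; have := hb k; rewrite -/P; lra.
have hS : \sum_(q <- l) (q.2 - q.1) = (2 * p)%:R * (1 + e).
  rewrite big_cons big_cat !big_map /=.
  have Ea : \sum_(j < m) (P - 1 + a j - (P + 1 + a j)) = \sum_(j < m) (- 2).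
    by apply: eq_bigr => j _; ring.
  have Eb : \sum_(k < n) (P + 1 + b k - (P - 1 + b k)) = \sum_(k < n) 2.
    by apply: eq_bigr => k _; ring.
  rewrite Ea Eb.
  rewrite !sumr_const !card_ord natrM -/P /e natrB// -[- 2 *+ m]mulr_natr -[2 *+ n]mulr_natr -natr1.
  by field; rewrite gt_eqF// (lt_le_trans ltr01).
have [B [g [gB hg]]] := gamma_quotient_moments s0 e0 hl hS.
have g0 k : (2 <= k)%N -> 0 < moment01 g k by move=> k2; have [] := hg k k2.
have zE (l0 : nat) : (2 * l0 + p + 2)%:R = 2 * l0%:R + P + 2 :> R.
  by rewrite -addnA natrD natrM (natrD _ p) addrA.
have zS (k : nat) : (2 * k.+1).+1%:R = 2 * k%:R + 3 :> R.
  by rewrite -natr1 natrM -(natr1 k); ring.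
have za (l0 : nat) j : 0 < (2 * l0 + p + 2)%:R + a j.
  by have := ha j; rewrite -/P; have : (0 : R) <= l0%:R by []; rewrite zE; lra.
have zb (l0 : nat) k : 0 < (2 * l0 + p + 2)%:R + b k.
  by have := hb k; rewrite -/P; have : (0 : R) <= l0%:R by []; rewrite zE; lra.
have Lam0 l0 : 0 < Lam (2 * l0 + p + 2)%:R.
  by rewrite hL; apply: divr_gt0; apply: prodr_gt0 => i _; [exact: za|exact: zb].
have Lam_step k : moment01 g (2 * (k + p).+1) = (k.+2%:R / (k + p).+1%:R) *
    (Lam (2 * k.+1 + p + 2)%:R / Lam (2 * k + p + 2)%:R) * moment01 g (2 * k.+1).
  have k2 : (2 <= 2 * k.+1)%N by lia.
  have [_] := hg _ k2; rewrite (_ : 2 * k.+1 + 2 * p = 2 * (k + p).+1)%N; last by lia.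
  move=> ->; congr (_ * _); rewrite big_cons big_cat !big_map /=.
  congr (_ * _).
    rewrite zS (_ : (k + p).+1%:R = k%:R + P + 1); last by rewrite -natr1 natrD.
    rewrite (_ : k.+2%:R = k%:R + 2); last by rewrite -addn2 natrD.
    have k0 : (0 : R) <= k%:R by [].
    field; apply/andP; split; apply/eqP; lra.
  rewrite !hL !prodf_div invf_div.
  have EA : \prod_(i < m) ((2 * k.+1).+1%:R + (P + 1 + a i)) = \prod_(j < m) ((2 * k.+1 + p + 2)%:R + a j).
    by apply: eq_bigr => i _; rewrite zS zE -?(natr1 _ k); ring.
  have EB : \prod_(i < n) ((2 * k.+1).+1%:R + (P + 1 + b i)) = \prod_(j < n) ((2 * k.+1 + p + 2)%:R + b j).
    by apply: eq_bigr => i _; rewrite zS zE -?(natr1 _ k); ring.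
  have EA' : \prod_(i < m) ((2 * k.+1).+1%:R + (P - 1 + a i)) = \prod_(j < m) ((2 * k + p + 2)%:R + a j).
    by apply: eq_bigr => i _; rewrite zS zE -?(natr1 _ k); ring.
  have EB' : \prod_(i < n) ((2 * k.+1).+1%:R + (P - 1 + b i)) = \prod_(j < n) ((2 * k + p + 2)%:R + b j).
    by apply: eq_bigr => i _; rewrite zS zE -?(natr1 _ k); ring.
  by rewrite EA EB EA' EB' -!mulrA; congr (_ * _); rewrite mulrC -!mulrA [RHS]mulrCA.
pose Om := \prod_(i < p) (2 * i.+2%:R * moment01 g (2 * i.+1)).
have Om0 : 0 < Om by apply: prodr_gt0 => i _; rewrite !mulr_gt0// g0//; lia.
(* Scaling [g] by [c] multiplies every product of [p] moments by [c ^ p], which settles the case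
   [l = 0]; a real root exists because [Lam] and [Om] are positive. *)
pose c := (2 * p.+1%:R * Lam (2 * 0 + p + 2)%:R / Om) `^ p%:R^-1.
have c0 : 0 < c by rewrite powR_gt0// divr_gt0// !mulr_gt0.
have cp : c ^+ p * Om = 2 * p.+1%:R * Lam (2 * 0 + p + 2)%:R.
  rewrite -powR_mulrn ?(ltW c0)// -powRrM mulVf ?pnatr_eq0 -?lt0n//.
  by rewrite powRr1 ?divfK ?gt_eqF// ltW// divr_gt0// !mulr_gt0.
(* This is [c * g], written as a sum so that [bdcontD] and [moment01D] apply. *)
exists (B + `|c - 1| * B), (fun r => g r + (c - 1) * g r); split; first exact: bdcontD.
have cE k : (0 < k)%N -> moment01 (fun r => g r + (c - 1) * g r) k = c * moment01 g k.
  by move=> k0; rewrite (moment01D _ gB gB k0); ring.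
elim=> [|k IH].
  rewrite -cp /Om; under eq_bigr do rewrite cE// mulrCA.
  by rewrite big_split/= prodr_const card_ord.
pose w i := 2 * (k + i).+2%:R * moment01 (fun r => g r + (c - 1) * g r) (2 * (k + i).+1).
have w0 : w 0%N != 0 by rewrite /w cE// gt_eqF// !mulr_gt0// g0//; lia.
rewrite (eq_bigr (fun i : 'I_p => w i.+1)); last by move=> i _; rewrite /w addSnnS.
apply: (mulfI w0).
have -> : w 0%N * \prod_(i < p) w i.+1 = \prod_(i < p) w i * w p.
  have := @big_ord_recl R 1 *%R p (fun i : 'I_p.+1 => w i).
  by rewrite big_ord_recr/= => ->.
rewrite IH /w !cE// Lam_step addn0 addSn.
have h1 : Lam (2 * k + p + 2)%:R != 0 by rewrite gt_eqF.
have h2 : (k + p).+1%:R != 0 :> R by rewrite pnatr_eq0.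
move: (Lam (2 * k + p + 2)%:R) (Lam (2 * k.+1 + p + 2)%:R) ((k + p).+1%:R) ((k + p).+2%:R) (k.+2%:R) (moment01 g _) h1 h2 => x y u v w1 M h1 h2.
by field; rewrite h1 h2.
Qed.
End RootSymbol.

(** * The root *)

Section IterateToeplitz.
Variable R : realType.
Implicit Types (h : R[i] -> R[i]) (c : nat -> R[i]) (psi phi : R -> R[i]).

Lemma iter_toeplitz_pseries psi q k h c : bounded_radial psi -> bergman h -> has_pseries h c ->
  bergman (iter k (toeplitz (quasihomogeneous q psi)) h) /\
  has_pseries (iter k (toeplitz (quasihomogeneous q psi)) h) (iter k (toeplitz_coef q psi) c).
Proof.
move=> bpsi bh hc; elim: k => [//|k [IH1 IH2]]; rewrite !iterS.
exact: toeplitz_pseries.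
Qed.

(** Factor [i] is the weight of the step from index [j - k + i] to the next one. Only moments of
    even order at least 2 occur; for [j < k] both sides are 0 because of [shift]. *)
Lemma iter_toeplitz_coef psi k c j : iter k (toeplitz_coef 1 psi) c j =
  shift k c j * \prod_(i < k) (2 * (j - k + i).+2%:R * moment psi (2 * (j - k + i).+1)).
Proof.
elim: k j => [|k IH] j; first by rewrite big_ord0 mulr1 /shift ltn0 subn0.
rewrite iterS /toeplitz_coef; case: j => [|j]; first by rewrite /shift !ltn0Sn mulr0 !mul0r.
rewrite [shift 1 _ _]/shift ltnS ltn0 subn1 /= IH /shift ltnS subSS.
have [jk|kj] := ltnP j k; first by rewrite !(mul0r, mulr0).
by rewrite big_ord_recr/= subnK// addnK; ring.
Qed.

Lemma mellin_natr phi n : mellin phi n.+1%:R = moment phi n.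
Proof.
have E : (n.+1%:R - 1 : R[i]) = (n%:R)%:C by rewrite -natr1 addrK rmorph_nat.
rewrite /mellin /moment E; apply: complex_eqP; apply: eq_Rintegral => r;
  rewrite inE/= in_itv/= => /andP[r0 _]; congr (_ (_ * _)); rewrite /rpowc/= mul0r cos0 sin0;
  rewrite powR_mulrn ?(ltW r0)//; exact: mulr1.
Qed.

Lemma bounded_radial_real B (g : R -> R) : bdcont B g -> bounded_radial (fun r => (g r)%:C).
Proof.
move=> [cg _ gB]; split.
- apply: (@measurable_fun_itv_co R 0 1 false true).
  apply: open_continuous_measurable_fun; first exact: interval_open.
  by move=> x; rewrite inE => /= x01; exact: cg.
- exact: measurable_cst.
(* [bdcont] says nothing at 0, so the value there enters the bound separately. *)
exists (Num.max `|g 0| B) => r /andP[r0 r1]; rewrite normcR le_max.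
move: r0; rewrite le_eqVlt => /orP[/eqP <-|r0]; first by rewrite lexx.
by rewrite gB ?orbT// r0 ltW.
Qed.

Lemma moment_real B (g : R -> R) n : bdcont B g -> (0 < n)%N ->
  moment (fun r => (g r)%:C) n = (moment01 g n)%:C.
Proof.
move=> gB n0; have iG := bdcont_moment_int gB n0.
have i2 : lebesgue_measure.-integrable `[0, 1[ (EFin \o (fun r => g r * r ^+ n)).
  by apply: integrableS iG => //; apply: subset_itvl; rewrite bnd_simp.
have i3 : lebesgue_measure.-integrable `]0, 1[ (EFin \o (fun r => g r * r ^+ n)).
  by apply: integrableS i2 => //; apply: subset_itvr; rewrite bnd_simp.
rewrite /moment01 -(Rintegral_itv_bndo_bndc i2) -(Rintegral_itv_obnd_cbnd i3).
rewrite /moment; apply: complex_eqP => /=.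
  by apply: eq_Rintegral => r _; rewrite mul0r subr0.
transitivity (Rintegral lebesgue_measure `]0, 1[ (fun=> 0 : R)).
  by apply: eq_Rintegral => r _; rewrite mulr0 mul0r addr0.
by rewrite Rintegral_cst// mul0r.
Qed.

(** In the order of [R[i]], being positive includes being real. The hypotheses on [A_j] and [B_k]
    therefore yield that all [a_j] and [b_k] are real. *)
Lemma complex_gt0_div (x : R[i]) (k : nat) : (0 < k)%N -> 0 < x / (2 * k%:R) ->
  complex.Im x = 0 /\ 0 < complex.Re x.
Proof.
move=> k0; rewrite pmulr_lgt0 ?invr_gt0 ?mulr_gt0 ?ltr0n//.
by rewrite ltcE/= => /andP[/eqP hx ->]; split.
Qed.
End IterateToeplitz.

Theorem mainTheorem1 (R : realType) (p m n : nat) (phi : R -> R[i])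
    (a : 'I_m -> R[i]) (b : 'I_n -> R[i])
    (hp : (1 <= p)%N) (hm : (1 <= m)%N) (hmn : (m < n)%N)
    (hphi : bounded_radial phi)
    (hmellin : forall z : R[i], 2 < complex.Re z ->
       \prod_(k < n) (z + b k) != 0 ->
       mellin phi z = (\prod_(j < m) (z + a j)) / (\prod_(k < n) (z + b k)))
    (hA : forall j : 'I_m, 0 < (a j + p%:R + 1) / (2 * p%:R))
    (hB : forall k : 'I_n, 0 < (b k + p%:R - 1) / (2 * p%:R)) :
  exists psi : R -> R[i],
    bounded_radial psi /\
    forall h : R[i] -> R[i], bergman h ->
      forall z : R[i], disk z ->
        iter p (toeplitz (quasihomogeneous 1 psi)) h z =
        toeplitz (quasihomogeneous p phi) h z.
Proof.
pose al j := complex.Re (a j); pose be k := complex.Re (b k).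
pose P : R := p%:R.
have natC k : (k%:R : R[i]) = (k%:R : R)%:C by rewrite rmorph_nat.
have toC (u v : R) : u%:C + v%:C = (u + v)%:C by rewrite rmorphD.
have ha j : a j = (al j)%:C /\ 0 < al j + P + 1.
  have [] := complex_gt0_div hp (hA j); rewrite natC !ImcD !RecD /= !addr0 => h1 h2; split=> //; exact: complex_eqP.
have hb k : b k = (be k)%:C /\ 0 < be k + P - 1.
  have [] := complex_gt0_div hp (hB k); rewrite natC !ImcD !RecD !ImcN !RecN /= oppr0 !addr0 => h1 h2; split=> //; exact: complex_eqP.
pose Lam z := \prod_(j < m) (z + al j) / \prod_(k < n) (z + be k).
have [B [g [gB hg]]] := root_moments hp hmn (fun j => (ha j).2) (fun k => (hb k).2) (Lam := Lam) (fun=> erefl).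
have phiE l : moment phi (2 * l + p + 1) = (Lam (2 * l + p + 2)%:R)%:C.
  rewrite -mellin_natr -addnS.
  pose x : R := (2 * l + p + 2)%:R.
  have ea j : (2 * l + p + 2)%:R + a j = (x + al j)%:C by rewrite (ha j).1 natC toC.
  have eb k : (2 * l + p + 2)%:R + b k = (x + be k)%:C by rewrite (hb k).1 natC toC.
  have xl : 0 <= x - P - 2.
    have -> : x = (2 * l)%:R + P + 2 by rewrite /x -addnA (natrD _ (2 * l)) (natrD _ p) addrA.
    by have : (0 : R) <= (2 * l)%:R by []; lra.
  (* The point [2 l + p + 2] is at least 3, so it lies in the half-plane, and [b_k + p - 1 > 0]
     keeps the denominator away from 0 there. *)
  rewrite hmellin.
  - rewrite (eq_bigr _ (fun j _ => ea j)) (eq_bigr _ (fun k _ => eb k)) -!rmorph_prod.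
    by rewrite -[LHS](fmorph_div (real_complex R)).
  - by rewrite natC /= -/x; have : 1 <= P by [rewrite ler1n]; lra.
  - apply/prodf_neq0 => k _; rewrite eb.
    by rewrite (inj_eq (@complexI R)) gt_eqF//; have := (hb k).2; lra.
exists (fun r => (g r)%:C).
have bpsi := bounded_radial_real gB; split=> // h bh z dz.
have [c hc] := analytic_pseries bh.1.
have [_ h1] := iter_toeplitz_pseries 1 p bpsi bh hc.
have [_ h2] := toeplitz_pseries p hphi bh hc.
(* Both sides of the operator identity are sums of power series on the disk, so equality of the
   coefficients suffices. *)
suff E : iter p (toeplitz_coef 1 (fun r => (g r)%:C)) c = toeplitz_coef p phi c.
  by rewrite E in h1; exact: pseries_unique h1 h2 dz.
apply/funext => j; rewrite iter_toeplitz_coef /toeplitz_coef /shift.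
have [jp|pj] := ltnP j p; first by rewrite mul0r mulr0 mul0r.
have [l jE] : exists l, j = (l + p)%N by exists (j - p)%N; rewrite subnK.
rewrite jE addnK (_ : 2 * (l + p) + 1 - p = 2 * l + p + 1)%N; last by lia.
rewrite phiE mulrAC [RHS]mulrC; congr (_ * _).
have -> : 2 * (l + p).+1%:R * (Lam (2 * l + p + 2)%:R)%:C = (2 * (l + p).+1%:R * Lam (2 * l + p + 2)%:R)%:C.
  by rewrite !rmorphM !rmorph_nat.
rewrite -hg rmorph_prod; apply: eq_bigr => i _.
by rewrite (moment_real gB)// !rmorphM !rmorph_nat.
Qed.
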